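(* Suppose conditions (M1)-(M3) of the context hold. Fix $\mathcal{S}_n\subset\mathbb{R}^n$. Suppose there exist $z\in\mathbb{R}$, $\rho_0>0$ and $\epsilon_n\in[0,1/4)$ such that $$\mathbb{P}\Big(\min_{w\in\mathbb{R}^n}H^{\mathsf M}(w,G,\xi)\ge z+\rho_0\Big)\vee\mathbb{P}\Big(\min_{w\in\mathcal{S}_n}H^{\mathsf M}(w,G,\xi)\le z+2\rho_0\Big)\le\epsilon_n.$$ Then there exists $K=K(\lambda,\tau,M_{6+\delta;A},\delta,L_0)>0$ such that $$\mathbb{P}\big(\hat w_A^{\mathsf M}\in\mathcal{S}_n\big)\le4\epsilon_n+K\big(1+\lVert\mu_0\rVert_\infty^{6+\delta}+\rho_0^{-3}\big)\,n^{-(1\wedge\delta)/500}.$$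
   Context: Linear model $Y=A\mu_0+\xi$ with $\mu_0\in\mathbb{R}^n$, $A\in\mathbb{R}^{m\times n}$, $\xi\in\mathbb{R}^m$. Robust cost and robust regression error: $$H^{\mathsf M}(w,A,\xi)\equiv\frac1m\Big\{\sum_{i=1}^m\psi_0\big((Aw)_i-\xi_i\big)+\frac\lambda2\lVert w+\mu_0\rVert^2\Big\},\qquad\hat w_A^{\mathsf M}\equiv\arg\min_{w\in\mathbb{R}^n}H^{\mathsf M}(w,A,\xi).$$ $G\in\mathbb{R}^{m\times n}$ has i.i.d. $\mathcal N(0,1/m)$ entries and is independent of $\xi$. $a\vee b=\max\{a,b\}$, $a\wedge b=\min\{a,b\}$, $\lVert\cdot\rVert$ is the Euclidean norm. Conditions: (M1) $\tau\le m/n\le1/\tau$ for some $\tau\in(0,1)$, and $\lambda>0$. (M2) $\psi_0:\mathbb{R}\to\mathbb{R}_{\ge0}$ is convex with weak derivative $\psi_0'$ satisfying $|\psi_0(0)|\vee\operatorname{ess\,sup}|\psi_0'|\le L_0$ for some $L_0>0$. (M3) $A_0=\sqrt mA$ and $\xi_0=\xi$ are independent. The entries of $A_0$ are independent, mean $0$, variance $1$, with $M_{6+\delta;A}\equiv\max_{i\in[m],j\in[n]}\mathbb{E}|A_{0;ij}|^{6+\delta}<\infty$ for some $\delta\in(0,1)$. The entries of $\xi_0$ are independent. *)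

(* Defs.v *)
(* MathComp / MathComp-Analysis *)
From HB Require Import structures.
From mathcomp Require Export all_boot all_order all_algebra.
From mathcomp Require Export all_classical all_reals all_analysis ess_sup_inf.
Export Order.TTheory GRing.Theory Num.Theory.
Export numFieldNormedType.Exports.

Set Implicit Arguments.
Unset Strict Implicit.
Unset Printing Implicit Defensive.

Local Open Scope classical_set_scope.
Local Open Scope ring_scope.

Section cost.
Variables (R : realType) (m n : nat).

(* \sum_j v j 0 ^+ 2 is the squared Euclidean norm; the norm `|v| of
   MathComp-Analysis on matrices is the sup norm. *)
Definition robust_cost (psi : R -> R) (lambda : R) (mu0 w : 'cV[R]_n)
    (A : 'M[R]_(m, n)) (xi : 'cV[R]_m) : R :=
  m%:R^-1 * (\sum_(i < m) psi ((A *m w) i 0 - xi i 0)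
             + lambda / 2 * \sum_(j < n) (w + mu0) j 0 ^+ 2).

(* The minimum of the cost over S, as an infimum in the extended reals, so that
   it is +oo for S empty and makes sense when it is not attained in S. *)
Definition min_cost (psi : R -> R) (lambda : R) (mu0 : 'cV[R]_n)
    (A : 'M[R]_(m, n)) (xi : 'cV[R]_m) (S : set 'cV[R]_n) : \bar R :=
  ereal_inf [set (robust_cost psi lambda mu0 w A xi)%:E | w in S].

(* The argmin over the whole space, with the junk value 0 if there is no
   minimizer; for lambda > 0 and psi nonnegative and convex there is exactly
   one. *)
Definition robust_argmin (psi : R -> R) (lambda : R) (mu0 : 'cV[R]_n)
    (A : 'M[R]_(m, n)) (xi : 'cV[R]_m) : 'cV[R]_n :=
  xget 0 [set w | forall v,
    robust_cost psi lambda mu0 w A xi <= robust_cost psi lambda mu0 v A xi].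

End cost.

Section weak_derivative.
Variable R : realType.

Definition test_function (phi : R -> R) : Prop :=
  (forall k x, derivable (phi^`(k))%classic x 1) /\
  (exists r : R, forall x, r < `|x| -> phi x = 0).

Definition weak_derivative (f df : R -> R) : Prop :=
  [/\ locally_integrable [set: R] f,
      locally_integrable [set: R] df &
      forall phi, test_function phi ->
        \int[lebesgue_measure]_x (f x * phi^`()%classic x) =
        - \int[lebesgue_measure]_x (df x * phi x)].

End weak_derivative.

Section independence.
Context d (T : measurableType d) (R : realType) (P : probability T R).

(* With measurable sets B i allowed to be the whole line, the product rule over
   all of I contains the product rule over every subfamily. *)
Definition mutually_independent (I : finType) (X : I -> T -> R) : Prop :=
  forall B : I -> set R, (forall i, measurable (B i)) ->
    P (\bigcap_i (X i @^-1` B i)) =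
    \big[*%E/1%E]_(i : I) P (X i @^-1` B i).

Definition sigma_family (I : Type) (X : I -> T -> R) : set (set T) :=
  <<s [set E | exists i (B : set R), measurable B /\ E = X i @^-1` B] >>.

Definition independent_families (I J : Type) (X : I -> T -> R) (Y : J -> T -> R)
    : Prop :=
  forall E F, sigma_family X E -> sigma_family Y F ->
    P (E `&` F) = (P E * P F)%E.

End independence.

Section conditions.
Context d (T : measurableType d) (R : realType) (P : probability T R).
Variables (m n : nat).

Definition random_mx (X : 'I_m -> 'I_n -> {RV P >-> R}) (t : T) : 'M[R]_(m, n) :=
  \matrix_(i, j) X i j t.

Definition random_cV (X : 'I_m -> {RV P >-> R}) (t : T) : 'cV[R]_m :=
  \col_i X i t.

(* As division by 0 gives 0, the bounds force m and n to be positive. *)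
Definition condM1 (tau lambda : R) : Prop :=
  [/\ 0 < tau < 1, tau <= m%:R / n%:R <= tau^-1 & 0 < lambda].

Definition condM2 (psi : R -> R) (L0 : R) : Prop :=
  [/\ forall x, 0 <= psi x,
      convex_function [set: R] psi &
      exists2 dpsi : R -> R, weak_derivative psi dpsi &
        (maxe `|psi 0|%:E
              (ess_sup lebesgue_measure (fun x => `|dpsi x|%:E)) <= L0%:E)%E].

Definition normalized_mx (A : 'I_m -> 'I_n -> {RV P >-> R})
    (ij : 'I_m * 'I_n) (t : T) : R :=
  Num.sqrt m%:R * A ij.1 ij.2 t.

Definition condM3 (A : 'I_m -> 'I_n -> {RV P >-> R}) (xi : 'I_m -> {RV P >-> R})
    (delta M : R) : Prop :=
  let A0 := normalized_mx A in
  [/\ independent_families P A0 (fun i => xi i : T -> R),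
      mutually_independent P A0 /\
        mutually_independent P (fun i => xi i : T -> R),
      forall ij, 'E_P[A0 ij]%E = 0%:E /\ 'V_P[A0 ij]%E = 1%:E,
      0 < delta < 1 &
      \big[maxe/0%:E]_(ij : 'I_m * 'I_n)
        'E_P[fun t => (`|A0 ij t| `^ (6 + delta))%R]%E = M%:E].

(* normal_prob takes the standard deviation as its second parameter. *)
Definition gaussian_design (G : 'I_m -> 'I_n -> {RV P >-> R})
    (xi : 'I_m -> {RV P >-> R}) : Prop :=
  let G1 (ij : 'I_m * 'I_n) := G ij.1 ij.2 : T -> R in
  [/\ mutually_independent P G1,
      forall i j (B : set R), measurable B ->
        distribution P (G i j) B = normal_prob 0 (Num.sqrt m%:R)^-1 B &
      independent_families P G1 (fun i => xi i : T -> R)].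

End conditions.

(* Main.v *)
(* The loss [psi0] is [L0]-Lipschitz, so it is uniformly close to a smooth function.
   Restricting the cost to a box of side [B] (a small power of [n]) and to a finite
   net, its minimum becomes a soft minimum, a smooth function of the design whose
   third derivative in each entry is [1 / m] up to a small power of [n].  The
   Lindeberg replacement of the entries of [A] by those of [G], which share two
   moments, then compares the laws of the minimal costs over an arbitrary subset of
   the box, up to [O(rho0)] in the cost.  The minimizers stay in the box with high
   probability: by a leave-one-out comparison, [w j] is controlled by
   [\sum_i A i j s_i] with [s] bounded and independent of the column [j], and
   Chernoff's bound applies.  If the minimizer for [A] lies in [S], then, off these
   rare events, either the minimal cost for [A] is large or the minimum over the
   boxed part of [S] is small; both transfer to [G], where they are excluded by
   hypothesis. *)
From HB Require Import structures.
Require Import Defs.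
From mathcomp Require Import ring lra zify measurable_realfun.

Set Implicit Arguments.
Unset Strict Implicit.
Unset Printing Implicit Defensive.

Local Open Scope classical_set_scope.
Local Open Scope ring_scope.

(** * Derivatives and smoothing of Lipschitz functions *)

(** The scales pull against each other. With inverse temperature [b] and box side [B], replacing all
    [m n] entries costs about [m n (m b)^-1 (b B)^3 m^(-3/2)], which is [b^2 B^3 / sqrt n] when [m]
    and [n] are comparable; the soft minimum over a net of [exp (O(n ln n))] points errs by
    [O(ln n / b)]; and [B] must be so large that [n exp (- c B)] vanishes. With [y = n^(1/40)], the
    choices [b = y^2] and [B = y^5] make all these errors [O(1 / y)]. The cubic Taylor remainder is
    controlled by [|x|^3 <= x^6 / t + t] with [t = m^(-3/2)], so sixth moments take the place of
    absolute third moments. The noise may be arbitrarily large: both designs share it, and it acts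
    only through bounded derivatives of the loss and a step function with values in [0, 1]. A large
    [mu0] would not fit in the box and a small [rho0] would be lost in the approximation, but then
    the asserted bound exceeds 1. *)

Section derivative_rules.
Context {R : realType}.
Implicit Types (f g : R -> R) (x : R).

Lemma isdD f g x a b : is_derive x 1 f a -> is_derive x 1 g b ->
  is_derive x 1 (fun y => f y + g y) (a + b).
Proof. by move=> *; exact: is_deriveD. Qed.

Lemma isdN f x a : is_derive x 1 f a -> is_derive x 1 (fun y => - f y) (- a).
Proof. by move=> *; exact: is_deriveN. Qed.

Lemma isdB f g x a b : is_derive x 1 f a -> is_derive x 1 g b ->
  is_derive x 1 (fun y => f y - g y) (a - b).
Proof. by move=> *; apply: isdD => //; exact: isdN. Qed.

Lemma isdM f g x a b : is_derive x 1 f a -> is_derive x 1 g b ->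
  is_derive x 1 (fun y => f y * g y) (a * g x + f x * b).
Proof.
by move=> fa gb; apply: (is_derive_eq (is_deriveM fa gb)); rewrite /GRing.scale/=; ring.
Qed.

Lemma isdC x (c : R) : is_derive x 1 (fun _ : R => c) 0.
Proof. exact: is_derive_cst. Qed.

Lemma isdI x : is_derive x 1 (fun y : R => y) 1.
Proof. exact: is_derive_id. Qed.

Lemma isdZ f x a c : is_derive x 1 f a -> is_derive x 1 (fun y => c * f y) (c * a).
Proof. by move=> fa; apply: (is_derive_eq (isdM (isdC x c) fa)); rewrite mul0r add0r. Qed.

Lemma isdX f x a n : is_derive x 1 f a ->
  is_derive x 1 (fun y => f y ^+ n) (n%:R * f x ^+ n.-1 * a).
Proof.
move=> fa; elim: n => [|n IH].
  by apply: (is_derive_eq (isdC x 1)); rewrite !mul0r.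
have -> : (fun y => f y ^+ n.+1) = fun y => f y * f y ^+ n.
  by apply/funext => y; rewrite exprS.
apply: (is_derive_eq (isdM fa IH)); case: n {IH} => [|n] /=; first by ring.
by rewrite [in RHS]exprS [X in a * X]exprS -(addn1 n.+1) natrD; ring.
Qed.

Lemma isd_comp f g x a b : is_derive (g x) 1 f a -> is_derive x 1 g b ->
  is_derive x 1 (fun y => f (g y)) (a * b).
Proof. by move=> fa gb; exact: is_derive1_comp. Qed.

Lemma isdV f x a : f x != 0 -> is_derive x 1 f a ->
  is_derive x 1 (fun y => (f y)^-1) (- (a / f x ^+ 2)).
Proof.
move=> fx fa; apply: (is_derive_eq (is_deriveV fx fa)).
by rewrite /GRing.scale/= mulNr mulrC.
Qed.

Lemma isd_sum (I : Type) (r : seq I) (P : pred I) (F : I -> R -> R) (dF : I -> R) x :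
  (forall i, is_derive x 1 (F i) (dF i)) ->
  is_derive x 1 (fun y => \sum_(i <- r | P i) F i y) (\sum_(i <- r | P i) dF i).
Proof.
move=> FdF; elim: r => [|i r IH].
  rewrite big_nil; have -> : (fun y => \sum_(i <- [::] | P i) F i y) = fun=> 0.
    by apply/funext => y; rewrite big_nil.
  exact: isdC.
rewrite big_cons.
have -> : (fun y => \sum_(j <- i :: r | P j) F j y) = fun y =>
    if P i then F i y + \sum_(j <- r | P j) F j y else \sum_(j <- r | P j) F j y.
  by apply/funext => y; rewrite big_cons.
by case: ifP => // _; exact: isdD.
Qed.

Lemma isd_continuous f df : (forall x, is_derive x 1 f (df x)) -> continuous f.
Proof.
move=> fdf x; apply/differentiable_continuous/derivable1_diffP.
exact: (@ex_derive _ _ _ _ _ _ _ (fdf x)).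
Qed.

Lemma MVT_global f df : (forall x, is_derive x 1 f (df x)) -> forall a b, a <= b ->
  exists2 c, a <= c <= b & f b - f a = df c * (b - a).
Proof.
move=> fdf a b ab.
have [c cab E] := @MVT_segment _ f df _ _ ab (fun x _ => fdf x)
  (continuous_subspaceT (isd_continuous fdf)).
by exists c => //; move: cab; rewrite in_itv.
Qed.

Lemma deriv_bound f df (K a b : R) : (forall x, is_derive x 1 f (df x)) ->
  (forall x, Num.min a b <= x <= Num.max a b -> `|df x| <= K) -> `|f b - f a| <= K * `|b - a|.
Proof.
move=> fdf dfK; case: (leP a b) => ab.
  have [c cab ->] := MVT_global fdf ab.
  by rewrite normrM ler_wpM2r// dfK// min_l// max_r.
have [c cab E] := MVT_global fdf (ltW ab).
rewrite distrC E distrC normrM ler_wpM2r// dfK//.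
by rewrite min_r ?max_l// ltW.
Qed.

(** The mean value bound is applied to [f2], then to the first-order remainder of [f1], then to the
    second-order remainder of [f]; each pass contributes a factor [|x|]. The 1/6 of Taylor's formula
    is given up. *)
Lemma taylor2_bound f f1 f2 f3 (K : R) : (forall x, is_derive x 1 f (f1 x)) ->
  (forall x, is_derive x 1 f1 (f2 x)) -> (forall x, is_derive x 1 f2 (f3 x)) ->
  (forall x, `|f3 x| <= K) ->
  forall x, `|f x - f 0 - f1 0 * x - f2 0 / 2 * x ^+ 2| <= K * `|x| ^+ 3.
Proof.
move=> df df1 df2 f3K.
have K0 : 0 <= K by rewrite (le_trans _ (f3K 0)).
have between (z x : R) : Num.min 0 x <= z <= Num.max 0 x -> `|z| <= `|x|.
  by case: (leP 0 x) => x0 /andP[z1 z2]; [rewrite !ger0_norm//; lra|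
    rewrite !ler0_norm ?lerN2//; lra].
have h2 x : `|f2 x - f2 0| <= K * `|x|.
  by rewrite -{2}(subr0 x); apply: (deriv_bound df2).
have h1 x : `|f1 x - f1 0 - f2 0 * x| <= K * `|x| * `|x|.
  pose g y := f1 y - f1 0 - f2 0 * y.
  have dg (y : R) : is_derive y 1 g (f2 y - f2 0).
    apply: (@is_derive_eq _ _ _ _ _ _ _ (f2 y - 0 - f2 0 * 1)); last by ring.
  have := @deriv_bound g _ (K * `|x|) 0 x dg.
  rewrite {1}/g subr0 [g 0]/g mulr0 !subrr subr0; apply => z /between zx.
  by rewrite (le_trans (h2 z))// ler_wpM2l.
move=> x; pose g y := f y - f 0 - f1 0 * y - f2 0 / 2 * y ^+ 2.
have dg (y : R) : is_derive y 1 g (f1 y - f1 0 - f2 0 * y).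
  apply: (@is_derive_eq _ _ _ _ _ _ _
     (f1 y - 0 - f1 0 * 1 - f2 0 / 2 * (2%:R * y ^+ 1 * 1))); last by field.
  rewrite /g; apply: isdB; last exact: isdZ (isdX _ (isdI _)).
have := @deriv_bound g _ (K * `|x| * `|x|) 0 x dg.
have -> : g x - g 0 = f x - f 0 - f1 0 * x - f2 0 / 2 * x ^+ 2 by rewrite /g; ring.
have -> : K * `|x| * `|x| * `|x - 0| = K * `|x| ^+ 3 by rewrite subr0; ring.
apply => z /between zx; rewrite (le_trans (h1 z))//.
by rewrite ler_pM ?mulr_ge0// ler_wpM2l.
Qed.

(** [F x] is the oriented integral from 0 to [x], written as a difference of two integrals from a
    common left end below both limits. By [shift] the left end is immaterial, so near a given point
    it can be frozen and the fundamental theorem on a bounded interval applies. *)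
Lemma continuous_antiderivative f : continuous f ->
  exists F : R -> R, forall x, is_derive x 1 F (f x).
Proof.
move=> cf.
have intf (a b : R) : lebesgue_measure.-integrable `[a, b] (EFin \o f).
  by apply: continuous_compact_integrable; [exact: segment_compact|
    exact: continuous_subspaceT].
pose I (a b : R) : R := \int[lebesgue_measure]_(t in `[a, b]) f t.
pose F x : R := I (- (`|x| + 1)) x - I (- (`|x| + 1)) 0.
have shift (a b u v : R) : b <= a -> a <= u -> a <= v ->
    I a u - I a v = I b u - I b v.
  move=> ba.
  wlog : u v / u <= v => [hw au av|uv au av].
    case: (leP u v) => [uv|/ltW vu]; first exact: hw.
    by have := hw _ _ vu av au; lra.
  have E (c : R) : c <= u -> I c v - I c u = \int[lebesgue_measure]_(t in `]u, v]) f t.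
    by move=> cu; apply: (Rintegral_itvB (a := BLeft c) (b := BRight v)).
  by have := E _ au; have := E _ (le_trans ba au); lra.
exists F => x.
pose K : R := `|x| + 2.
have xK : - K < x < K.
  by rewrite /K; have := ler_norm x; have := ler_norm (- x); rewrite normrN; lra.
have K0 : 0 < K by rewrite /K; have := normr_ge0 x; lra.
apply: (@near_eq_is_derive _ _ _ (fun y : R => I (- K) y - I (- K) 0)).
  near=> y.
  have yx : `|x - y| < 1 by near: y; exact: (@cvgr_dist_lt _ _ _ _ _ (fun z => z) x).
  rewrite /F; symmetry; apply: shift.
  - have := ler_normD (y - x) x; rewrite subrK (distrC y) /K; lra.
  - have := ler_norm (- y); rewrite normrN; lra.
  - by have := normr_ge0 y; lra.
have [dI EI] := @continuous_FTC1_closed _ f (- K) x K (andP xK).2 (intf _ _) (andP xK).1 (cf x).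
apply: (@is_derive_eq _ _ _ _ _ _ _ (f x - 0)); last by rewrite subr0.
apply: isdB (isdC _ _).
by split; [exact: dI|rewrite -derive1E; exact: EI].
Unshelve. all: by end_near. Qed.

Lemma lipschitz_continuous f (L : R) :
  (forall x y, `|f x - f y| <= L * `|x - y|) -> continuous f.
Proof.
move=> fL; have L0 : 0 <= L by have := le_trans (normr_ge0 _) (fL 1 0); rewrite subr0 normr1 mulr1.
move=> x; apply/cvgrPdist_lt => e e0; near=> y.
rewrite (le_lt_trans (fL _ _))//.
have : `|x - y| < e / (L + 1).
  near: y; apply: (@cvgr_dist_lt _ _ _ _ _ (fun z => z) x) => //.
  rewrite divr_gt0//; lra.
rewrite ltr_pdivlMr; last by lra.
by have := normr_ge0 (x - y); nra.
Unshelve. all: by end_near. Qed.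

Definition fdiff (h : R) f x := f (x + h) - f x.

Lemma isd_fdiff h f df : (forall x, is_derive x 1 f (df x)) ->
  forall x, is_derive x 1 (fdiff h f) (fdiff h df x).
Proof.
move=> fdf x; apply: isdB => //.
rewrite -[df (x + h)]mulr1; apply: (@isd_comp f (fun y => y + h) x _ 1 (fdf (x + h))).
exact: (is_derive_eq (isdD (isdI x) (isdC x h)) (addr0 1)).
Qed.

Lemma fdiff_MVT h f df : 0 <= h -> (forall x, is_derive x 1 f (df x)) ->
  forall x, exists2 c, x <= c <= x + h & fdiff h f x = h * df c.
Proof.
move=> h0 fdf x; have xh : x <= x + h by rewrite lerDl.
have [c cx E] := MVT_global fdf xh.
by exists c => //; rewrite /fdiff E; ring.
Qed.

(* [g] is the third difference quotient of a third antiderivative of [f], so it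
   is a local average of [f] and its k-th derivative is a k-th difference
   quotient of such averages. *)
Lemma lipschitz_smoothing f (L eta : R) : 0 < eta ->
  (forall x y, `|f x - f y| <= L * `|x - y|) ->
  exists g g1 g2 g3 : R -> R,
  [/\ [/\ forall x, is_derive x 1 g (g1 x), forall x, is_derive x 1 g1 (g2 x) &
           forall x, is_derive x 1 g2 (g3 x)],
      forall x, exists2 c, x <= c <= x + 3 * eta & g x = f c,
      [/\ forall x, `|g1 x| <= L, forall x, `|g2 x| <= 2 * L / eta &
           forall x, `|g3 x| <= 4 * L / eta ^+ 2] &
      forall x, exists c, g2 x = eta ^- 2 * (f (c + eta + eta) - 2 * f (c + eta) + f c)].
Proof.
move=> e0 fL; have e1 : eta != 0 by rewrite gt_eqF.
have [F1 dF1] := continuous_antiderivative (lipschitz_continuous fL).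
have [F2 dF2] := continuous_antiderivative (isd_continuous dF1).
have [F3 dF3] := continuous_antiderivative (isd_continuous dF2).
pose D := fdiff eta.
have dD := @isd_fdiff eta.
have D1 := fdiff_MVT (ltW e0).
have avg x : exists2 c, x <= c <= x + 3 * eta & D (D (D F3)) x = eta ^+ 3 * f c.
  have [c cx E] := D1 _ _ (dD _ _ (dD _ _ dF3)) x.
  have [c' cc' E'] := D1 _ _ (dD _ _ dF2) c.
  have [c2 cc2 E2] := D1 _ _ dF1 c'.
  exists c2; first by lra.
  by rewrite /D E E' E2; ring.
(* Each derivative taken removes one antiderivative, trading a factor [eta] for a difference of [f].
   The first difference is at most [L * eta], and each further one doubles the bound. *)
have d1 x : exists c, D (D (D F2)) x = eta ^+ 2 * D f c.
  have [c cx E] := D1 _ _ (dD _ _ (dD _ _ dF2)) x.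
  have [c' cc' E'] := D1 _ _ (dD _ _ dF1) c.
  by exists c'; rewrite /D E E'; ring.
have d2 x : exists c, D (D (D F1)) x = eta * D (D f) c.
  have [c cx E] := D1 _ _ (dD _ _ (dD _ _ dF1)) x.
  by exists c; rewrite /D E.
have Df x : `|D f x| <= L * eta.
  by rewrite (le_trans (fL _ _))// addrAC subrr add0r gtr0_norm.
have DDf x : `|D (D f) x| <= 2 * L * eta.
  by rewrite (le_trans (ler_normB _ _))//; have := Df x; have := Df (x + eta); lra.
have DDDf x : `|D (D (D f)) x| <= 4 * L * eta.
  by rewrite (le_trans (ler_normB _ _))//; have := DDf x; have := DDf (x + eta); lra.
have en n : 0 < eta ^+ n by rewrite exprn_gt0.
exists (fun x => eta ^- 3 * D (D (D F3)) x), (fun x => eta ^- 3 * D (D (D F2)) x),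
  (fun x => eta ^- 3 * D (D (D F1)) x), (fun x => eta ^- 3 * D (D (D f)) x); split.
- by split=> x; apply: isdZ; do 3 apply: isd_fdiff.
- by move=> x; have [c cx E] := avg x; exists c => //; rewrite E mulKf// gt_eqF.
- split=> x.
  + have [c ->] := d1 x; rewrite mulrA.
    have -> : eta ^- 3 * eta ^+ 2 = eta^-1 by field.
    by rewrite normrM gtr0_norm ?invr_gt0// mulrC ler_pdivrMr.
  + have [c ->] := d2 x; rewrite mulrA.
    have -> : eta ^- 3 * eta = eta^-1 ^+ 2 by field.
    have -> : 2 * L / eta = eta^-1 ^+ 2 * (2 * L * eta) by field.
    by rewrite normrM ger0_norm ?sqr_ge0// ler_wpM2l// sqr_ge0.
  + have -> : 4 * L / eta ^+ 2 = eta ^- 3 * (4 * L * eta) by field.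
    by rewrite normrM gtr0_norm ?invr_gt0// ler_wpM2l// invr_ge0 ltW.
- move=> x; have [c E] := d2 x; exists c; rewrite E /D /fdiff.
  by field.
Qed.

End derivative_rules.

(** * Lindeberg replacement for independent coordinates *)

Section coordinate_space.
Context {R : realType} {J : finType}.

Definition coordinate_sets : set (set (J -> R)) :=
  [set E | exists j (B : set R), measurable B /\ E = [set w | B (w j)]].

(** With the product sigma-algebra, measurability of a map into the space is checked coordinate by
    coordinate, and the design and the noise form one random element. *)
Definition coordinates := g_sigma_algebraType coordinate_sets.

HB.instance Definition _ := Measurable.on coordinates.

Definition rectangle (B : J -> set R) : set coordinates := [set w | forall j, B j (w j)].

Lemma measurable_coordinate j : measurable_fun setT (fun w : coordinates => w j).
Proof.
move=> _ B mB; rewrite setTI; apply: sub_sigma_algebra.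
by exists j, B.
Qed.

Lemma measurable_coordinates d (T : measurableType d) (X : T -> coordinates) :
  (forall j, measurable_fun setT (fun t => X t j)) -> measurable_fun setT X.
Proof.
move=> mX. apply: (@measurability _ _ T coordinates setT X coordinate_sets (erefl _)) => // _ [_ [j [B [mB ->]] <-]].
by have := mX j measurableT _ mB; rewrite setTI.
Qed.

Lemma measurable_rectangle B : (forall j, measurable (B j)) -> measurable (rectangle B).
Proof.
move=> mB; have -> : rectangle B = \bigcap_(j in [set: J]) [set w | B j (w j)].
  by apply/seteqP; split=> w /= wB j; [move=> _; exact: wB|exact: (wB j)].
apply: fin_bigcap_measurable => // j _.
by have := measurable_coordinate j measurableT (mB j); rewrite setTI.
Qed.

(** Rectangles are stable under intersection, contain the whole space and generate the
    sigma-algebra, so measures are determined by their values on them. *)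
Lemma eq_law_rectangle (m1 m2 : probability coordinates R) :
  (forall B, (forall j, measurable (B j)) -> m1 (rectangle B) = m2 (rectangle B)) ->
  forall E, measurable E -> m1 E = m2 E.
Proof.
move=> m12 E mE.
pose G : set (set coordinates) := [set rectangle B | B in [set B | forall j, measurable (B j)]].
have GT : G setT by exists (fun=> setT) => //; apply/seteqP; split.
apply: (@g_sigma_algebra_measure_unique _ _ _ G _ (fun=> setT)) => //.
- by move=> _ [B mB <-]; exact: measurable_rectangle.
- by rewrite bigcup_const.
- move=> _ _ [B mB <-] [C mC <-]; exists (fun j => B j `&` C j).
    by move=> j; exact: measurableI.
  apply/seteqP; split=> w /=; last by move=> [wB wC] j; split; [exact: wB|exact: wC].
  by move=> wBC; split=> j; case: (wBC j).
- by move=> _ [B mB <-]; exact: m12.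
- by move=> _; rewrite (le_lt_trans (probability_le1 _ _))// ltry.
- move: E mE; apply: sub_sigma_algebra2 => _ [j [B [mB ->]]].
  exists (fun k => if k == j then B else setT).
    by move=> k; case: ifP.
  apply/seteqP; split=> w /=; first by move/(_ j); rewrite eqxx.
  by move=> wB k; case: ifP => // /eqP ->.
Qed.

End coordinate_space.
Arguments coordinates : clear implicits.


Section same_law.
Context {R : realType} {J : finType} d1 d2 (T1 : measurableType d1) (T2 : measurableType d2).
Variables (P1 : probability T1 R) (P2 : probability T2 R).
Variables (X : T1 -> coordinates R J) (Y : T2 -> coordinates R J).
Hypotheses (mX : measurable_fun setT X) (mY : measurable_fun setT Y).
Hypothesis XY : forall B : J -> set R, (forall j, measurable (B j)) ->
  P1 (X @^-1` rectangle B) = P2 (Y @^-1` rectangle B).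

Lemma same_law_integral (Phi : coordinates R J -> \bar R) :
  measurable_fun setT Phi -> (forall w, 0 <= Phi w)%E ->
  (\int[P1]_t Phi (X t) = \int[P2]_t Phi (Y t))%E.
Proof.
move=> mPhi Phi0.
pose X' : {mfun T1 >-> coordinates R J} := HB.pack X (isMeasurableFun.Build _ _ _ _ X mX).
pose Y' : {mfun T2 >-> coordinates R J} := HB.pack Y (isMeasurableFun.Build _ _ _ _ Y mY).
have := @ge0_integral_distribution _ _ _ _ _ P1 X' _ mPhi Phi0; rewrite /comp => <-.
have := @ge0_integral_distribution _ _ _ _ _ P2 Y' _ mPhi Phi0; rewrite /comp => <-.
apply: eq_measure_integral => E mE _.
exact: (@eq_law_rectangle R J (distribution P1 X') (distribution P2 Y')).
Qed.

End same_law.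

Section decoupling.
Context {R : realType} {J : finType} d (T : measurableType d) (P : probability T R).
Variable X : J -> T -> R.
Hypothesis mX : forall j, measurable_fun setT (X j).
Hypothesis indX : mutually_independent P X.

Lemma joint_measurable : measurable_fun setT (fun t => (X^~ t : coordinates R J)).
Proof. by apply: measurable_coordinates => j; exact: mX. Qed.

(* Independence of the subfamilies indexed by [K] and by its complement. *)
Lemma decouple (K : pred J) (Phi : coordinates R J -> \bar R) :
  measurable_fun setT Phi -> (forall w, 0 <= Phi w)%E ->
  (\int[P]_t Phi (X^~ t) = \int[P]_t \int[P]_s Phi (fun j => if K j then X j s else X j t))%E.
Proof.
move=> mPhi Phi0.
pose Y (z : T * T) : coordinates R J := fun j => if K j then X j z.2 else X j z.1.
have mY : measurable_fun setT Y.
  apply: measurable_coordinates => j; rewrite /Y; case: (K j).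
    exact: (measurableT_comp (mX j) measurable_snd).
  exact: (measurableT_comp (mX j) measurable_fst).
have mC (C : J -> set R) : (forall j, measurable (C j)) -> measurable (\bigcap_j (X j @^-1` C j)).
  move=> mC; apply: fin_bigcap_measurable => // j _.
  by have := mX j measurableT (mC j); rewrite setTI.
rewrite (@same_law_integral R J _ _ T (T * T)%type P (P \x P)%E _ Y joint_measurable mY)//.
  rewrite (fubini_tonelli1 (Phi \o Y)); [by []|exact: (measurableT_comp mPhi mY)|by move=> z; exact: Phi0].
move=> B mB.
(* Constraints on one side of [K] only: the preimage of a rectangle under [Y] is then a product of
   two events, and both sides reduce to the same product of marginal probabilities. *)
pose C (b : bool) j := if K j == b then B j else setT.
have mCb b j : measurable (C b j) by rewrite /C; case: ifP.
have -> : Y @^-1` rectangle B =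
    (\bigcap_j (X j @^-1` C false j)) `*` (\bigcap_j (X j @^-1` C true j)).
  apply/seteqP; split=> -[s t] /=.
    by move=> H; split=> j _ /=; have := H j; rewrite /Y /C /=; case: (K j).
  by move=> [H1 H2] j; have := H1 j I; have := H2 j I; rewrite /Y /C /=; case: (K j).
transitivity (P (\bigcap_j (X j @^-1` C false j)) * P (\bigcap_j (X j @^-1` C true j)))%E; last first.
  by symmetry; apply: product_measure1E; exact: mC.
have -> : (fun t => X^~ t) @^-1` rectangle B = \bigcap_j (X j @^-1` B j).
  by apply/seteqP; split=> t /= H j; [move=> _; exact: H|exact: (H j)].
rewrite !indX//; rewrite -big_split /=; apply: eq_bigr => j _.
rewrite /C; case: (K j) => /=; rewrite preimage_setT probability_setT ?mul1e ?mule1//.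
Qed.

End decoupling.

Section lindeberg.
Context {R : realType} {J : finType} d (T : measurableType d) (P : probability T R).

Definition set_coordinate (w : coordinates R J) (k : J) (x : R) : coordinates R J :=
  fun j => if j == k then x else w j.

Variables X Y : J -> T -> R.
Hypotheses (mX : forall j, measurable_fun setT (X j)) (mY : forall j, measurable_fun setT (Y j)).
Hypotheses (indX : mutually_independent P X) (indY : mutually_independent P Y).
Variables (Phi : coordinates R J -> \bar R) (C : J -> R).
Hypotheses (mPhi : measurable_fun setT Phi) (Phi0 : forall w, (0 <= Phi w)%E).
Hypothesis C0 : forall k, 0 <= C k.
Hypothesis swap : forall k w, (\int[P]_s Phi (set_coordinate w k (X k s)) <=
  \int[P]_s Phi (set_coordinate w k (Y k s)) + (C k)%:E)%E.

(** [X] is read on the first copy of the space and [Y] on the second, so the two families become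
    independent of each other whatever their joint law under [P]. *)
Let hybrid (s : seq J) (z : T * T) : coordinates R J :=
  fun j => if j \in s then Y j z.2 else X j z.1.

Let mhybrid s : measurable_fun setT (hybrid s).
Proof.
apply: measurable_coordinates => j; rewrite /hybrid; case: (j \in s).
  exact: (measurableT_comp (mY j) measurable_snd).
exact: (measurableT_comp (mX j) measurable_fst).
Qed.

Let hybrid_mean s := (\int[(P \x P)%E]_z Phi (hybrid s z))%E.

Let m_resample s k (Z : J -> T -> R) : (forall j, measurable_fun setT (Z j)) ->
  measurable_fun setT (fun z : (T * T) * T => Phi (set_coordinate (hybrid s z.1) k (Z k z.2))).
Proof.
move=> mZ; apply: (measurableT_comp mPhi); apply: measurable_coordinates => j.
rewrite /set_coordinate; case: (j == k).
  exact: (measurableT_comp (mZ k) measurable_snd).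
have mj := measurableT_comp (measurable_coordinate j) (mhybrid s).
exact: (measurableT_comp mj measurable_fst).
Qed.

Let m_resampled s k (Z : J -> T -> R) : (forall j, measurable_fun setT (Z j)) ->
  measurable_fun setT (fun z => \int[P]_u Phi (set_coordinate (hybrid s z) k (Z k u)))%E.
Proof.
move=> mZ; apply: (measurable_fun_fubini_tonelli_F
  (fun z => Phi (set_coordinate (hybrid s z.1) k (Z k z.2)))) => //.
exact: m_resample.
Qed.

Let mpatch (D : pred J) (w : J -> R) : measurable_fun setT
  (fun v : coordinates R J => Phi (fun j => if D j then w j else v j)).
Proof.
apply: (measurableT_comp mPhi); apply: measurable_coordinates => j.
by case: (D j) => //; exact: measurable_coordinate.
Qed.

(** Freezing the second copy makes the hybrid a function of [X] alone, and [decouple] resamples its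
    coordinate [k], still read from [X] as [k] is not in [s]. [hybrid_resampleY] is the mirror
    image, with the first copy frozen. *)
Let hybrid_resampleX s k : k \notin s ->
  hybrid_mean s = (\int[(P \x P)%E]_z \int[P]_u Phi (set_coordinate (hybrid s z) k (X k u)))%E.
Proof.
move=> ks; rewrite /hybrid_mean.
rewrite (fubini_tonelli2 (Phi \o hybrid s)); [|exact: (measurableT_comp mPhi)|by move=> z; exact: Phi0].
rewrite (fubini_tonelli2 (fun z => \int[P]_u Phi (set_coordinate (hybrid s z) k (X k u)))%E);
  [|exact: m_resampled|by move=> z; exact: integral_ge0].
apply: eq_integral => t2 _; rewrite /fubini_G /=.
apply: (eq_trans (decouple mX indX (pred1 k) (mpatch (fun j => j \in s) (Y^~ t2)) _)).
  by move=> w; exact: Phi0.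
apply: eq_integral => t1 _; apply: eq_integral => u _; congr Phi; apply/funext => j.
rewrite /set_coordinate /hybrid /=; case: eqP => [->|//].
by rewrite (negbTE ks).
Qed.

Let hybrid_resampleY s k : k \notin s ->
  hybrid_mean (k :: s) =
  (\int[(P \x P)%E]_z \int[P]_u Phi (set_coordinate (hybrid s z) k (Y k u)))%E.
Proof.
move=> ks; rewrite /hybrid_mean.
rewrite (fubini_tonelli1 (Phi \o hybrid (k :: s)));
  [|exact: (measurableT_comp mPhi)|by move=> z; exact: Phi0].
rewrite (fubini_tonelli1 (fun z => \int[P]_u Phi (set_coordinate (hybrid s z) k (Y k u)))%E);
  [|exact: m_resampled|by move=> z; exact: integral_ge0].
apply: eq_integral => t1 _; rewrite /fubini_F /=.
have E t2 : hybrid (k :: s) (t1, t2) =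
    fun j => if j \notin k :: s then X j t1 else Y j t2.
  by apply/funext => j; rewrite /hybrid /=; case: (j \in _).
under eq_integral do rewrite E.
apply: (eq_trans (decouple mY indY (pred1 k) (mpatch (fun j => j \notin k :: s) (X^~ t1)) _)).
  by move=> w; exact: Phi0.
apply: eq_integral => t2 _; apply: eq_integral => u _; congr Phi; apply/funext => j.
rewrite /set_coordinate /hybrid /= inE; case: eqP => [->|] //=.
by case: (j \in s).
Qed.

(** After resampling, consecutive hybrids are averages over the same background [hybrid s z], whose
    coordinate [k] is overwritten by a fresh draw of [X k] or of [Y k]. So [swap] can be integrated
    pointwise, and the costs telescope along an enumeration of [J]. *)
Lemma lindeberg : (\int[P]_t Phi (X^~ t) <= \int[P]_t Phi (Y^~ t) + (\sum_j C j)%:E)%E.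
Proof.
have step s k : k \notin s -> (hybrid_mean s <= hybrid_mean (k :: s) + (C k)%:E)%E.
  move=> ks; rewrite (hybrid_resampleX ks) (hybrid_resampleY ks).
  have CE : (C k)%:E = (\int[(P \x P)%E]_z (cst (C k)%:E z))%E.
    by rewrite integral_cst//= probability_setT mule1.
  rewrite [X in (_ <= _ + X)%E]CE -ge0_integralD//=; first last.
  - by move=> z _; rewrite lee_fin.
  - exact: m_resampled.
  - by move=> z _; exact: integral_ge0.
  apply: ge0_le_integral => //=.
  - by move=> z _; exact: integral_ge0.
  - exact: m_resampled.
  - apply: emeasurable_funD => //; exact: m_resampled.
have chain s : uniq s -> (hybrid_mean [::] <= hybrid_mean s + (\sum_(j <- s) C j)%:E)%E.
  elim: s => [_|k s IH /= /andP[ks us]]; first by rewrite big_nil adde0.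
  rewrite big_cons EFinD addeA (le_trans (IH us))// leeD2r// step//.
have := chain (enum J) (enum_uniq _); rewrite big_enum /=.
have -> : hybrid_mean [::] = (\int[P]_t Phi (X^~ t))%E.
  rewrite /hybrid_mean (fubini_tonelli1 (Phi \o hybrid [::]));
    [|exact: (measurableT_comp mPhi)|by move=> z; exact: Phi0].
  apply: eq_integral => t1 _; rewrite /fubini_F /=.
  by rewrite (integral_cst _ _ (Phi (hybrid [::] (t1, point))))//= probability_setT mule1.
suff -> : hybrid_mean (enum J) = (\int[P]_t Phi (Y^~ t))%E by [].
have hE z : hybrid (enum J) z = Y^~ z.2.
  by apply/funext => j; rewrite /hybrid mem_enum.
rewrite /hybrid_mean (fubini_tonelli2 (Phi \o hybrid (enum J)));
  [|exact: (measurableT_comp mPhi)|by move=> z; exact: Phi0].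
apply: eq_integral => t2 _; rewrite /fubini_G /=.
under eq_integral do rewrite hE.
by rewrite (integral_cst _ _ (Phi (Y^~ t2)))//= probability_setT mule1.
Qed.

End lindeberg.

(** * Moments of the normal distribution *)

Section normal_moments.
Context {R : realType}.
Local Notation mu := (@lebesgue_measure R).

Lemma expRN_le n (y : R) : 0 < y -> expR (- y) <= n`!%:R / y ^+ n.
Proof.
move=> y0; rewrite expRN -[leRHS]invrK lef_pV2 ?posrE ?expR_gt0//; last first.
  by rewrite invr_gt0 divr_gt0 ?exprn_gt0// ltr0n fact_gt0.
rewrite invf_div; case: n => [|n].
  by rewrite expr0 fact0 divr1 ltW// expR_gt1.
by rewrite (le_trans _ (expR_ge1Dxn n (ltW y0)))// lerDr.
Qed.

(** The change of variables produces the Radon-Nikodym derivative of the normal law, which equals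
    [normal_pdf] almost everywhere because both have the same integral over every measurable set. *)
Lemma ge0_integral_normal_prob (s : R) (f : R -> R) :
  measurable_fun setT f -> (forall x, 0 <= f x) ->
  (\int[normal_prob 0 s]_x (f x)%:E = \int[mu]_x (f x * normal_pdf 0 s x)%:E)%E.
Proof.
move=> mf f0.
have dom := @normal_prob_dominates R 0 s.
have := Radon_Nikodym_SigmaFinite.change_of_variables dom (f := EFin \o f) (E := setT).
move=> <-; last 3 first.
- by move=> x; rewrite lee_fin.
- by [].
- exact/measurable_EFinP.
have mg := Radon_Nikodym_SigmaFinite.f_integrable dom.
apply: ae_eq_integral => //.
- apply: emeasurable_funM; first exact/measurable_EFinP.
  exact: (measurable_int _ mg).
- by apply/measurable_EFinP/measurable_funM => //; exact: measurable_normal_pdf.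
under [X in ae_eq _ _ _ X]eq_fun do rewrite EFinM.
apply: ae_eqe_mul2l; apply: integral_ae_eq => //.
- by apply/measurable_EFinP; exact: measurable_normal_pdf.
- by move=> E _ mE; rewrite -(Radon_Nikodym_SigmaFinite.f_integral dom).
Qed.

Lemma isd_normal_pdf (s x : R) : s != 0 ->
  is_derive x 1 (normal_pdf 0 s) (- (x / s ^+ 2) * normal_pdf 0 s x).
Proof.
move=> s0; rewrite !normal_pdfE//.
have de := @isd_comp _ expR (fun y => - (y - 0) ^+ 2 / (s ^+ 2 *+ 2)) x _ _ (is_derive_expR (- (x - 0) ^+ 2 / (s ^+ 2 *+ 2)))
  (isdM (isdN (isdX 2 (isdB (isdI x) (isdC x 0)))) (isdC x (s ^+ 2 *+ 2)^-1)).
apply: (is_derive_eq (isdZ (normal_peak s) de)).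
by rewrite /normal_fun -mulr_natr; field.
Qed.

Lemma normal_pdf_decay (s : R) : s != 0 ->
  exists2 C, 0 <= C & forall x : R, 1 <= x -> x ^+ 5 * normal_pdf 0 s x <= C / x.
Proof.
(* The fourth term of the exponential series at [x^2 / (2 s^2)], with 24 = 4!, gives decay
   [C / x^8], more than enough against [x^5]. *)
move=> s0; pose C := 24 * (2 * s ^+ 2) ^+ 4.
have C0 : 0 <= C by apply: mulr_ge0 => //; rewrite exprn_even_ge0.
have p0 := normal_peak_ge0 s.
exists (normal_peak s * C); first exact: mulr_ge0.
move=> x x1; rewrite normal_pdfE// /normal_fun subr0 mulNr.
have x0 : 0 < x by lra.
have s2 : 0 < s ^+ 2 by rewrite exprn_even_gt0.
have y0 : 0 < x ^+ 2 / (s ^+ 2 *+ 2) by rewrite divr_gt0 ?exprn_gt0// mulrn_wgt0.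
have := expRN_le 4 y0; rewrite (_ : 4`!%:R = 24 :> R)// => E.
have -> : normal_peak s * C / x = x ^+ 5 * (normal_peak s * (x ^+ 2 * (C / x ^+ 8))).
  by field; rewrite gt_eqF.
apply: ler_wpM2l; first by rewrite exprn_ge0// ltW.
apply: ler_wpM2l => //; apply: (le_trans E).
have -> : 24 / (x ^+ 2 / (s ^+ 2 *+ 2)) ^+ 4 = C / x ^+ 8.
  by rewrite /C -mulr_natr; field; rewrite s0 gt_eqF.
apply: ler_peMl; last by rewrite exprn_ege1.
by apply: divr_ge0 => //; rewrite exprn_even_ge0.
Qed.

Lemma normal_pdf_opp (s x : R) : normal_pdf 0 s (- x) = normal_pdf 0 s x \/ s = 0.
Proof.
have [->|s0] := eqVneq s 0; [by right|left].
by rewrite normal_pdfE// /normal_fun !subr0 sqrrN.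
Qed.

(* [Q] witnesses that [(f - c) * normal_pdf] is an exact derivative. *)
Lemma normal_moment (s c D : R) (f Q : R -> R) : s != 0 -> continuous f ->
  (forall x, 0 <= f x) -> (forall x, 1 <= `|x| -> `|Q x| <= D * `|x| ^+ 5) ->
  (forall x : R, is_derive x 1 (fun y => Q y * normal_pdf 0 s y) ((f x - c) * normal_pdf 0 s x)) ->
  (\int[normal_prob 0 s]_x (f x)%:E = c%:E)%E.
Proof.
move=> s0 cf f0 QD dQ.
have mf : measurable_fun setT f by exact: continuous_measurable_fun.
rewrite ge0_integral_normal_prob//.
pose phi := normal_pdf 0 s.
have cphi : continuous phi by exact: continuous_normal_pdf.
have phi0 x : 0 <= phi x by exact: normal_pdf_ge0.
have cfphi : continuous (fun x => f x * phi x) by move=> x; apply: cvgM; [exact: cf|exact: cphi].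
pose I n := `[- n%:R, n%:R]%classic : set R.
have intg (g : R -> R) n : continuous g -> mu.-integrable (I n) (EFin \o g).
  move=> cg; apply: continuous_compact_integrable; first exact: segment_compact.
  exact: continuous_subspaceT.
have cI (g : R -> R) : continuous g -> forall n, (\int[mu]_(x in I n) (g x)%:E)%E \is a fin_num.
  by move=> cg n; apply: integrable_fin_num; [exact: measurable_itv|exact: intg].
have limI (g : R -> R) : continuous g -> (forall x, 0 <= g x) ->
    (\int[mu]_(x in I n) (g x)%:E)%E @[n --> \oo] --> (\int[mu]_x (g x)%:E)%E.
  move=> cg g0.
  have -> : setT = \bigcup_n I n.
    apply/seteqP; split=> // x _; exists (Num.bound `|x|) => //; rewrite /I /= in_itv /=.
    have := archi_boundP (normr_ge0 x); have := ler_norm x; have := ler_norm (- x).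
    by rewrite normrN => a b u; apply/andP; split; lra.
  apply: ge0_nondecreasing_set_cvg_integral.
  - apply/nondecreasing_seqP => n; apply/subsetPset => x; rewrite /I /= !in_itv /= -natr1 => /andP[a b]; apply/andP; split; lra.
  - by move=> i; exact: measurable_itv.
  - move=> i; apply/measurable_EFinP/measurable_funTS; exact: continuous_measurable_fun.
  - by move=> i x _; rewrite lee_fin.
pose Delta n := Q n%:R * phi n%:R - Q (- n%:R) * phi (- n%:R).
have FTC n : (0 < n)%N -> (\int[mu]_(x in I n) (f x * phi x)%:E =
    (Delta n)%:E + c%:E * \int[mu]_(x in I n) (phi x)%:E)%E.
  move=> n0; have nn : - n%:R < n%:R :> R by rewrite gtrN// ltr0n.
  pose h x := (f x - c) * phi x.
  have ccphi : continuous (fun x => c * phi x) by move=> x; apply: cvgM; [exact: cvg_cst|exact: cphi].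
  have ch : continuous h.
    by move=> x; apply: cvgM; [apply: cvgB; [exact: cf|exact: cvg_cst]|exact: cphi].
  have dF (x : R) : is_derive x 1 (fun y => Q y * phi y) (h x) := dQ x.
  have cF := isd_continuous dF.
  have FTC2 : (\int[mu]_(x in I n) (h x)%:E = (Delta n)%:E)%E.
    rewrite (@continuous_FTC2 R h (fun y => Q y * phi y)) //.
    - exact: continuous_subspaceT.
    - split; first by move=> x _; exact: (@ex_derive _ _ _ _ _ _ _ (dF x)).
        exact/cvg_at_right_filter/cF.
      exact/cvg_at_left_filter/cF.
    - by move=> x _; rewrite derive1E; exact: (@derive_val _ _ _ _ _ _ _ (dF x)).
  rewrite -FTC2 -integralZl; [|exact: measurable_itv|exact: intg].
  rewrite -integralD; [|exact: measurable_itv|exact: intg|exact: (intg _ n ccphi)].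
  by apply: eq_integral => x _; rewrite -!EFinM -EFinD /h; congr EFin; ring.
(* The boundary terms vanish: [Q] grows at most like the fifth power, for which [normal_pdf_decay]
   is calibrated. *)
have Delta0 : Delta n @[n --> \oo] --> (0 : R).
  have [C C0 HC] := normal_pdf_decay s0.
  pose K : R := 2 * (`|D| * C).
  apply: norm_cvg0; apply: (@squeeze_cvgr _ _ _ _ (fun=> 0) (fun n => K * 2 * harmonic n)).
  - near=> n; rewrite normr_ge0 /= /Delta.
    have n1 : 1 <= n%:R :> R by rewrite ler1n; near: n; exact: nbhs_infty_gt.
    have n0 : 0 <= n%:R :> R by [].
    have -> : phi (- n%:R) = phi n%:R by case: (normal_pdf_opp s n%:R) => // /eqP; rewrite (negbTE s0).
    rewrite -mulrBl normrM (ger0_norm (phi0 _)).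
    have Q1 := QD n%:R; have Q2 := QD (- n%:R); rewrite normrN ger0_norm// in Q1 Q2.
    have {Q1 Q2} Q12 : `|Q n%:R - Q (- n%:R)| <= 2 * `|D| * n%:R ^+ 5.
      rewrite (le_trans (ler_normB _ _))//; have := Q1 n1; have := Q2 n1.
      have : D * n%:R ^+ 5 <= `|D| * n%:R ^+ 5 by rewrite ler_wpM2r ?exprn_ge0 ?ler_norm.
      by lra.
    apply: (le_trans (ler_wpM2r (phi0 _) Q12)).
    have -> : K * 2 * harmonic n = 2 * `|D| * (C * (2 * harmonic n)).
      by rewrite /K; ring.
    rewrite -[leLHS]mulrA ler_wpM2l ?mulr_ge0//.
    apply: (le_trans (HC _ n1)); apply: ler_wpM2l => //.
    rewrite /harmonic/= ler_pdivlMr ?ltr0Sn// mulrC ler_pdivrMr; last by lra.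
    by rewrite -natr1; lra.
  - exact: cvg_cst.
  - rewrite -[X in _ --> X](mulr0 (K * 2)); apply: cvgM; first exact: cvg_cst.
    exact: cvg_harmonic.
have L1 := limI _ cfphi (fun x => mulr_ge0 (f0 x) (phi0 x)).
have L2 := limI _ cphi phi0; rewrite integral_normal_pdf in L2.
suff L3 : (\int[mu]_(x in I n) (f x * phi x)%:E)%E @[n --> \oo] --> c%:E.
  exact: (cvg_unique (@ereal_hausdorff R) L1 L3).
have : ((Delta n)%:E + c%:E * \int[mu]_(x in I n) (phi x)%:E)%E @[n --> \oo] --> (0%:E + c%:E * 1)%E.
  apply: cvgeD => //; first by apply: cvg_EFin; [exact: nearW|exact: Delta0].
  exact: cvgeZl.
rewrite add0e mule1; apply: cvg_trans; apply: near_eq_cvg; near=> n.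
rewrite FTC//; near: n; exact: nbhs_infty_gt.
Unshelve. all: by end_near. Qed.


(** The middle moment stands in for the mean: [normal_moment] wants a nonnegative integrand, and the
    mean is recovered later by expanding [(x + 1) ^+ 2]. *)
Lemma normal_moments (s : R) : 0 < s ->
  [/\ (\int[normal_prob 0 s]_x (x ^+ 2)%:E = (s ^+ 2)%:E)%E,
      (\int[normal_prob 0 s]_x ((x + 1) ^+ 2)%:E = (s ^+ 2 + 1)%:E)%E &
      (\int[normal_prob 0 s]_x (x ^+ 6)%:E = (15 * s ^+ 6)%:E)%E].
Proof.
move=> s0; have sN0 : s != 0 by rewrite gt_eqF.
have dphi (x : R) := isd_normal_pdf x sN0.
have pow_le (x : R) i j : (i <= j)%N -> 1 <= `|x| -> `|x| ^+ i <= `|x| ^+ j.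
  by move=> ij x1; exact: ler_weXn2l.
split.
- apply: (@normal_moment s (s ^+ 2) (s ^+ 2) (fun x => x ^+ 2) (fun x => - s ^+ 2 * x)) => //.
  + exact: isd_continuous (fun x => isdX 2 (isdI x)).
  + by move=> x; exact: sqr_ge0.
  + move=> x x1; rewrite normrM normrN (ger0_norm (sqr_ge0 s)) ler_wpM2l ?sqr_ge0//.
    by rewrite -[leLHS]expr1 pow_le.
  + move=> x; apply: (is_derive_eq (isdM (isdZ (- s ^+ 2) (isdI x)) (dphi x))).
    by field.
- apply: (@normal_moment s (s ^+ 2 + 1) (3 * s ^+ 2) (fun x => (x + 1) ^+ 2)
    (fun x => - s ^+ 2 * (x + 2))) => //.
  + exact: isd_continuous (fun x => isdX 2 (isdD (isdI x) (isdC x 1))).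
  + by move=> x; exact: sqr_ge0.
  + move=> x x1; rewrite normrM normrN (ger0_norm (sqr_ge0 s)).
    have -> : 3 * s ^+ 2 * `|x| ^+ 5 = s ^+ 2 * (3 * `|x| ^+ 5) by ring.
    rewrite ler_wpM2l ?sqr_ge0// (le_trans (ler_normD _ _))// (@ger0_norm _ 2)//.
    by have := pow_le x 1%N 5%N isT x1; rewrite expr1; lra.
  + move=> x; apply: (is_derive_eq (isdM (isdZ (- s ^+ 2) (isdD (isdI x) (isdC x 2))) (dphi x))).
    by field.
(* [Q] results from integrating [x^6] by parts three times, using that the density has derivative
   [- x / s^2] times itself; hence the coefficients 1, 5 and 15. *)
- apply: (@normal_moment s (15 * s ^+ 6) (s ^+ 2 + 5 * s ^+ 4 + 15 * s ^+ 6) (fun x => x ^+ 6)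
    (fun x => - (s ^+ 2 * x ^+ 5 + 5 * s ^+ 4 * x ^+ 3 + 15 * s ^+ 6 * x))) => //.
  + exact: isd_continuous (fun x => isdX 6 (isdI x)).
  + by move=> x; rewrite exprn_even_ge0.
  + move=> x x1; rewrite normrN.
    have -> : (s ^+ 2 + 5 * s ^+ 4 + 15 * s ^+ 6) * `|x| ^+ 5 =
      s ^+ 2 * `|x| ^+ 5 + 5 * s ^+ 4 * `|x| ^+ 5 + 15 * s ^+ 6 * `|x| ^+ 5 by ring.
    have c4 : 0 <= 5 * s ^+ 4 by rewrite mulr_ge0// exprn_even_ge0.
    have c6 : 0 <= 15 * s ^+ 6 by rewrite mulr_ge0// exprn_even_ge0.
    apply: (le_trans (ler_normD _ _)); apply: lerD; last first.
      by rewrite normrM (ger0_norm c6); apply: ler_wpM2l => //; rewrite -[leLHS]expr1 pow_le.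
    apply: (le_trans (ler_normD _ _)); apply: lerD; last first.
      by rewrite normrM (ger0_norm c4); apply: ler_wpM2l => //; rewrite normrX pow_le.
    by rewrite normrM (ger0_norm (sqr_ge0 s)) normrX.
  + move=> x; apply: (is_derive_eq (isdM (isdN (isdD (isdD (isdZ (s ^+ 2) (isdX 5 (isdI x)))
      (isdZ (5 * s ^+ 4) (isdX 3 (isdI x)))) (isdZ (15 * s ^+ 6) (isdI x)))) (dphi x))).
    by rewrite /=; field.
Qed.

End normal_moments.

(** * Weak derivatives of convex functions *)

Section bump.
Context {R : realType}.
Local Notation mu := (@lebesgue_measure R).

(** The classical smooth function vanishing to infinite order at 0, times a pole of order [k]: with
    the poles, the family is stable under differentiation up to linear combinations. *)
Definition flat (k : nat) (x : R) : R := if 0 < x then x ^- k * expR (- x^-1) else 0.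

Lemma flat_ge0 k x : 0 <= flat k x.
Proof.
by rewrite /flat; case: ifP => // x0; rewrite mulr_ge0 ?expR_ge0// invr_ge0 exprn_ge0// ltW.
Qed.

(** The exponential is at most [(k + n)! x^(k + n)], of which [x^n] survives the pole. The case
    [n = 2] serves for the derivative at 0, the case [n = 0] as a uniform bound. *)
Lemma flat_le k n (x : R) : `|flat k x| <= (k + n)`!%:R * `|x| ^+ n.
Proof.
rewrite ger0_norm ?flat_ge0// /flat; case: ifP => x0; last by rewrite mulr_ge0 ?exprn_ge0.
have xi : 0 < x^-1 by rewrite invr_gt0.
rewrite gtr0_norm//.
have -> : (k + n)`!%:R * x ^+ n = x ^- k * ((k + n)`!%:R / x^-1 ^+ (k + n)).
  by rewrite exprVn invrK exprD; field; rewrite expf_neq0// gt_eqF.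
by apply: ler_wpM2l; [rewrite invr_ge0 exprn_ge0// ltW|exact: expRN_le].
Qed.

Lemma isd0_of_sqr (f : R -> R) (C : R) : f 0 = 0 -> (forall x, `|f x| <= C * `|x| ^+ 2) ->
  is_derive (0 : R) 1 f 0.
Proof.
move=> f0 fC.
have C0 : 0 <= C by have := fC 1; rewrite normr1 expr1n mulr1; exact: le_trans.
have lim : h^-1 *: ((f \o shift (0 : R)) (h *: 1) - f 0) @[h --> 0^'] --> (0 : R).
  apply/cvgrPdist_le => e e0; near=> h.
  have h0 : h != 0 by near: h; exact: nbhs_dnbhs_neq.
  have hC : `|h| <= e / (C + 1).
    near: h; apply: (@dnbhs0_le _ _ (e / (C + 1))); rewrite divr_gt0//; lra.
  rewrite sub0r normrN f0 subr0 /= addr0 /GRing.scale/= mulr1 normrM normfV.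
  rewrite mulrC ler_pdivrMr ?normr_gt0// (le_trans (fC h))//.
  rewrite expr2 mulrA ler_wpM2r//.
  move: hC; rewrite ler_pdivlMr; last by lra.
  by have := normr_ge0 h; nra.
split; first by apply/cvg_ex; exists 0.
by rewrite /derive; apply: cvg_lim.
Unshelve. all: by end_near. Qed.

Lemma isd_flat k (x : R) : is_derive x 1 (flat k) (- k%:R * flat k.+1 x + flat k.+2 x).
Proof.
have [x0|x0|->] := ltgtP x 0.
- have -> : - k%:R * flat k.+1 x + flat k.+2 x = 0.
    by rewrite /flat !ifF ?mulr0 ?addr0//; apply/negbTE; rewrite -leNgt ltW.
  apply: (@near_eq_is_derive _ _ _ (fun _ : R => 0 : R)).
  near=> y; rewrite /flat ifF//; apply/negbTE; rewrite -leNgt ltW//.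
  by near: y; exact: lt_nbhsl.
- have xN0 : x != 0 by rewrite gt_eqF.
  apply: (@near_eq_is_derive _ _ _ (fun y : R => y ^- k * expR (- y^-1))).
    near=> y; rewrite /flat ifT//; near: y; exact: lt_nbhsr.
  have xk : x ^+ k != 0 by rewrite expf_neq0.
  have d1 := @isdV _ (fun y => y ^+ k) x _ xk (isdX k (isdI x)).
  have d2 := @isd_comp _ expR (fun y => - y^-1) x _ _ (is_derive_expR (- x^-1))
    (isdN (@isdV _ (fun y => y) x _ xN0 (isdI x))).
  apply: (is_derive_eq (isdM d1 d2)).
  rewrite /flat x0; case: k {d1 d2} xk => [|k] xk /=; first by field.
  have xk' : x ^+ k != 0 by rewrite expf_neq0.
  by rewrite !exprS; field; rewrite ?xN0 ?xk'.
- have f0 i : flat i (0 : R) = 0 by rewrite /flat ltxx.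
  rewrite !f0 mulr0 addr0; apply: (@isd0_of_sqr _ (k + 2)`!%:R); first exact: f0.
  by move=> y; exact: flat_le.
Unshelve. all: by end_near. Qed.

Definition bump (c : R) (k l : nat) (x : R) : R := flat k (x - (c - 2^-1)) * flat l (c + 2^-1 - x).

Lemma isd_bump c k l (x : R) : is_derive x 1 (bump c k l)
  (- k%:R * bump c k.+1 l x + bump c k.+2 l x + l%:R * bump c k l.+1 x - bump c k l.+2 x).
Proof.
have d1 := @isd_comp _ (flat k) (fun y => y - (c - 2^-1)) x _ _ (isd_flat k _)
  (isdB (isdI x) (isdC x _)).
have d2 := @isd_comp _ (flat l) (fun y => c + 2^-1 - y) x _ _ (isd_flat l _)
  (isdB (isdC x _) (isdI x)).
by apply: (is_derive_eq (isdM d1 d2)); rewrite /bump; ring.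
Qed.

Lemma bump_out c k l x : 2^-1 <= `|x - c| -> bump c k l x = 0.
Proof.
rewrite /bump /flat ler_normr => /orP[] xc.
  by rewrite [X in _ * X]ifF ?mulr0//; apply/negbTE; rewrite -leNgt; lra.
by rewrite ifF ?mul0r//; apply/negbTE; rewrite -leNgt; lra.
Qed.

Definition bump_comb c (s : seq (R * nat * nat)) (x : R) : R :=
  \sum_(p <- s) p.1.1 * bump c p.1.2 p.2 x.

(** Triples hold a coefficient and the two pole orders. Stability of such combinations under
    differentiation gives [bump c 0 0] derivatives of every order. *)
Lemma isd_bump_comb c s : exists s', forall x : R, is_derive x 1 (bump_comb c s) (bump_comb c s' x).
Proof.
exists (flatten [seq [:: (p.1.1 * - p.1.2%:R, p.1.2.+1, p.2); (p.1.1, p.1.2.+2, p.2);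
  (p.1.1 * p.2%:R, p.1.2, p.2.+1); (- p.1.1, p.1.2, p.2.+2)] | p <- s]) => x.
apply: (is_derive_eq (@isd_sum R _ s predT (fun p x => p.1.1 * bump c p.1.2 p.2 x) _ x
  (fun p => isdZ p.1.1 (isd_bump c p.1.2 p.2 x)))).
rewrite /bump_comb big_flatten big_map; apply: eq_bigr => p _.
by rewrite !big_cons big_nil /=; ring.
Qed.

Lemma bump_test c : test_function (bump c 0 0).
Proof.
split; last first.
  exists (`|c| + 1) => x xc; apply: bump_out.
  by have := lerB_dist x c; lra.
move=> k.
have [s E] : exists s, derive1n k (bump c 0 0) = bump_comb c s.
  elim: k => [|k [s IH]].
    exists [:: (1, 0%N, 0%N)]; apply/funext => x.
    by rewrite derive1n0 /bump_comb big_seq1 mul1r.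
  have [s' ds'] := isd_bump_comb c s.
  exists s'; rewrite derive1nS IH; apply/funext => x; rewrite derive1E.
  exact: (@derive_val _ _ _ _ _ _ _ (ds' x)).
have [s' ds'] := isd_bump_comb c s.
by move=> x; rewrite E; exact: (@ex_derive _ _ _ _ _ _ _ (ds' x)).
Qed.

Definition dbump (c x : R) : R := bump c 2 0 x - bump c 0 2 x.

Lemma isd_bump0 c (x : R) : is_derive x 1 (bump c 0 0) (dbump c x).
Proof. by apply: (is_derive_eq (isd_bump c 0 0 x)); rewrite /dbump; ring. Qed.

Lemma bump_ge0 c x : 0 <= bump c 0 0 x.
Proof. by rewrite mulr_ge0 ?flat_ge0. Qed.

(** With [a] and [b] the distances from [x] to the two ends of the support, the derivative inside it
    is a positive multiple of [a^-2 - b^-2], while [x - c] is [(a - b) / 2]. *)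
Lemma dbump_sign c x : dbump c x * (x - c) <= 0.
Proof.
have [xc|xc] := leP 2^-1 `|x - c|; first by rewrite /dbump !bump_out// subrr mul0r.
move: xc; rewrite ltr_norml => /andP[x1 x2].
have a0 : 0 < x - (c - 2^-1) by lra.
have b0 : 0 < c + 2^-1 - x by lra.
rewrite /dbump /bump /flat a0 b0 !expr0 !invr1 !mul1r.
set A := expR _; set B := expR _.
have A0 : 0 < A := expR_gt0 _; have B0 : 0 < B := expR_gt0 _.
set a := x - (c - 2^-1); set b := c + 2^-1 - x.
have -> : x - c = (a - b) / 2 by rewrite /a /b; field.
have -> : (a ^- 2 * A * B - A * (b ^- 2 * B)) * ((a - b) / 2) =
    - ((A * B) * ((a - b) ^+ 2 * (a + b)) / (2 * (a ^+ 2 * b ^+ 2))).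
  by field; rewrite !gt_eqF.
rewrite oppr_le0; apply: divr_ge0.
  apply: mulr_ge0; first exact: ltW (mulr_gt0 A0 B0).
  by apply: mulr_ge0; [exact: sqr_ge0|rewrite ltW// addr_gt0].
by apply: mulr_ge0 => //; apply: mulr_ge0; exact: sqr_ge0.
Qed.

Lemma bump_ge c x : c - 4^-1 <= x <= c + 4^-1 -> expR (- 4) ^+ 2 <= bump c 0 0 x.
Proof.
have flat_ge (y : R) : 4^-1 <= y -> expR (- 4) <= flat 0 y.
  move=> y4; have y0 : 0 < y by apply: lt_le_trans y4.
  by rewrite /flat y0 expr0 invr1 mul1r ler_expR lerN2 -[leRHS]invrK lef_pV2 ?posrE// invr_gt0.
move=> /andP[x1 x2]; rewrite expr2 /bump ler_pM ?expR_ge0// flat_ge//; lra.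
Qed.

Lemma bump_integral_gt0 c : 0 < \int[mu]_(x in `[c - 2^-1, c + 2^-1]) bump c 0 0 x.
Proof.
have cphi : continuous (bump c 0 0) := isd_continuous (isd_bump0 c).
have mphi : measurable_fun setT (bump c 0 0) by exact: continuous_measurable_fun.
have m0 : 0 < expR (- 4) ^+ 2 :> R by rewrite exprn_gt0 ?expR_gt0.
have lt4 : c - 4^-1 < c + 4^-1 by lra.
rewrite -lte_fin /Rintegral fineK; last first.
  apply: integrable_fin_num => //.
  apply: continuous_compact_integrable; first exact: segment_compact.
  exact: continuous_subspaceT.
apply: (@lt_le_trans _ _ (\int[mu]_(x in `[(c - 4^-1)%R, (c + 4^-1)%R]) (expR (- 4) ^+ 2)%:E)%E).
  rewrite integral_cst//= lebesgue_measure_itv /= lte_fin lt4 -EFinD -EFinM lte_fin.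
  by rewrite mulr_gt0// subr_gt0.
apply: (@le_trans _ _ (\int[mu]_(x in `[(c - 4^-1)%R, (c + 4^-1)%R]) (bump c 0 0 x)%:E)%E).
  apply: ge0_le_integral => //=.
  - by apply/measurable_EFinP/measurable_funTS.
  - by move=> x; rewrite in_itv /= => xJ; rewrite lee_fin bump_ge.
apply: ge0_subset_integral => //=.
- by apply/measurable_EFinP/measurable_funTS.
- by move=> x _; rewrite lee_fin bump_ge0.
- by move=> x; rewrite /= !in_itv /= => /andP[x1 x2]; apply/andP; split; lra.
Qed.

End bump.

Section weak_derivative_lipschitz.
Context {R : realType}.
Local Notation mu := (@lebesgue_measure R).

Lemma convex_function_ineq (psi : R -> R) : convex_function [set: R] psi ->
  forall p q r, p < q -> q < r -> psi q * (r - p) <= psi p * (r - q) + psi r * (q - p).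
Proof.
move=> cvx p q r pq qr; have pr : 0 < r - p by lra.
have t0 : 0 <= (r - q) / (r - p) by rewrite divr_ge0; lra.
have t1 : (r - q) / (r - p) <= 1 by rewrite ler_pdivrMr// mul1r; lra.
have := cvx (Itv01 t0 t1) p r; rewrite !inE => /(_ I I).
have -> : conv (Itv01 t0 t1) (p : convex_lmodType R^o) r = q.
  transitivity ((r - q) / (r - p) * p + (1 - (r - q) / (r - p)) * r); first by [].
  by field; rewrite gt_eqF.
rewrite convRE /unstable.onem /=.
move=> H; have := ler_wpM2r (ltW pr) H; congr (_ <= _).
by field; rewrite gt_eqF.
Qed.

(* A bump whose derivative has the sign of [c - x] turns a pointwise comparison
   of [psi] with a line through [c] into a comparison of slopes. *)
Lemma weak_slope (psi dpsi : R -> R) (c s L sg : R) :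
  0 <= L -> weak_derivative psi dpsi -> {ae mu, forall x, `|dpsi x| <= L} -> sg ^+ 2 = 1 ->
  (forall x, `|x - c| < 2^-1 -> 0 <= sg * (psi x - psi c - s * (x - c)) * (x - c)) ->
  sg * s <= L.
Proof.
move=> L0 [[mpsi _ ipsi] [mdpsi _ idpsi] weak] dpsiL sg2 sgn.
pose I := `[c - 2^-1, c + 2^-1]%classic : set R.
pose phi := bump c 0 0.
have mI : measurable I by exact: measurable_itv.
have compI : compact I by exact: segment_compact.
have outI x : ~ I x -> 2^-1 <= `|x - c|.
  move=> xI; rewrite leNgt; apply/negP; rewrite ltr_norml => /andP[a b].
  by apply: xI; rewrite /I /= in_itv /=; apply/andP; split; lra.
have onI (F : R -> R) : (forall x, ~ I x -> F x = 0) -> \int[mu]_x F x = \int[mu]_(x in I) F x.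
  move=> F0; rewrite [RHS]Rintegral_mkcond; congr Rintegral; apply/funext => x.
  by rewrite patchE; case: ifPn => // /negP; rewrite inE => /F0.
have cphi : continuous phi := isd_continuous (isd_bump0 c).
have cdphi : continuous (dbump c).
  apply: (@isd_continuous _ _ (fun x => _ - _)) => x.
  exact: isdB (isd_bump c 2 0 x) (isd_bump c 0 2 x).
have mfun (f : R -> R) : continuous f -> measurable_fun I f.
  by move=> cf; apply: measurable_funTS; exact: continuous_measurable_fun.
have icont (f : R -> R) : continuous f -> mu.-integrable I (EFin \o f).
  move=> cf; apply: continuous_compact_integrable => //; exact: continuous_subspaceT.
have bnd k l x : `|bump c k l x| <= k`!%:R * l`!%:R.
  have f0 i y : `|flat i (y : R)| <= i`!%:R by have := flat_le i 0 y; rewrite addn0 expr0 mulr1.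
  by rewrite normrM ler_pM.
have iprod (f g : R -> R) K : measurable_fun setT f ->
    (\int[mu]_(x in I) `|f x|%:E < +oo)%E -> continuous g -> (forall x, `|g x| <= K) ->
    mu.-integrable I (EFin \o (fun x => f x * g x)).
  move=> mf fi cg gK.
  have -> : EFin \o (fun x => f x * g x) = ((EFin \o f) \* (EFin \o g))%E by apply/funext.
  apply: integrableMl => //.
  - apply/integrableP; split; first by apply/measurable_EFinP; exact: measurable_funTS.
    by under eq_integral do rewrite /=.
  - exact: mfun.
  - exists K; split; first exact: num_real.
    by move=> M KM x _; apply: (le_trans (gK x)); exact: ltW.
have ipd := iprod _ _ _ mpsi (ipsi I (@subsetT _ _) compI) cdphi.
have {ipd} ipd : mu.-integrable I (EFin \o (fun x => psi x * dbump c x)).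
  apply: (ipd (2`!%:R * 0`!%:R + 0`!%:R * 2`!%:R)) => x.
  by rewrite (le_trans (ler_normB _ _))// lerD.
have idp : mu.-integrable I (EFin \o (fun x => dpsi x * phi x)).
  exact: (iprod _ _ _ mdpsi (idpsi I (@subsetT _ _) compI) cphi (bnd 0 0)).
have := weak _ (bump_test c).
have -> : ((bump c 0 0)^`())%classic = dbump c.
  apply/funext => x; rewrite derive1E; exact: (@derive_val _ _ _ _ _ _ _ (isd_bump0 c x)).
rewrite onI; last by move=> x /outI xI; rewrite /dbump !bump_out// subrr mulr0.
rewrite onI; last by move=> x /outI xI; rewrite bump_out// mulr0.
rewrite -/phi => weakE.
have iphi := icont _ cphi.
have left_le : sg * \int[mu]_(x in I) (psi x * dbump c x) <= - (sg * s) * \int[mu]_(x in I) phi x.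
  (* [h] is [sg] times the line of slope [s] through the graph at [c], times the derivative of the
     bump. The sum of [h] and [sg * s * phi] is an exact derivative vanishing at both ends, so [h]
     integrates to [- (sg * s)] times the mass of the bump. *)
  pose h x := sg * (psi c * dbump c x + s * ((x - c) * dbump c x)).
  have ch : continuous h.
    move=> x; apply: cvgM; first exact: cvg_cst.
    apply: cvgD; first by apply: cvgM; [exact: cvg_cst|exact: cdphi].
    apply: cvgM; first exact: cvg_cst.
    by apply: cvgM; [apply: cvgB; [exact: cvg_id|exact: cvg_cst]|exact: cdphi].
  have cshift : continuous (fun x => - (sg * s) * phi x).
    by move=> x; apply: cvgM; [exact: cvg_cst|exact: cphi].
  have cg : continuous (fun x => h x - (- (sg * s) * phi x)).
    by move=> x; apply: cvgB; [exact: ch|exact: cshift].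
  have FTC : \int[mu]_(x in I) (h x - (- (sg * s) * phi x)) = 0.
    pose H x := sg * (psi c * phi x + s * ((x - c) * phi x)).
    have dH (x : R) : is_derive x 1 H (h x - (- (sg * s) * phi x)).
      apply: (is_derive_eq (isdZ sg (isdD (isdZ (psi c) (isd_bump0 c x))
        (isdZ s (isdM (isdB (isdI x) (isdC x c)) (isd_bump0 c x)))))).
      by rewrite /h /phi; ring.
    have cH := isd_continuous dH.
    rewrite /Rintegral (@continuous_FTC2 R _ H).
    - have b1 : phi (c + 2^-1) = 0 by apply: bump_out; rewrite addrAC subrr add0r ger0_norm.
      have b2 : phi (c - 2^-1) = 0.
        by apply: bump_out; rewrite addrAC subrr add0r normrN ger0_norm.
      by rewrite /H b1 b2 !mulr0 addr0 mulr0 subee.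
    - lra.
    - exact: continuous_subspaceT.
    - split; first by move=> x _; exact: (@ex_derive _ _ _ _ _ _ _ (dH x)).
        exact/cvg_at_right_filter/cH.
      exact/cvg_at_left_filter/cH.
    - by move=> x _; rewrite derive1E; exact: (@derive_val _ _ _ _ _ _ _ (dH x)).
  rewrite -RintegralZl// -RintegralZl//.
  have -> : \int[mu]_(x in I) (- (sg * s) * phi x) =
      \int[mu]_(x in I) (- (sg * s) * phi x) + \int[mu]_(x in I) (h x - (- (sg * s) * phi x)).
    by rewrite FTC addr0.
  rewrite -RintegralD//; [|exact: icont cshift|exact: icont cg].
  apply: le_Rintegral => //.
  - have -> : EFin \o (fun x => sg * (psi x * dbump c x)) =
      (fun x => (sg%:E * (EFin \o (fun x => psi x * dbump c x)%R) x)%E) by apply/funext.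
    exact: integrableZl.
  - apply: icont => x; rewrite /=; apply: cvgD; [exact: cshift|exact: cg].
  - move=> x _; rewrite addrC subrK -subr_ge0.
    have -> : h x - sg * (psi x * dbump c x) =
        - (sg * (psi x - psi c - s * (x - c)) * dbump c x) by rewrite /h; ring.
    have [xc|xc] := leP 2^-1 `|x - c|.
      by rewrite /dbump !bump_out// subrr mulr0 oppr0.
    have sx := sgn _ xc; have ds := dbump_sign c x.
    set u := sg * _ in sx *.
    have [->|xc0] := eqVneq x c.
      rewrite /dbump /bump; have -> : c - (c - 2^-1) = c + 2^-1 - c by ring.
      by rewrite [X in X - _]mulrC subrr mulr0 oppr0.
    rewrite oppr_ge0.
    have : u * dbump c x * (x - c) ^+ 2 <= 0.
      have -> : u * dbump c x * (x - c) ^+ 2 = (u * (x - c)) * (dbump c x * (x - c)) by ring.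
      exact: mulr_ge0_le0.
    by rewrite pmulr_lle0// exprn_even_gt0//= subr_eq0.
have right_le : `|\int[mu]_(x in I) (dpsi x * phi x)| <= L * \int[mu]_(x in I) phi x.
  rewrite -lee_fin EFin_normr_Rintegral//.
  have : (\int[mu]_(x in I) `|(dpsi x * phi x)%:E| <= \int[mu]_(x in I) (L * phi x)%:E)%E.
    apply: ae_ge0_le_integral => //.
    - apply: measurableT_comp => //; exact: (measurable_int _ idp).
    - by move=> x _; rewrite lee_fin mulr_ge0 ?bump_ge0.
    - by apply/measurable_EFinP; apply: measurable_funM => //; exact: mfun.
    - apply: negligibleS dpsiL => x /= /not_implyP[_ xN] xL; apply: xN; rewrite lee_fin normrM (ger0_norm (bump_ge0 _ _)).
      by rewrite ler_wpM2r ?bump_ge0.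
  move=> H; apply: le_trans (le_trans _ H) _.
    by apply: le_abse_integral => //; exact: (measurable_int _ idp).
  rewrite -RintegralZl// /Rintegral fineK//.
  apply: integrable_fin_num => //; apply: icont => x.
  by apply: cvgM; [exact: cvg_cst|exact: cphi].
have phi_gt0 : 0 < \int[mu]_(x in I) phi x := bump_integral_gt0 c.
rewrite -(ler_pM2r phi_gt0).
move: left_le; rewrite weakE mulrN mulNr lerN2 => /le_trans; apply.
rewrite (le_trans _ right_le)// (le_trans (ler_norm _))// normrM.
by have /eqP := sg2; rewrite sqrf_eq1 => /orP[]/eqP ->; rewrite ?normrN normr1 mul1r.
Qed.

(** Take a chord of slope [s] over [[x, y]]. By convexity the slopes of [psi] are at least [s] to
    the right of [y] and at most [s] to the left of [x]; a bump on each outer side bounds [s] and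
    [- s] by [L]. *)
Lemma lipschitz_of_weak_derivative (psi dpsi : R -> R) (L : R) : 0 <= L ->
  convex_function [set: R] psi -> weak_derivative psi dpsi ->
  {ae mu, forall x, `|dpsi x| <= L} -> forall x y, `|psi x - psi y| <= L * `|x - y|.
Proof.
move=> L0 /convex_function_ineq cvx wd dL.
have slope x y : x < y -> `|psi y - psi x| <= L * (y - x).
  move=> xy; have yx : 0 < y - x by rewrite subr_gt0.
  pose s := (psi y - psi x) / (y - x).
  have sE : psi y - psi x = s * (y - x) by rewrite /s divfK// gt_eqF.
  have up u v : y <= u -> u < v -> s * (v - u) <= psi v - psi u.
    move=> yu uv.
    have v1 : s * (v - y) <= psi v - psi y.
      have := cvx x y v xy (le_lt_trans yu uv) => H.
      by rewrite -(ler_pM2r yx); nra.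
    move: yu; rewrite le_eqVlt => /orP[/eqP<-//|yu].
    have vy : 0 < v - y by lra.
    have := cvx y u v yu uv => H; rewrite -(ler_pM2r vy).
    by have := ler_wpM2r (ltW (_ : 0 < v - u)) v1; rewrite subr_gt0 => /(_ uv); lra.
  have dn u v : v <= x -> u < v -> psi v - psi u <= s * (v - u).
    move=> vx uv.
    have v1 : psi x - psi u <= s * (x - u).
      have := cvx u x y (lt_le_trans uv vx) xy => H.
      by rewrite -(ler_pM2r yx); nra.
    move: vx; rewrite le_eqVlt => /orP[/eqP->//|vx].
    have xu : 0 < x - u by lra.
    have := cvx u v x uv vx => H; rewrite -(ler_pM2r xu).
    by have := ler_wpM2r (ltW (_ : 0 < v - u)) v1; rewrite subr_gt0 => /(_ uv); lra.
  (* The bump centered at [y + 1/2] is supported in [[y, y + 1]], to the right of the chord, where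
     [up] applies. *)
  have sL : s <= L.
    rewrite -(mul1r s); apply: (@weak_slope psi dpsi (y + 2^-1)) => //; first by rewrite expr1n.
    move=> z; rewrite ltr_norml => /andP[z1 z2]; rewrite mul1r.
    have [zc|zc|->] := ltgtP z (y + 2^-1); last by rewrite !subrr !mulr0.
      rewrite mulr_le0//; last by lra.
      by have := up z (y + 2^-1); lra.
    rewrite mulr_ge0//; last by lra.
    by have := up (y + 2^-1) z; lra.
  have sNL : - s <= L.
    rewrite -(mulN1r s); apply: (@weak_slope psi dpsi (x - 2^-1)) => //; first by rewrite sqrrN expr1n.
    move=> z; rewrite ltr_norml => /andP[z1 z2]; rewrite mulN1r.
    have [zc|zc|->] := ltgtP z (x - 2^-1); last by rewrite !subrr !mulr0.
      rewrite mulr_le0//; last by lra.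
      by have := dn z (x - 2^-1); lra.
    rewrite mulr_ge0//; last by lra.
    by have := dn (x - 2^-1) z; lra.
  by rewrite sE normrM (gtr0_norm yx) ler_wpM2r ?(ltW yx)// ler_norml; lra.
move=> x y; have [xy|xy|->] := ltgtP x y.
- by rewrite distrC (le_trans (slope _ _ xy))// distrC ler_wpM2l ?ler_norm.
- by rewrite (le_trans (slope _ _ xy))// ler_wpM2l ?ler_norm.
- by rewrite !subrr normr0 mulr0.
Qed.

End weak_derivative_lipschitz.

(** * Minimizers and the leave-one-out comparison *)

Section minimizers.
Context {R : realType} {n : nat}.
Implicit Types (f : 'cV[R]_n -> R) (w : 'cV[R]_n).

Definition locally_lipschitz f := forall w, exists2 K, 0 <= K &
  forall w' r, 0 <= r <= 1 -> (forall j, `|w j 0 - w' j 0| <= r) -> `|f w - f w'| <= K * r.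

Lemma locally_lipschitz_continuous_row f : locally_lipschitz f ->
  continuous (fun u : 'rV[R]_n => f u^T).
Proof.
move=> lf u; have [K K0 HK] := lf u^T.
move=> P /nbhs_ballP[e /= e0 eP].
pose r := Num.min 1 (e / (K + 1)).
have K1 : 0 < K + 1 by lra.
have r0 : 0 < r by rewrite /r lt_min ltr01 divr_gt0.
apply/nbhs_ballP; exists r => //= v [_ uv].
have uvr j : `|u^T j 0 - v^T j 0| <= r by rewrite !mxE ltW//; have := uv 0 j.
have r1 : 0 <= r <= 1 by rewrite ltW// /r ge_min lexx.
apply: eP; rewrite /ball /=; apply: (le_lt_trans (HK _ _ r1 uvr)).
have : r <= e / (K + 1) by rewrite /r ge_min lexx orbT.
by rewrite ler_pdivlMr//; nra.
Qed.

(** Coercivity confines the competitors of [w1] to a box, where continuity gives a minimum.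
    Coordinates in [C] are pinned by the degenerate interval [[0, 0]], so the constrained problem
    also lives on a compact product. *)
Lemma exists_minimizer f (C : pred 'I_n) (B : R) w1 : locally_lipschitz f ->
  (forall j, C j -> w1 j 0 = 0) ->
  (forall w, f w <= f w1 -> forall j, `|w j 0| <= B) ->
  exists2 w0 : 'cV[R]_n, (forall j, C j -> w0 j 0 = 0) &
    forall w, (forall j, C j -> w j 0 = 0) -> f w0 <= f w.
Proof.
move=> lf w1C coer.
pose A (j : 'I_n) : set R := if C j then `[0, 0]%classic else `[- B, B]%classic.
pose AA := [set u : 'rV[R]_n | forall j, A j (u ord0 j)].
have cA : compact AA.
  by apply: rV_compact => j; rewrite /A; case: (C j); exact: segment_compact.
have inA w : (forall j, C j -> w j 0 = 0) -> f w <= f w1 -> AA w^T.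
  move=> wC ww1 j; rewrite mxE /A; case: ifP => Cj /=; rewrite in_itv /=.
    by rewrite wC// lexx.
  by rewrite -ler_norml coer.
have [|u uA umin] := compact_EVT_min _ cA (continuous_subspaceT (locally_lipschitz_continuous_row lf)).
  by exists w1^T; exact: inA.
have uC j : C j -> u^T j 0 = 0.
  move=> Cj; have := set_mem uA j; rewrite /A Cj /= in_itv /= mxE => /andP[a b].
  by apply/eqP; rewrite eq_le a b.
exists u^T => // w wC.
have [ww1|/ltW w1w] := leP (f w) (f w1).
  by rewrite -[w in leRHS]trmxK umin// inE; exact: inA.
apply: le_trans w1w; rewrite -[w1 in leRHS]trmxK umin// inE; exact: inA.
Qed.

End minimizers.

Section total_cost.
Context {R : realType} {m n : nat}.
Implicit Types (psi : R -> R) (mu w : 'cV[R]_n) (A : 'M[R]_(m, n)) (xi : 'cV[R]_m).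

Definition total_cost psi lambda mu A xi w : R :=
  \sum_(i < m) psi ((A *m w) i 0 - xi i 0) + lambda / 2 * \sum_(j < n) (w + mu) j 0 ^+ 2.

Lemma robust_costE psi lambda mu w A xi :
  robust_cost psi lambda mu w A xi = m%:R^-1 * total_cost psi lambda mu A xi w.
Proof. by []. Qed.

Lemma total_cost_diff psi lambda mu A xi (L r : R) w w' : 0 <= L -> 0 <= lambda ->
  (forall x y, `|psi x - psi y| <= L * `|x - y|) ->
  (forall j, `|w j 0 - w' j 0| <= r) ->
  `|total_cost psi lambda mu A xi w - total_cost psi lambda mu A xi w'| <=
  (L * (\sum_i \sum_j `|A i j|) + lambda / 2 * \sum_(j < n) (2 * `|w j 0 + mu j 0| + r)) * r.
Proof.
move=> L0 l0 psiL ww'; rewrite /total_cost opprD addrACA -mulrBr -!sumrB.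
rewrite mulrDl (le_trans (ler_normD _ _))// lerD//.
  rewrite (le_trans (ler_norm_sum _ _ _))// -mulrA mulr_suml mulr_sumr ler_sum// => i _.
  rewrite (le_trans (psiL _ _))// ler_wpM2l//.
  have -> : (A *m w) i 0 - xi i 0 - ((A *m w') i 0 - xi i 0) = \sum_j A i j * (w j 0 - w' j 0).
    rewrite opprB addrA subrK !mxE -sumrB; apply: eq_bigr => j _; ring.
  rewrite (le_trans (ler_norm_sum _ _ _))// mulr_suml ler_sum// => j _.
  by rewrite normrM ler_wpM2l.
have l2 : 0 <= lambda / 2 by rewrite divr_ge0.
rewrite normrM (ger0_norm l2) -[leRHS]mulrA ler_wpM2l//.
rewrite (le_trans (ler_norm_sum _ _ _))// mulr_suml ler_sum// => j _.
rewrite !mxE subr_sqr normrM mulrC.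
have := ww' j; set a := w j 0; set b := w' j 0; set c := mu j 0 => ab.
have -> : a + c - (b + c) = a - b by ring.
rewrite ler_pM// ?(le_trans _ ab)//.
have -> : a + c + (b + c) = 2 * (a + c) - (a - b) by ring.
by rewrite (le_trans (ler_normB _ _))// normrM ger0_norm// lerD.
Qed.

Lemma total_cost_locally_lipschitz psi lambda mu A xi (L : R) : 0 <= L -> 0 <= lambda ->
  (forall x y, `|psi x - psi y| <= L * `|x - y|) ->
  locally_lipschitz (total_cost psi lambda mu A xi).
Proof.
move=> L0 l0 psiL w.
exists (L * (\sum_i \sum_j `|A i j|) + lambda / 2 * \sum_(j < n) (2 * `|w j 0 + mu j 0| + 1)).
  apply: addr_ge0; apply: mulr_ge0 => //.
  - by apply: sumr_ge0 => i _; exact: sumr_ge0.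
  - by rewrite divr_ge0.
  - by apply: sumr_ge0 => j _; rewrite addr_ge0// mulr_ge0.
move=> w' r /andP[r0 r1] ww'; apply: (le_trans (total_cost_diff mu A xi L0 l0 psiL ww')).
rewrite ler_wpM2r// lerD2l ler_wpM2l ?divr_ge0// ler_sum// => j _.
by rewrite lerD2l.
Qed.

Lemma total_cost_coercive psi lambda mu A xi (c : R) w : 0 < lambda -> (forall x, 0 <= psi x) ->
  total_cost psi lambda mu A xi w <= c ->
  forall j, `|w j 0| <= 1 + 2 / lambda * c + \sum_k `|mu k 0|.
Proof.
move=> l0 psi0 wc j.
have sq : lambda / 2 * (w j 0 + mu j 0) ^+ 2 <= c.
  apply: le_trans wc; rewrite /total_cost -[leLHS]add0r lerD//; first exact: sumr_ge0.
  rewrite ler_pM2l ?divr_gt0// (bigD1 j)//= mxE lerDl.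
  by apply: sumr_ge0 => k _; rewrite sqr_ge0.
have h1 : `|w j 0 + mu j 0| <= 1 + 2 / lambda * c.
  have : (w j 0 + mu j 0) ^+ 2 <= 2 / lambda * c.
    have -> : (w j 0 + mu j 0) ^+ 2 = 2 / lambda * (lambda / 2 * (w j 0 + mu j 0) ^+ 2).
      by field; rewrite gt_eqF.
    by rewrite ler_wpM2l// divr_ge0// ltW.
  rewrite -real_normK ?num_real//; set x := `|_|.
  have x0 : 0 <= x := normr_ge0 _.
  by have := sqr_ge0 (x - 1); nra.
have h2 : `|mu j 0| <= \sum_k `|mu k 0|.
  by rewrite (bigD1 j)//= lerDl sumr_ge0.
have := ler_normB (w j 0 + mu j 0) (mu j 0); rewrite addrK; lra.
Qed.

(** Used with [C] empty for the original problem, and with [C] a single coordinate for the smoothed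
    leave-one-out problem. *)
Lemma total_cost_minimizer psi lambda mu A xi (L : R) (C : pred 'I_n) : 0 <= L -> 0 < lambda ->
  (forall x, 0 <= psi x) -> (forall x y, `|psi x - psi y| <= L * `|x - y|) ->
  exists2 w0 : 'cV[R]_n, (forall j, C j -> w0 j 0 = 0) & forall w, (forall j, C j -> w j 0 = 0) ->
    total_cost psi lambda mu A xi w0 <= total_cost psi lambda mu A xi w.
Proof.
move=> L0 l0 psi0 psiL.
apply: (@exists_minimizer _ _ _ C _ 0); first exact: total_cost_locally_lipschitz (ltW l0) psiL.
  by move=> j _; rewrite mxE.
by move=> w; exact: total_cost_coercive.
Qed.

End total_cost.

Section leave_one_out.
Context {R : realType} {m n : nat}.

Lemma isd_min0 (q : R -> R) (dq : R -> R) : (forall t : R, is_derive t 1 q (dq t)) ->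
  (forall t, q 0 <= q t) -> dq 0 = 0.
Proof.
move=> dqE qmin.
have d1 : is_derive (0 : R) 1 q 0.
  by apply: (@derive1_at_min _ q (- 1) 1) => //; rewrite in_itv /=; lra.
by rewrite -(@derive_val _ _ _ _ _ _ _ (dqE 0)) (@derive_val _ _ _ _ _ _ _ d1).
Qed.

Lemma tangent_le (g g1 g2 : R -> R) : (forall x : R, is_derive x 1 g (g1 x)) ->
  (forall x : R, is_derive x 1 g1 (g2 x)) -> (forall x, 0 <= g2 x) ->
  forall r y, g r + g1 r * (y - r) <= g y.
Proof.
move=> dg dg1 g20 r y.
have mono a b : a <= b -> g1 a <= g1 b.
  move=> ab; have [c _ E] := MVT_global dg1 ab.
  by rewrite -subr_ge0 E mulr_ge0// subr_ge0.
have [ry|/ltW yr] := leP r y.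
  have [c /andP[rc cy] E] := MVT_global dg ry.
  rewrite -lerBrDl E ler_wpM2r ?subr_ge0// mono//.
have [c /andP[yc cr] E] := MVT_global dg yr.
by have := mono _ _ cr; have := subr_ge0 y r; rewrite yr; nra.
Qed.

(* Since the minimizer of the smoothed cost on [w j = 0] does not involve column
   [j], neither do the residual derivatives [s]. *)
Lemma leave_one_out (psi : R -> R) (lambda L eta : R) (mu : 'cV[R]_n) (xi : 'cV[R]_m)
    (A : 'M[R]_(m, n)) (j : 'I_n) :
  0 <= L -> 0 < lambda -> 0 < eta -> (forall x, 0 <= psi x) ->
  (forall x y, `|psi x - psi y| <= L * `|x - y|) ->
  (forall x, 0 <= psi (x + eta + eta) - 2 * psi (x + eta) + psi x) ->
  exists2 s : 'I_m -> R, (forall i, `|s i| <= L) &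
  forall A' : 'M[R]_(m, n), (forall i k, k != j -> A' i k = A i k) ->
  exists w0 : 'cV[R]_n, forall w : 'cV[R]_n,
    total_cost psi lambda mu A' xi w0 + w j 0 * (\sum_i A' i j * s i + lambda * mu j 0) +
      lambda / 2 * w j 0 ^+ 2 <=
    total_cost psi lambda mu A' xi w + 6 * m%:R * L * eta.
Proof.
move=> L0 l0 e0 psi0 psiL psicvx.
(* Smoothing supplies the stationarity equations. [g] is nonnegative since its values are values of
   [psi], and convex since [g2] is a scaled second difference of [psi]. *)
have [g [g1 [g2 [g3 [[dg dg1 dg2] avg [g1L _ _] g2E]]]]] := lipschitz_smoothing e0 psiL.
have g0 x : 0 <= g x by have [c _ ->] := avg x.
have g20 x : 0 <= g2 x.
  by have [c ->] := g2E x; rewrite mulr_ge0// invr_ge0 sqr_ge0.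
have gL x y : `|g x - g y| <= L * `|x - y| by apply: (deriv_bound dg) => z _.
have gpsi x : `|g x - psi x| <= 3 * L * eta.
  have [c /andP[xc cx] ->] := avg x; apply: (le_trans (psiL _ _)).
  have -> : 3 * L * eta = L * (3 * eta) by ring.
  by rewrite ler_wpM2l// ger0_norm; lra.
have [w0 w0j w0min] := @total_cost_minimizer R m n g lambda mu A xi L (pred1 j) L0 l0 g0 gL.
have w0j0 : w0 j 0 = 0 by apply: w0j => /=.
pose res i := (A *m w0) i 0 - xi i 0.
exists (fun i => g1 (res i)) => // A' A'A.
have A'w0 i : (A' *m w0) i 0 = (A *m w0) i 0.
  rewrite !mxE; apply: eq_bigr => k _; have [->|kj] := eqVneq k j; first by rewrite w0j0 !mulr0.
  by rewrite A'A.
exists w0 => w.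
(* Minimality of [w0] along direction [k]; the constraint rules out direction [j]. *)
have grad k : k != j -> \sum_i A i k * g1 (res i) + lambda * (w0 k 0 + mu k 0) = 0.
  move=> kj.
  pose q t := \sum_i g (res i + t * A i k) +
    lambda / 2 * ((w0 k 0 + mu k 0 + t) ^+ 2 + \sum_(l | l != k) (w0 l 0 + mu l 0) ^+ 2).
  have qE t : q t = total_cost g lambda mu A xi (w0 + t *: delta_mx k 0).
    rewrite /total_cost; congr (_ + _ * _).
      apply: eq_bigr => i _; congr g; rewrite /res !mxE addrAC; congr (_ + _).
      have -> : t * A i k = \sum_l A i l * (t * (l == k)%:R).
        rewrite (bigD1 k)//= eqxx mulr1 big1 ?addr0; first by rewrite mulrC.
        by move=> l /negbTE ->; rewrite !mulr0.
      rewrite -big_split; apply: eq_bigr => l _ /=.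
      by rewrite !mxE eqxx andbT mulrDr.
    rewrite [RHS](bigD1 k)//= !mxE !eqxx mulr1 [in RHS]addrAC; congr (_ + _).
    by apply: eq_bigr => l /negbTE lk; rewrite !mxE lk mulr0 addr0.
  pose dq t := \sum_i (g1 (res i + t * A i k) * A i k) +
    lambda / 2 * (2%:R * (w0 k 0 + mu k 0 + t) + 0).
  have dqE (t : R) : is_derive t 1 q (dq t).
    have d1 i : is_derive t 1 (fun t => g (res i + t * A i k)) (g1 (res i + t * A i k) * A i k).
      apply: (@isd_comp _ g (fun t => res i + t * A i k) t _ _ (dg _)).
      apply: (is_derive_eq (isdD (isdC t (res i)) (isdM (isdI t) (isdC t (A i k))))).
      by rewrite add0r mul1r mulr0 addr0.
    have d2 : is_derive t 1 (fun t => (w0 k 0 + mu k 0 + t) ^+ 2) (2%:R * (w0 k 0 + mu k 0 + t)).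
      apply: (is_derive_eq (isdX 2 (isdD (isdC t (w0 k 0 + mu k 0)) (isdI t)))).
      by rewrite add0r mulr1.
    exact: (isdD (isd_sum _ _ d1) (isdZ (lambda / 2) (isdD d2 (isdC t _)))).
  have qmin t : q 0 <= q t.
    rewrite !qE scale0r addr0; apply: w0min => l /eqP ->.
    by rewrite !mxE w0j0 eq_sym (negbTE kj) /= mulr0 addr0.
  rewrite -[RHS](isd_min0 dqE qmin) /dq !addr0.
  congr (_ + _); last by field.
  by apply: eq_bigr => i _; rewrite mul0r addr0 mulrC.
pose d k := w k 0 - w0 k 0.
(* Tangent lines at the residuals bound the loss from below, and the ridge term is expanded exactly.
   Stationarity reduces the first-order part to coordinate [j]; of the second-order part only
   [w j 0 ^+ 2] is kept. *)
have key : total_cost g lambda mu A' xi w0 + w j 0 * (\sum_i A' i j * g1 (res i) + lambda * mu j 0) +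
    lambda / 2 * w j 0 ^+ 2 <= total_cost g lambda mu A' xi w.
  rewrite /total_cost.
  have E1 : \sum_i g ((A' *m w0) i 0 - xi i 0) + \sum_i \sum_k A' i k * d k * g1 (res i) <=
      \sum_i g ((A' *m w) i 0 - xi i 0).
    rewrite -big_split ler_sum// => i _ /=; rewrite A'w0 -/(res i).
    apply: le_trans (tangent_le dg dg1 g20 (res i) _); rewrite lerD2l.
    have -> : (A' *m w) i 0 - xi i 0 - res i = \sum_k A' i k * d k.
      rewrite /res -A'w0 opprB addrA subrK !mxE -sumrB.
      by apply: eq_bigr => k _; rewrite /d mulrBr.
    by rewrite mulrC mulr_suml.
  have E2 : \sum_k (w + mu) k 0 ^+ 2 = \sum_k (w0 + mu) k 0 ^+ 2 +
     2 * \sum_k d k * (w0 k 0 + mu k 0) + \sum_k d k ^+ 2.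
    rewrite mulr_sumr -!big_split; apply: eq_bigr => k _ /=.
    by rewrite !mxE /d; ring.
  have E3 : \sum_i \sum_k A' i k * d k * g1 (res i) + lambda * \sum_k d k * (w0 k 0 + mu k 0) =
      w j 0 * (\sum_i A' i j * g1 (res i) + lambda * mu j 0).
    rewrite exchange_big mulr_sumr -big_split (bigD1 j)//= [X in _ + X = _]big1 ?addr0.
      rewrite /d w0j0 subr0 add0r mulrDr mulr_sumr; congr (_ + _); last by ring.
      by apply: eq_bigr => i _; ring.
    move=> k kj; transitivity (d k * (\sum_i A i k * g1 (res i) + lambda * (w0 k 0 + mu k 0)));
      last by rewrite grad// mulr0.
    rewrite [RHS]mulrDr mulr_sumr; congr (_ + _); last by ring.
    by apply: eq_bigr => i _; rewrite A'A//; ring.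
  have E4 : w j 0 ^+ 2 <= \sum_k d k ^+ 2.
    rewrite (bigD1 j)//= {1}/d w0j0 subr0 lerDl sumr_ge0// => k _; exact: sqr_ge0.
  have E5 := ler_wpM2l (ltW (divr_gt0 l0 (ltr0n _ 2))) E4.
  rewrite E2 -E3; move: E1 E5.
  set S1 := \sum_i g _; set S2 := \sum_i \sum_k _; set S3 := \sum_i g _.
  set T1 := \sum_k (w0 + mu) k 0 ^+ 2; set T2 := \sum_k d k * _; set T3 := \sum_k d k ^+ 2.
  move=> E1 E5.
  have -> : lambda / 2 * (T1 + 2 * T2 + T3) = lambda / 2 * T1 + lambda * T2 + lambda / 2 * T3 by field.
  lra.
(* Passing from [g] back to [psi] is paid at [w0] and again at [w], whence the factor 6 in the
   statement. *)
have close v : `|total_cost g lambda mu A' xi v - total_cost psi lambda mu A' xi v| <= 3 * m%:R * L * eta.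
  rewrite /total_cost opprD addrACA subrr addr0 -sumrB (le_trans (ler_norm_sum _ _ _))//.
  have -> : 3 * m%:R * L * eta = \sum_(i < m) 3 * L * eta.
    by rewrite sumr_const card_ord -[RHS]mulr_natr; ring.
  exact: ler_sum.
have := close w; have := close w0; rewrite !ler_norml => /andP[a1 a2] /andP[b1 b2].
by lra.
Qed.

End leave_one_out.

(** * Finite nets and measurability of the minimal cost *)

Section grid.
Context {R : realType} {n : nat}.
Implicit Types (S : set 'cV[R]_n) (r : R) (w : 'cV[R]_n).

Definition cell r w : {ffun 'I_n -> int} := [ffun j => Num.floor (w j 0 / r)].

Lemma same_cell r w w' : 0 < r -> cell r w = cell r w' -> forall j, `|w j 0 - w' j 0| <= r.
Proof.
move=> r0 /ffunP ww' j; have := ww' j; rewrite !ffunE => E.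
have := floor_itv (w j 0 / r); have := floor_itv (w' j 0 / r).
rewrite E => /andP[a1 a2] /andP[b1 b2].
have : `|w j 0 / r - w' j 0 / r| <= 1.
  by rewrite intrD in a2 b2; rewrite ler_norml; lra.
by rewrite -mulrBl normrM normfV (gtr0_norm r0) ler_pdivrMr// mul1r.
Qed.

(** The representative is taken in [S] itself, not at a corner of the cell, so that minimizing over
    representatives never leaves [S]. *)
Definition cell_point S r (f : {ffun 'I_n -> int}) : 'cV[R]_n :=
  xget 0 [set w | S w /\ cell r w = f].

Lemma cell_pointP S r w : 0 < r -> S w ->
  S (cell_point S r (cell r w)) /\ forall j, `|w j 0 - cell_point S r (cell r w) j 0| <= r.
Proof.
move=> r0 Sw; rewrite /cell_point; case: xgetP => [w' -> [Sw' E]|/(_ w)[]//].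
by split=> // j; exact: same_cell.
Qed.

(** The integer parts of [w j 0 / r] lie between [- K] and [K], whence [2 * K + 1] cells per
    coordinate. The filter removes default representatives lying outside [S]. *)
Lemma finite_net S r (B : R) (K : nat) : 0 < r -> B / r <= K%:R ->
  (forall w, S w -> forall j, `|w j 0| <= B) ->
  exists pts : seq 'cV[R]_n, [/\ forall p, p \in pts -> S p,
    (size pts <= (2 * K + 1) ^ n)%N &
    forall w, S w -> exists2 p, p \in pts & forall j, `|w j 0 - p j 0| <= r].
Proof.
move=> r0 BK SB.
pose shift (f : {ffun 'I_n -> 'I_(2 * K + 1)}) : {ffun 'I_n -> int} :=
  [ffun j => (f j : nat)%:Z - K%:Z].
pose P w := `[< S w >].
exists [seq p <- [seq cell_point S r (shift f) | f <- enum {ffun 'I_n -> 'I_(2 * K + 1)}] | P p].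
split.
- by move=> p; rewrite mem_filter => /andP[/asboolP].
- rewrite size_filter (leq_trans (count_size _ _))// size_map -cardE card_ffun !card_ord.
  by [].
- move=> w Sw; have [Sp wp] := cell_pointP r0 Sw.
  exists (cell_point S r (cell r w)) => //.
  rewrite mem_filter; apply/andP; split; first exact/asboolP.
  apply/mapP.
  have bnd j : (- K%:Z <= cell r w j <= K%:Z)%R.
    have /ler_normlP[w1 w2] := SB _ Sw j.
    rewrite ffunE; apply/andP; split.
      rewrite floor_ge_int rmorphN /= -[leRHS]opprK lerN2 -mulNr; apply: le_trans BK.
      by rewrite ler_pM2r ?invr_gt0//; lra.
    rewrite -ltzD1 floor_lt_int intrD.
    apply: (@le_lt_trans _ _ K%:R); last by rewrite ltrDl.
    by apply: le_trans BK; rewrite ler_pM2r ?invr_gt0//; lra.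
  have lt j : (absz (cell r w j + K%:Z)%R < 2 * K + 1)%N.
    have /andP[b1 b2] := bnd j; lia.
  exists [ffun j => Ordinal (lt j)]; first by rewrite mem_enum.
  congr cell_point; apply/ffunP => j; rewrite !ffunE /=.
  have /andP[b1 b2] := bnd j; move: b1 b2; rewrite ffunE => b1 b2; lia.
Qed.

End grid.

Section min_cost_measurable.
Context {R : realType} {m n : nat} d (T : measurableType d).
Variables (psi : R -> R) (lambda L : R) (mu : 'cV[R]_n).
Hypotheses (L0 : 0 <= L) (l0 : 0 <= lambda).
Hypothesis psiL : forall x y, `|psi x - psi y| <= L * `|x - y|.
Variables (A : T -> 'M[R]_(m, n)) (xi : T -> 'cV[R]_m).
Hypothesis mA : forall i j, measurable_fun setT (fun t => A t i j).
Hypothesis mxi : forall i, measurable_fun setT (fun t => xi t i 0).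

Lemma measurable_total_cost w : measurable_fun setT (fun t => total_cost psi lambda mu (A t) (xi t) w).
Proof.
have mpsi : measurable_fun setT psi.
  exact: continuous_measurable_fun (lipschitz_continuous psiL).
apply: measurable_funD => //; apply: measurable_sum => i.
apply: measurableT_comp => //; apply: measurable_funB => //.
under eq_fun do rewrite mxE; apply: measurable_sum => j.
by apply: measurable_funM.
Qed.

Lemma measurable_robust_cost w :
  measurable_fun setT (fun t => robust_cost psi lambda mu w (A t) (xi t)).
Proof. by apply: measurable_funM => //; exact: measurable_total_cost. Qed.

(** By continuity of the cost, the infimum over [S] is attained along countably many points:
    representatives of the cells meeting [S], for every mesh [1 / (k + 1)]. Pickling enumerates mesh
    and cell together, and codes yielding no point of [S] contribute [+oo]. *)
Lemma measurable_min_cost (S : set 'cV[R]_n) :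
  measurable_fun setT (fun t => min_cost psi lambda mu (A t) (xi t) S).
Proof.
pose pt k : option 'cV[R]_n :=
  if @unpickle (nat * {ffun 'I_n -> int})%type k is Some p
  then let w := cell_point S (p.1.+1%:R^-1) p.2 in if `[< S w >] then Some w else None
  else None.
pose h k t : \bar R := if pt k is Some w then (robust_cost psi lambda mu w (A t) (xi t))%:E else +oo%E.
have mh k : measurable_fun setT (h k).
  rewrite /h; case: (pt k) => [w|]; last exact: measurable_cst.
  by apply/measurable_EFinP; exact: measurable_robust_cost.
have := measurable_fun_einfs mh 0%N; congr measurable_fun; apply/funext => t.
rewrite /einfs /=; apply/eqP; rewrite eq_le; apply/andP; split; last first.
  apply: le_ereal_inf_tmp => _ [k _ <-]; rewrite /h /pt.
  case: (unpickle k) => [p|]; last exact: leey.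
  case: asboolP => [Sw|_]; last exact: leey.
  by apply: ereal_inf_lbound; exists (cell_point S (p.1.+1%:R^-1) p.2).
apply: le_ereal_inf_tmp => _ [w Sw <-]; apply/lee_addgt0Pr => e e0.
have [K K0 HK] := total_cost_locally_lipschitz mu (A t) (xi t) L0 l0 psiL w.
have mi0 : 0 <= m%:R^-1 :> R by [].
pose D := m%:R^-1 * K.
have D0 : 0 <= D by rewrite mulr_ge0.
have [N HN] : exists N : nat, D * N.+1%:R^-1 <= e.
  exists (Num.bound (D / e)); rewrite ler_pdivrMr ?ltr0Sn// mulrC -ler_pdivrMr//.
  by rewrite ltW// (lt_trans (archi_boundP _)) ?divr_ge0 ?(ltW e0)// ltr_nat.
have N0 : 0 < N.+1%:R^-1 :> R by rewrite invr_gt0 ltr0Sn.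
have [Sp wp] := cell_pointP N0 Sw.
set p := cell_point _ _ _ in Sp wp.
apply: (@le_trans _ _ (robust_cost psi lambda mu p (A t) (xi t))%:E).
  apply: ereal_inf_lbound; exists (pickle (N, cell (N.+1%:R^-1) w)) => //.
  by rewrite /h /pt pickleK /= asboolT.
rewrite -EFinD lee_fin.
apply: (@le_trans _ _ (robust_cost psi lambda mu w (A t) (xi t) + D * N.+1%:R^-1));
  last by rewrite lerD2l.
rewrite !robust_costE /D -mulrA -mulrDr ler_wpM2l//.
have N1 : 0 <= (N.+1%:R^-1 : R) <= 1 by rewrite ltW//= invf_le1 ?ler1n ?ltr0Sn.
by rewrite -lerBlDl (le_trans (ler_norm _))// distrC; exact: HK.
Qed.

End min_cost_measurable.

(** * Coordinatewise bounds for the minimizer *)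

Section design_law.
Context {R : realType} (m n : nat).

(** One index set for design and noise: the noise is then a block of coordinates on which the two
    families of the replacement coincide. *)
Definition entry := ('I_m * 'I_n + 'I_m)%type.

Definition design_of (w : coordinates R entry) : 'M[R]_(m, n) := \matrix_(i, j) w (inl (i, j)).
Definition noise_of (w : coordinates R entry) : 'cV[R]_m := \col_i w (inr i).

Lemma measurable_design_of i j : measurable_fun setT (fun w => design_of w i j).
Proof.
have -> : (fun w => design_of w i j) = (fun w : coordinates R entry => w (inl (i, j))).
  by apply/funext => w; rewrite mxE.
exact: measurable_coordinate.
Qed.

Lemma measurable_noise_of i : measurable_fun setT (fun w => noise_of w i 0).
Proof.
have -> : (fun w => noise_of w i 0) = (fun w : coordinates R entry => w (inr i)).
  by apply/funext => w; rewrite mxE.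
exact: measurable_coordinate.
Qed.

Context d (T : measurableType d) (P : probability T R).

Definition design_moments (M6 : R) (X : entry -> T -> R) : Prop := forall ij : 'I_m * 'I_n,
  [/\ (\int[P]_t (X (inl ij) t)%:E = 0)%E,
      (\int[P]_t (X (inl ij) t ^+ 2)%:E = (m%:R^-1)%:E)%E &
      (\int[P]_t (X (inl ij) t ^+ 6)%:E <= (M6 / m%:R ^+ 3)%:E)%E].

End design_law.
Arguments entry : clear implicits.

Lemma union_bound (R : realType) d (T : measurableType d) (P : probability T R)
    (I : finType) (F : I -> set T) : (forall i, measurable (F i)) ->
  (P (\bigcup_i F i) <= \sum_i P (F i))%E.
Proof.
move=> mF; have -> : \bigcup_i F i = \bigcup_(i in [set` index_enum I]) F i.
  by apply: eq_bigcupl; split=> i //= _; rewrite mem_index_enum.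
rewrite bigcup_seq; elim: (index_enum I) => [|i s IH]; first by rewrite !big_nil measure0.
rewrite !big_cons (le_trans (measureU2 _ _ _))//; last exact: leeD2l.
exact: bigsetU_measurable.
Qed.

Section tail_bound.
Context {R : realType}.

Lemma expR_le_quadratic (x : R) : x <= 2^-1 -> expR x <= 1 + x + 2 * x ^+ 2.
Proof.
move=> x2; have x1 : 0 < 1 - x by lra.
have := expR_ge1Dx (- x); rewrite expRN => H.
have : expR x <= (1 - x)^-1.
  by rewrite -[leLHS]invrK lef_pV2 ?posrE ?invr_gt0 ?expR_gt0.
move=> /le_trans; apply; rewrite -[leLHS]mul1r ler_pdivrMr//.
have : 0 <= x ^+ 2 * (1 - 2 * x) by rewrite mulr_ge0 ?sqr_ge0//; lra.
by nra.
Qed.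

Definition trunc1 (x : R) : R := if `|x| <= 1 then x else 0.

Lemma measurable_trunc1 : measurable_fun setT trunc1.
Proof.
apply: measurable_fun_ifT => //.
apply: (measurable_fun_bool true).
rewrite setTI (_ : _ @^-1` _ = [set x | `|x| <= 1]); last first.
  by apply/seteqP; split=> x /=.
have := @normr_measurable R setT measurableT _ (measurable_itv `]-oo, 1%R]).
by rewrite setTI; congr measurable; apply/seteqP; split=> x; rewrite /= in_itv.
Qed.

(** The right side contains [x] untruncated, so that its zero mean can be used. When [|x| > 1] the
    left side is 1, and [c * x >= - x^2] suffices. *)
Lemma expR_trunc1_le (c x : R) : `|c| <= 2^-1 -> expR (c * trunc1 x) <= 1 + c * x + 2 * x ^+ 2.
Proof.
move=> c2; have := c2; rewrite ler_norml => /andP[c3 c4].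
rewrite /trunc1; case: (leP `|x| 1) => x1.
  have cx : `|c * x| <= 2^-1.
    by rewrite normrM -[leRHS]mulr1 ler_pM.
  apply: (le_trans (expR_le_quadratic (le_trans (ler_norm _) cx))).
  rewrite lerD2l ler_wpM2l// exprMn ler_piMl ?sqr_ge0//.
  rewrite -real_normK ?num_real// exprn_ile1//; lra.
rewrite mulr0 expR0.
have x2 : `|x| <= x ^+ 2 by rewrite -real_normK ?num_real// expr2 ler_peMl// ltW.
have : - x ^+ 2 <= c * x.
  rewrite lerNl -mulNr (le_trans (ler_norm _))// normrM normrN (le_trans _ x2)//.
  by rewrite ler_piMl// (le_trans c2)//; lra.
by have := sqr_ge0 x; lra.
Qed.

Context {J : finType} d (T : measurableType d) (P : probability T R).
Variables (X : J -> T -> R) (v : R).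
Hypothesis mX : forall j, measurable_fun setT (X j).
Hypothesis indX : mutually_independent P X.
Variable D : pred J.
Hypothesis X1 : forall j, D j -> (\int[P]_t (X j t)%:E = 0)%E.
Hypothesis X2 : forall j, D j -> (\int[P]_t (X j t ^+ 2)%:E = v%:E)%E.

Lemma integrable_of_sqr j : D j -> P.-integrable setT (EFin \o X j) /\
  P.-integrable setT (EFin \o (fun t => X j t ^+ 2)).
Proof.
move=> Dj.
have i2 : P.-integrable setT (EFin \o (fun t => X j t ^+ 2)).
  apply/integrableP; split; first by apply/measurable_EFinP; exact: measurable_funX.
  under eq_integral do rewrite /= ger0_norm ?sqr_ge0//.
  by rewrite X2// ltry.
split=> //.
apply: (@le_integrable _ _ _ _ _ measurableT _ (EFin \o (fun t => X j t ^+ 2 + 1))).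
- by apply/measurable_EFinP.
- move=> t _ /=; rewrite lee_fin [leRHS]ger0_norm ?addr_ge0 ?sqr_ge0//.
  rewrite -[in leRHS]real_normK ?num_real//; set x := `|X j t|.
  have x0 : 0 <= x := normr_ge0 _.
  by have := sqr_ge0 (x - 1); nra.
- have -> : EFin \o (fun t => X j t ^+ 2 + 1) = ((EFin \o (fun t => X j t ^+ 2)%R) \+ cst 1%E)%E.
    by apply/funext.
  apply: integrableD => //; exact: finite_measure_integrable_cst.
Qed.

Lemma mean_expR_trunc1 j (c : R) : D j -> `|c| <= 2^-1 ->
  (\int[P]_t (expR (c * trunc1 (X j t)))%:E <= (expR (2 * v))%:E)%E.
Proof.
move=> Dj c2; have [i1 i2] := integrable_of_sqr Dj.
have mt : measurable_fun setT (fun t => expR (c * trunc1 (X j t))).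
  apply: measurableT_comp => //; apply: measurable_funM => //.
  exact: (measurableT_comp measurable_trunc1 (mX j)).
pose f1 := (EFin \o X j : T -> \bar R); pose f2 := (EFin \o (fun t => X j t ^+ 2) : T -> \bar R).
have i1' : P.-integrable setT (fun t => c%:E * f1 t)%E by exact: integrableZl.
have i2' : P.-integrable setT (fun t => 2%:E * f2 t)%E by exact: integrableZl.
have ic : P.-integrable setT (cst 1%:E : T -> \bar R) by exact: finite_measure_integrable_cst.
have i3 : P.-integrable setT (fun t => 1%:E + c%:E * f1 t)%E by exact: integrableD.
apply: (@le_trans _ _ (\int[P]_t (1%:E + c%:E * f1 t + 2%:E * f2 t))%E).
  apply: ge0_le_integral => //.
  - exact/measurable_EFinP.
  - apply: (measurable_int P); exact: integrableD.
  - by move=> t _; rewrite /f1 /f2 /= -!EFinM -!EFinD lee_fin expR_trunc1_le.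
rewrite integralD// integralD// integral_cst//= probability_setT mule1.
rewrite integralZl// integralZl// /f1 /f2 /= X1// X2// mule0 adde0 -EFinM -EFinD lee_fin.
exact: expR_ge1Dx.
Qed.

(** Induction on the list: [decouple] resamples the leading variable, whose exponential is then
    integrated on its own, and the exponents [2 * v] add up. *)
Lemma mean_expR_sum (c : J -> R) : (forall j, `|c j| <= 2^-1) -> forall s : seq J,
  uniq s -> all D s ->
  (\int[P]_t (expR (\sum_(j <- s) c j * trunc1 (X j t)))%:E <= (expR (2 * v * (size s)%:R))%:E)%E.
Proof.
move=> c2; elim => [_ _|k s IH /= /andP[ks us] /andP[Dk Ds]].
  under eq_integral do rewrite big_nil expR0.
  by rewrite integral_cst//= probability_setT mule1 mulr0 expR0.
pose S (w : coordinates R J) := \sum_(j <- s) c j * trunc1 (w j).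
pose F k (w : coordinates R J) : R := c k * trunc1 (w k).
have mF j : measurable_fun setT (F j).
  apply: measurable_funM => //.
  exact: (measurableT_comp measurable_trunc1 (measurable_coordinate j)).
have mS : measurable_fun setT S by apply: measurable_sum => j; exact: mF.
have mPhi : measurable_fun setT (fun w => (expR (F k w + S w))%:E).
  by apply/measurable_EFinP; apply: measurableT_comp => //; exact: measurable_funD.
have Phi0 w : (0 <= (expR (F k w + S w))%:E)%E by rewrite lee_fin expR_ge0.
under eq_integral do rewrite big_cons.
rewrite (decouple mX indX (pred1 k) mPhi Phi0).
apply: (@le_trans _ _ (\int[P]_t ((expR (S (X^~ t)))%:E * (expR (2 * v))%:E))%E).
  have ms : measurable_fun setT (fun t => expR (S (X^~ t))).
    apply: measurableT_comp => //; exact: (measurableT_comp mS (joint_measurable mX)).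
  have mk : measurable_fun setT (fun u => expR (c k * trunc1 (X k u))).
    apply: measurableT_comp => //; apply: measurable_funM => //.
    exact: (measurableT_comp measurable_trunc1 (mX k)).
  have E t : (\int[P]_u (expR (F k (fun j => if pred1 k j then X j u else X j t) +
       S (fun j => if pred1 k j then X j u else X j t)))%:E =
      (expR (S (X^~ t)))%:E * \int[P]_u (expR (c k * trunc1 (X k u)))%:E)%E.
    rewrite -ge0_integralZl//; last exact/measurable_EFinP.
    apply: eq_integral => u _; rewrite -EFinM -expRD addrC; congr EFin; congr expR; congr (_ + _).
      rewrite /S big_seq [RHS]big_seq; apply: eq_bigr => j js /=.
      by case: eqP js ks => // -> ->.
    by rewrite /F /= eqxx.
  under eq_integral do rewrite E.
  apply: ge0_le_integral => //.
  - by move=> t _; apply: mule_ge0; [rewrite lee_fin expR_ge0|apply: integral_ge0 => u _; rewrite lee_fin expR_ge0].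
  - by apply: emeasurable_funM => //; exact/measurable_EFinP.
  - by apply: emeasurable_funM => //; exact/measurable_EFinP.
  - move=> t _; apply: lee_wpmul2l; first by rewrite lee_fin expR_ge0.
    exact: mean_expR_trunc1.
rewrite ge0_integralZr//; last first.
  by apply/measurable_EFinP; apply: measurableT_comp => //; exact: (measurableT_comp mS (joint_measurable mX)).
apply: (@le_trans _ _ ((expR (2 * v * (size s)%:R))%:E * (expR (2 * v))%:E)%E).
  by apply: lee_wpmul2r; [rewrite lee_fin expR_ge0|exact: IH].
by rewrite -EFinM -expRD -(natr1 (size s)) mulrDr mulr1.
Qed.

(* Chernoff bound for the truncated variables, the sixth moments controlling the
   truncation. *)
Lemma tail_sum (M6 : R) (s : seq J) (c : J -> R) (y : R) : uniq s -> all D s ->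
  (forall j, D j -> (\int[P]_t (X j t ^+ 6)%:E <= M6%:E)%E) ->
  (forall j, `|c j| <= 2^-1) ->
  (P [set t | (y < `|\sum_(j <- s) c j * X j t|)%R] <=
   ((size s)%:R * M6 + 2 * expR (2 * v * (size s)%:R - y))%:E)%E.
Proof.
move=> us Ds X6 c2.
pose Z (e : R) t := \sum_(j <- s) (e * c j) * trunc1 (X j t).
have mZ e : measurable_fun setT (Z e).
  apply: measurable_sum => j; apply: measurable_funM => //.
  exact: (measurableT_comp measurable_trunc1 (mX j)).
pose V := [set t | y < `|\sum_(j <- s) c j * X j t|%R].
have mV : measurable V.
  have mS : measurable_fun setT (fun t => `|\sum_(j <- s) c j * X j t|).
    apply: measurableT_comp => //; apply: measurable_sum => j; exact: measurable_funM.
  by have := mS measurableT _ (measurable_itv `]y, +oo[); rewrite setTI; congr measurable;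
    apply/seteqP; split=> t; rewrite /V /= in_itv /= andbT.
(* A majorant of the indicator of [V]: if some [|X j t| > 1], the sixth powers already reach 1;
   otherwise the truncation is inactive and one of the two exponentials is at least 1. *)
pose G t := \sum_(j <- s) X j t ^+ 6 + expR (Z 1 t - y) + expR (Z (- 1) t - y).
have x6 (x : R) : 0 <= x ^+ 6 by rewrite exprn_even_ge0.
have VG t : \1_V t <= G t.
  have s60 : 0 <= \sum_(j <- s) X j t ^+ 6 by exact: sumr_ge0.
  have e1 := expR_ge0 (Z 1 t - y); have e2 := expR_ge0 (Z (- 1) t - y).
  rewrite indicE; case: (boolP (t \in V)) => [|_]; last by rewrite !addr_ge0.
  rewrite inE /V /= => yt.
  have [alls|] := boolP (all (fun j => `|X j t| <= 1) s); last first.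
    move=> /allPn[j js]; rewrite -ltNge => xj.
    have : 1 <= X j t ^+ 6.
      by rewrite (exprM _ 2 3) -(@real_normK _ (X j t)) ?num_real// -exprM exprn_ege1// ltW.
    rewrite /G (big_rem j)//=.
    have : 0 <= \sum_(i <- rem j s) X i t ^+ 6 by exact: sumr_ge0.
    by lra.
  have ZE e : Z e t = e * \sum_(j <- s) c j * X j t.
    rewrite /Z mulr_sumr big_seq [RHS]big_seq; apply: eq_bigr => j js.
    by rewrite /trunc1 (allP alls)// mulrA.
  rewrite /G !ZE mul1r mulN1r.
  move: yt; rewrite ltr_normr => /orP[] yt.
    have : 1 <= expR (\sum_(j <- s) c j * X j t - y) by rewrite -[leLHS]expR0 ler_expR subr_ge0 ltW.
    by move: e2; rewrite ZE mulN1r; lra.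
  have : 1 <= expR (- \sum_(j <- s) c j * X j t - y) by rewrite -[leLHS]expR0 ler_expR subr_ge0 ltW.
  by move: e1; rewrite ZE mul1r; lra.
have mG6 : measurable_fun setT (fun t => \sum_(j <- s) X j t ^+ 6).
  by apply: measurable_sum => j; exact: measurable_funX.
have mGe e : measurable_fun setT (fun t => expR (Z e t - y)).
  by apply: measurableT_comp => //; exact: measurable_funB.
have PV : P V = (\int[P]_t (\1_V t)%:E)%E by rewrite integral_indic// setIT.
rewrite -/V PV.
apply: (@le_trans _ _ (\int[P]_t ((\sum_(j <- s) X j t ^+ 6)%:E + (expR (Z 1 t - y))%:E +
    (expR (Z (- 1) t - y))%:E))%E).
  apply: ge0_le_integral => //.
  - by apply/measurable_EFinP; exact: measurable_indic.
  - by apply: emeasurable_funD; [apply: emeasurable_funD|]; exact/measurable_EFinP.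
  - by move=> t _; rewrite -!EFinD lee_fin; exact: VG.
have e0 e t : (0 <= (expR (Z e t - y))%:E)%E by rewrite lee_fin expR_ge0.
have s0 t : (0 <= (\sum_(j <- s) X j t ^+ 6)%:E)%E by rewrite lee_fin sumr_ge0.
rewrite ge0_integralD//; last 3 first.
- by move=> t _; apply: adde_ge0.
- by apply: emeasurable_funD; exact/measurable_EFinP.
- exact/measurable_EFinP.
rewrite ge0_integralD//; [|exact/measurable_EFinP|exact/measurable_EFinP].
have be e : `|e| = 1 -> (\int[P]_t (expR (Z e t - y))%:E <= (expR (2 * v * (size s)%:R - y))%:E)%E.
  move=> e1.
  under eq_integral do rewrite expRD EFinM.
  rewrite ge0_integralZr//; last by apply/measurable_EFinP; exact: measurableT_comp.
  rewrite expRD EFinM; apply: lee_wpmul2r; first by rewrite lee_fin expR_ge0.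
  apply: (mean_expR_sum (c := fun j => e * c j)) => // j.
  by rewrite normrM e1 mul1r.
have b6 : (\int[P]_t (\sum_(j <- s) X j t ^+ 6)%:E <= ((size s)%:R * M6)%:E)%E.
  under eq_integral do rewrite -sumEFin.
  rewrite ge0_integral_sum//; last 2 first.
  - by move=> j; apply/measurable_EFinP; exact: measurable_funX.
  - by move=> j t _; rewrite lee_fin.
  have -> : ((size s)%:R * M6)%:E = (\sum_(j <- s) M6%:E)%E.
    by rewrite sumEFin big_const_seq count_predT iter_addr_0 mulr_natl.
  by rewrite big_seq [X in (_ <= X)%E]big_seq; apply: lee_sum => j js; apply: X6; exact: (allP Ds).
have := leeD (leeD b6 (be 1 (normr1 _))) (be (- 1) (etrans (normrN _) (normr1 _))).
move=> /le_trans; apply; rewrite -!EFinD lee_fin; lra.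
Qed.

End tail_bound.

Section box.
Context {R : realType} {m n : nat}.
Variables (psi : R -> R) (lambda L : R) (mu : 'cV[R]_n).
Hypotheses (L0 : 0 < L) (l0 : 0 < lambda) (m0 : (0 < m)%N).
Hypothesis psi0 : forall x, 0 <= psi x.
Hypothesis psiL : forall x y, `|psi x - psi y| <= L * `|x - y|.
Hypothesis psi_mid : forall x h, 0 < h -> 0 <= psi (x + h + h) - 2 * psi (x + h) + psi x.

Definition far_coordinate (B : R) (j : 'I_n) : set 'cV[R]_n := [set v | B < `|v j 0|].

(* Contains every configuration having a minimizer [v] with [B < |v j 0|]; unlike that event
   it is clearly measurable. *)
Definition unboxed (B : R) (j : 'I_n) : set (coordinates R (entry m n)) :=
  [set w | (min_cost psi lambda mu (design_of w) (noise_of w) (far_coordinate B j) <=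
            min_cost psi lambda mu (design_of w) (noise_of w) setT)%E].

Lemma measurable_unboxed B j : measurable (unboxed B j).
Proof.
have mmin S : measurable_fun setT
    (fun w => min_cost psi lambda mu (@design_of R m n w) (@noise_of R m n w) S).
  exact: (measurable_min_cost mu (ltW L0) (ltW l0) psiL
    (@measurable_design_of R m n) (@measurable_noise_of R m n)).
by have := measurable_lee measurableT (mmin (far_coordinate B j)) (mmin setT); rewrite setTI.
Qed.

(** For [|v j 0| > B] the quadratic term beats the linear one by at least [lambda B^2 / 4], which
    exceeds [k]: on the far set the cost stays above that of [w0] by a fixed positive gap. *)
Lemma min_cost_far (A : 'M[R]_(m, n)) xi (B D k : R) j w0 : 0 < B ->
  (forall v : 'cV[R]_n, total_cost psi lambda mu A xi w0 + v j 0 * D + lambda / 2 * v j 0 ^+ 2 <=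
     total_cost psi lambda mu A xi v + k) ->
  k < lambda * B ^+ 2 / 4 -> `|D| <= lambda * B / 4 ->
  ~ (min_cost psi lambda mu A xi (far_coordinate B j) <= min_cost psi lambda mu A xi setT)%E.
Proof.
move=> B0 H kB DB; apply/negP; rewrite -ltNge.
have mi0 : 0 < m%:R^-1 :> R by rewrite invr_gt0 ltr0n.
apply: (@le_lt_trans _ _ (robust_cost psi lambda mu w0 A xi)%:E).
  by apply: ereal_inf_lbound; exists w0.
pose g := lambda * B ^+ 2 / 4 - k.
have g0 : 0 < g by rewrite subr_gt0.
apply: (@lt_le_trans _ _ (m%:R^-1 * (total_cost psi lambda mu A xi w0 + g))%:E).
  by rewrite lte_fin robust_costE ltr_pM2l// ltrDl.
apply: le_ereal_inf_tmp => _ [v Bv <-]; rewrite lee_fin robust_costE ler_pM2l//.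
have := H v; have : lambda * B ^+ 2 / 4 <= v j 0 * D + lambda / 2 * v j 0 ^+ 2.
  have h4 : - (`|v j 0| * `|D|) <= v j 0 * D by rewrite lerNl -normrM -normrN ler_norm.
  move: Bv h4; rewrite /far_coordinate /= -(@real_normK _ (v j 0)) ?num_real//.
  have := normr_ge0 (v j 0); move: (`|v j 0|) => a a0 Ba h4.
  have h3 : a * `|D| <= a * (lambda * B / 4) by rewrite ler_wpM2l.
  have h2 : B ^+ 2 <= a * B by rewrite expr2 ler_wpM2r// ltW.
  have h1 : a * B <= a ^+ 2 by rewrite expr2 ler_wpM2l// ltW.
  have := ler_wpM2l (ltW l0) h1; have := ler_wpM2l (ltW l0) h2.
  by lra.
rewrite /g; lra.
Qed.

Context d (T : measurableType d) (P : probability T R).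
Variables (X : entry m n -> T -> R) (M6 : R).
Hypothesis mX : forall j, measurable_fun setT (X j).
Hypothesis indX : mutually_independent P X.
Hypothesis momX : design_moments P M6 X.

(** Column [j] is resampled with everything else frozen, so the [s i] of [leave_one_out] are
    constants and [tail_sum] applies to the linear term. Off the tail event that term is at most
    [2 L y + lambda |mu j 0| = lambda B / 4], the threshold of [min_cost_far]; this fixes the
    exponent. *)
Lemma probability_unboxed (B : R) j : 0 < B ->
  (P [set t | unboxed B j (X^~ t)] <=
   (m%:R * (M6 / m%:R ^+ 3) + 2 * expR (2 - lambda * (B / 4 - `|mu j 0|) / (2 * L)))%:E)%E.
Proof.
move=> B0.
pose Phi w : \bar R := (\1_(unboxed B j) w)%:E.
have mU := measurable_unboxed B j.
have mPhi : measurable_fun setT Phi by apply/measurable_EFinP; exact: measurable_indic.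
have Phi0 w : (0 <= Phi w)%E by rewrite lee_fin.
have mUX : measurable [set t | unboxed B j (X^~ t)].
  by have := joint_measurable mX measurableT mU; rewrite setTI.
have -> : P [set t | unboxed B j (X^~ t)] = (\int[P]_t Phi (X^~ t))%E.
  set U := [set t | unboxed B j (X^~ t)] in mUX *.
  have <- : (\int[P]_t (\1_U t)%:E = P U)%E by rewrite integral_indic// setIT.
  by apply: eq_integral => t _; rewrite /Phi !indicE.
pose K (k : entry m n) := if k is inl ij then ij.2 == j else false.
rewrite (decouple mX indX K mPhi Phi0).
set bound := (X in (_ <= X)%E).
suff inner t : (\int[P]_u Phi (fun k => if K k then X k u else X k t) <= bound)%E.
  apply: (@le_trans _ _ (\int[P]_t bound)%E); last first.
    by rewrite integral_cst//= probability_setT mule1.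
  have mXX : measurable_fun setT (fun z : T * T => Phi (fun k => if K k then X k z.2 else X k z.1)).
    apply: (measurableT_comp mPhi); apply: measurable_coordinates => k.
    case: (K k); [exact: (measurableT_comp (mX k) measurable_snd)|
                  exact: (measurableT_comp (mX k) measurable_fst)].
  apply: ge0_le_integral => //.
  - by move=> u _; exact: integral_ge0.
  - exact: (measurable_fun_fubini_tonelli_F (fun z => Phi (fun k => if K k then X k z.2 else X k z.1))).
(* This smoothing scale makes the error [6 m L eta] of [leave_one_out] equal to [lambda B^2 / 8],
   below the allowance [lambda B^2 / 4]. *)
have h0 : 0 < lambda * B ^+ 2 / (48 * m%:R * L).
  by rewrite divr_gt0 ?mulr_gt0 ?exprn_gt0 ?ltr0n.
have [s sL Hs] := @leave_one_out R m n psi lambda L _ mu (noise_of (X^~ t)) (design_of (X^~ t)) j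
  (ltW L0) l0 h0 psi0 psiL (fun x => psi_mid x h0).
(* Division by [2 L] brings the coefficients to at most 1/2, as [tail_sum] requires. *)
pose c (k : entry m n) := if k is inl ij then s ij.1 / (2 * L) else 0.
pose sq : seq (entry m n) := [seq inl (i, j) | i <- enum 'I_m].
have usq : uniq sq by rewrite map_inj_uniq ?enum_uniq// => a b [].
have Ksq : all K sq by apply/allP => _ /mapP[i _ ->] /=.
have ssq : size sq = m by rewrite size_map size_enum_ord.
have L20 : 0 < 2 * L by rewrite mulr_gt0.
have c2 k : `|c k| <= 2^-1.
  case: k => [[i k]|i] /=; last by rewrite normr0.
  rewrite normrM normfV (gtr0_norm L20) ler_pdivrMr//.
  by apply: (le_trans (sL i)); rewrite mulrA mulVf ?mul1r.
have X1 k : K k -> (\int[P]_t (X k t)%:E = 0)%E.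
  by case: k => [ij|i] //= _; have [] := momX ij.
have X2 k : K k -> (\int[P]_t (X k t ^+ 2)%:E = (m%:R^-1)%:E)%E.
  by case: k => [ij|i] //= _; have [] := momX ij.
have X6 k : K k -> (\int[P]_t (X k t ^+ 6)%:E <= (M6 / m%:R ^+ 3)%:E)%E.
  by case: k => [ij|i] //= _; have [] := momX ij.
have := tail_sum mX indX X1 X2 (lambda * (B / 4 - `|mu j 0|) / (2 * L)) usq Ksq X6 c2.
rewrite ssq.
have -> : 2 * m%:R^-1 * m%:R = 2 :> R by rewrite -mulrA mulVf ?mulr1// pnatr_eq0 -lt0n.
apply: le_trans.
set y := lambda * _ / _.
have mS : measurable_fun setT (fun u => `|\sum_(k <- sq) c k * X k u|).
  apply: measurableT_comp => //; apply: measurable_sum => k; exact: measurable_funM.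
have mV : measurable [set u | y < `|\sum_(k <- sq) c k * X k u|].
  by have := mS measurableT _ (measurable_itv `]y, +oo[); rewrite setTI; congr measurable;
    apply/seteqP; split=> u; rewrite /= in_itv /= andbT.
set V := [set u | _] in mV *.
have -> : P V = (\int[P]_u (\1_V u)%:E)%E by rewrite integral_indic// setIT.
have mpatch : measurable_fun setT (fun u => Phi (fun k => if K k then X k u else X k t)).
  apply: (measurableT_comp mPhi); apply: measurable_coordinates => k.
  by case: (K k).
apply: ge0_le_integral => //.
  by apply/measurable_EFinP; exact: measurable_indic.
move=> u _; rewrite lee_fin !indicE ler_nat.
set w := (fun k => _) : coordinates R (entry m n).
case: (boolP (w \in unboxed B j)) => //; rewrite inE => wU.
suff : V u by move=> Vu; rewrite mem_set.
rewrite /V /= ltNge; apply/negP => yV.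
have Anoise : noise_of w = noise_of (X^~ t) by apply/matrixP => i k; rewrite !mxE.
have Acol i k : k != j -> design_of w i k = design_of (X^~ t) i k.
  by move=> kj; rewrite !mxE /w /= (negbTE kj).
have [w0 Hw0] := Hs _ Acol.
move: wU; rewrite /unboxed /= Anoise; apply: (min_cost_far (w0 := w0) _ Hw0) => //.
  have -> : 6 * m%:R * L * (lambda * B ^+ 2 / (48 * m%:R * L)) = lambda * B ^+ 2 / 8.
    by field; rewrite gt_eqF// pnatr_eq0 -lt0n.
  have : 0 < lambda * B ^+ 2 by rewrite mulr_gt0 ?exprn_gt0.
  lra.
have SE : \sum_i design_of w i j * s i = 2 * L * \sum_(k <- sq) c k * X k u.
  rewrite /sq big_map big_enum /= mulr_sumr; apply: eq_bigr => i _.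
  by rewrite mxE /w /= eqxx; field; rewrite gt_eqF.
rewrite SE (le_trans (ler_normD _ _))// normrM (gtr0_norm L20) normrM (gtr0_norm l0).
have := ler_wpM2l (ltW L20) yV.
have -> : 2 * L * y = lambda * (B / 4 - `|mu j 0|) by rewrite /y; field; rewrite gt_eqF.
lra.
Qed.

(** Markov's inequality for sixth moments, with a union bound. Entries bounded by 1 give the cost a
    deterministic modulus of continuity on the box. *)
Lemma probability_large_entry :
  (P [set t | exists ij, (1 < `|X (inl ij) t|)%R] <= ((m * n)%:R * (M6 / m%:R ^+ 3))%:E)%E.
Proof.
pose E ij := [set t | (1 < `|X (inl ij) t|)%R].
have mE ij : measurable (E ij).
  have mN : measurable_fun setT (fun t => `|X (inl ij) t|) by exact: measurableT_comp.
  by have := mN measurableT _ (measurable_itv `]1%R, +oo[); rewrite setTI; congr measurable;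
    apply/seteqP; split=> t; rewrite /E /= in_itv /= andbT.
have PE ij : (P (E ij) <= (M6 / m%:R ^+ 3)%:E)%E.
  have [_ _] := momX ij; apply: le_trans.
  have <- : (\int[P]_t (\1_(E ij) t)%:E = P (E ij))%E by rewrite integral_indic// setIT.
  apply: ge0_le_integral => //.
  - by apply/measurable_EFinP; exact: measurable_indic.
  - by apply/measurable_EFinP; exact: measurable_funX.
  - move=> t _; rewrite lee_fin indicE; case: (boolP (t \in E ij)) => [|_]; last first.
      by rewrite exprn_even_ge0.
    rewrite inE /E /= => x1.
    by rewrite (exprM _ 2 3) -(@real_normK _ (X _ t)) ?num_real// -exprM exprn_ege1// ltW.
have -> : [set t | exists ij, (1 < `|X (inl ij) t|)%R] = \bigcup_ij E ij.
  by apply/seteqP; split=> t; [case=> ij H; exists ij|case=> ij _ H; exists ij].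
apply: (le_trans (union_bound P mE)).
apply: (@le_trans _ _ (\sum_(ij : 'I_m * 'I_n) (M6 / m%:R ^+ 3)%:E)%E).
  by apply: lee_sum => ij _; exact: PE.
by rewrite sumEFin lee_fin sumr_const -[leLHS]mulr_natl card_prod !card_ord.
Qed.

End box.

(** * Functions with geometrically bounded derivatives *)

Section tame_functions.
Context {R : realType}.
Implicit Types (u : R -> R) (th : R).

(** Derivatives are measured relative to the function itself, a condition stable under sums with the
    same [th]: a partition function inherits it from its terms, however many there are. *)
Definition tame th u := exists u1 u2 u3 : R -> R,
  [/\ forall x : R, is_derive x 1 u (u1 x), forall x : R, is_derive x 1 u1 (u2 x),
      forall x : R, is_derive x 1 u2 (u3 x) &
      forall x, [/\ 0 < u x, `|u1 x| <= th * u x, `|u2 x| <= th ^+ 2 * u x &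
                    `|u3 x| <= th ^+ 3 * u x]].

Lemma tameD th u v : tame th u -> tame th v -> tame th (fun x => u x + v x).
Proof.
move=> [u1 [u2 [u3 [du du1 du2 bu]]]] [v1 [v2 [v3 [dv dv1 dv2 bv]]]].
exists (fun x => u1 x + v1 x), (fun x => u2 x + v2 x), (fun x => u3 x + v3 x); split.
- by move=> x; exact: isdD.
- by move=> x; exact: isdD.
- by move=> x; exact: isdD.
move=> x; have [b0 b1 b2 b3] := bu x; have [c0 c1 c2 c3] := bv x.
by split; rewrite ?addr_gt0// mulrDr (le_trans (ler_normD _ _))// lerD.
Qed.

Lemma tame_sum th (I : eqType) (s : seq I) (F : I -> R -> R) : s != [::] ->
  (forall i, i \in s -> tame th (F i)) -> tame th (fun x => \sum_(i <- s) F i x).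
Proof.
elim: s => [//|i s IH _ HF].
have -> : (fun x => \sum_(j <- i :: s) F j x) = fun x => F i x + \sum_(j <- s) F j x.
  by apply/funext => x; rewrite big_cons.
have Fi := HF i (mem_head _ _).
case: (eqVneq s [::]) => [->|s0].
  have -> : (fun x => F i x + \sum_(j <- [::]) F j x) = F i.
    by apply/funext => x; rewrite big_nil addr0.
  exact: Fi.
by apply: tameD => //; apply: IH => // j js; apply: HF; rewrite inE js orbT.
Qed.

(** The powers of [b] and of [om] collect into powers of [b B]. The factor [4 (1 + L)] is large
    enough for its square and cube to dominate the coefficients [2 L + L^2] and [4 L + 6 L^2 + L^3]
    of the chain rule. *)
Lemma tame_exp (g g1 g2 g3 : R -> R) (L b B k a om : R) :
  (forall x : R, is_derive x 1 g (g1 x)) -> (forall x : R, is_derive x 1 g1 (g2 x)) ->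
  (forall x : R, is_derive x 1 g2 (g3 x)) ->
  0 <= L -> 0 < b -> 0 < k -> `|om| <= B ->
  (forall x, `|g1 x| <= L) -> (forall x, `|g2 x| <= 2 * L * b) ->
  (forall x, `|g3 x| <= 4 * L * b ^+ 2) ->
  tame (4 * (1 + L) * b * B) (fun x => k * expR (- b * g (a + x * om))).
Proof.
move=> dg dg1 dg2 L0 b0 k0 omB g1L g2L g3L.
have lin (x : R) : is_derive x 1 (fun x => a + x * om) om.
  apply: (is_derive_eq (isdD (isdC x a) (isdM (isdI x) (isdC x om)))).
  by rewrite mul1r mulr0 addr0 add0r.
have shift (f df : R -> R) : (forall x : R, is_derive x 1 f (df x)) ->
    forall x : R, is_derive x 1 (fun x => f (a + x * om)) (df (a + x * om) * om).
  by move=> fdf x; exact: (@isd_comp _ f (fun x => a + x * om) x _ _ (fdf _) (lin x)).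
pose E x := k * expR (- b * g (a + x * om)).
pose c1 x := - (b * om) * g1 (a + x * om).
pose c2 x := - (b * om ^+ 2) * g2 (a + x * om).
pose c3 x := - (b * om ^+ 3) * g3 (a + x * om).
have dc1 (x : R) : is_derive x 1 c1 (c2 x).
  by apply: (is_derive_eq (isdZ (- (b * om)) (shift _ _ dg1 x))); rewrite /c2; ring.
have dc2 (x : R) : is_derive x 1 c2 (c3 x).
  by apply: (is_derive_eq (isdZ (- (b * om ^+ 2)) (shift _ _ dg2 x))); rewrite /c3; ring.
have dE (x : R) : is_derive x 1 E (c1 x * E x).
  have d1 := isdZ (- b) (shift _ _ dg x).
  have d2 := @isd_comp _ expR (fun x => - b * g (a + x * om)) x _ _ (is_derive_expR _) d1.
  by apply: (is_derive_eq (isdZ k d2)); rewrite /c1 /E; ring.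
have E0 x : 0 < E x by rewrite mulr_gt0 ?expR_gt0.
exists (fun x => c1 x * E x), (fun x => (c2 x + c1 x ^+ 2) * E x),
  (fun x => (c3 x + 3 * c1 x * c2 x + c1 x ^+ 3) * E x); split=> //.
- by move=> x; apply: (is_derive_eq (isdM (dc1 x) (dE x))); ring.
- move=> x; apply: (is_derive_eq (isdM (isdD (dc2 x) (isdX 2 (dc1 x))) (dE x))).
  by rewrite /=; ring.
move=> x; set th := 4 * _ * _ * _.
pose q := b * B.
have B0 : 0 <= B := le_trans (normr_ge0 _) omB.
have q0 : 0 <= q by rewrite mulr_ge0// ltW.
have omn n : `|om ^+ n| <= B ^+ n by rewrite normrX lerXn2r ?nnegrE.
have b1 : `|c1 x| <= L * q.
  rewrite /c1 normrM normrN normrM (gtr0_norm b0) mulrC /q.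
  by rewrite ler_pM ?mulr_ge0 ?(ltW b0)// ler_wpM2l ?(ltW b0).
have b2 : `|c2 x| <= 2 * L * q ^+ 2.
  have -> : 2 * L * q ^+ 2 = (b * B ^+ 2) * (2 * L * b) by rewrite /q; ring.
  rewrite /c2 normrM normrN normrM (gtr0_norm b0).
  by rewrite ler_pM ?mulr_ge0 ?(ltW b0)// ler_wpM2l ?(ltW b0).
have b3 : `|c3 x| <= 4 * L * q ^+ 3.
  have -> : 4 * L * q ^+ 3 = (b * B ^+ 3) * (4 * L * b ^+ 2) by rewrite /q; ring.
  rewrite /c3 normrM normrN normrM (gtr0_norm b0).
  by rewrite ler_pM ?mulr_ge0 ?(ltW b0)// ler_wpM2l ?(ltW b0).
have thE : th = 4 * (1 + L) * q by rewrite /th /q; ring.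
have Lq0 : 0 <= L * q by rewrite mulr_ge0.
have q2 : 0 <= q ^+ 2 by rewrite sqr_ge0.
have q3 : 0 <= q ^+ 3 by rewrite exprn_ge0.
have b12 : `|c1 x ^+ 2| <= (L * q) ^+ 2 by rewrite normrX lerXn2r ?nnegrE.
have b13 : `|c1 x ^+ 3| <= (L * q) ^+ 3 by rewrite normrX lerXn2r ?nnegrE.
have b112 : `|3 * c1 x * c2 x| <= 3 * (L * q) * (2 * L * q ^+ 2).
  by rewrite normrM ler_pM// normrM ger0_norm// ler_wpM2l.
have L2 : 0 <= L ^+ 2 by rewrite sqr_ge0.
have L3 : 0 <= L ^+ 3 by rewrite exprn_ge0.
split; first exact: E0.
- by rewrite /= normrM (gtr0_norm (E0 x)) ler_wpM2r ?(ltW (E0 x))// (le_trans b1)// thE; nra.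
- rewrite /= normrM (gtr0_norm (E0 x)) ler_wpM2r ?(ltW (E0 x))//.
  apply: (le_trans (ler_normD _ _)); apply: (le_trans (lerD b2 b12)).
  have -> : 2 * L * q ^+ 2 + (L * q) ^+ 2 = (2 * L + L ^+ 2) * q ^+ 2 by ring.
  have -> : th ^+ 2 = (16 + 32 * L + 16 * L ^+ 2) * q ^+ 2 by rewrite thE; ring.
  by rewrite ler_wpM2r//; lra.
- rewrite /= normrM (gtr0_norm (E0 x)) ler_wpM2r ?(ltW (E0 x))//.
  apply: (le_trans (ler_normD _ _)); apply: (le_trans (lerD (ler_normD _ _) (lexx _))).
  apply: (le_trans (lerD (lerD b3 b112) b13)).
  have -> : 4 * L * q ^+ 3 + 3 * (L * q) * (2 * L * q ^+ 2) + (L * q) ^+ 3 =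
    (4 * L + 6 * L ^+ 2 + L ^+ 3) * q ^+ 3 by ring.
  have -> : th ^+ 3 = (64 + 192 * L + 192 * L ^+ 2 + 64 * L ^+ 3) * q ^+ 3 by rewrite thE; ring.
  by rewrite ler_wpM2r//; lra.
Qed.

(** Derivatives of [ln u] are polynomials in the ratios of the derivatives of [u] to [u], so no
    lower bound on [u] is involved. As [al <= 1], one factor [al] is kept from each product; with
    [al = (m b)^-1] it is what makes the replacement affordable. *)
Lemma tame_ln_bound th u (al c1 c2 c3 : R) (h h1 h2 h3 : R -> R) : 0 <= th -> 0 <= al <= 1 ->
  tame th u ->
  (forall x : R, is_derive x 1 h (h1 x)) -> (forall x : R, is_derive x 1 h1 (h2 x)) ->
  (forall x : R, is_derive x 1 h2 (h3 x)) ->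
  (forall x, `|h1 x| <= c1) -> (forall x, `|h2 x| <= c2) -> (forall x, `|h3 x| <= c3) ->
  exists f1 f2 f3 : R -> R, [/\
    forall x : R, is_derive x 1 (fun x => h (- al * ln (u x))) (f1 x),
    forall x : R, is_derive x 1 f1 (f2 x), forall x : R, is_derive x 1 f2 (f3 x) &
    forall x, `|f3 x| <= al * th ^+ 3 * (c3 + 6 * c2 + 6 * c1)].
Proof.
move=> th0 /andP[al0 al1] [u1 [u2 [u3 [du du1 du2 bu]]]] dh dh1 dh2 h1c h2c h3c.
have u0 x : u x != 0 by have [/gt_eqF/negbT] := bu x.
pose F x := - al * ln (u x).
pose r x := u1 x / u x; pose s x := u2 x / u x; pose t x := u3 x / u x.
have dratio (v dv : R -> R) (x : R) : is_derive x 1 v (dv x) ->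
    is_derive x 1 (fun x => v x / u x) (dv x / u x - v x / u x * r x).
  move=> dvx; apply: (is_derive_eq (isdM dvx (@isdV _ u x _ (u0 x) (du x)))).
  by rewrite /r; field.
have dr (x : R) : is_derive x 1 r (s x - r x * r x) by exact: (dratio u1 u2 x (du1 x)).
have ds (x : R) : is_derive x 1 s (t x - s x * r x) by exact: (dratio u2 u3 x (du2 x)).
pose F1 x := - al * r x.
pose F2 x := - al * (s x - r x ^+ 2).
pose F3 x := - al * (t x - 3 * s x * r x + 2 * r x ^+ 3).
have dF (x : R) : is_derive x 1 F (F1 x).
  have [ux0 _ _ _] := bu x.
  have dl := @isd_comp _ (@ln R) u x _ _ (is_derive1_ln ux0) (du x).
  by apply: (is_derive_eq (isdZ (- al) dl)); rewrite /F1 /r mulrA; ring.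
have dF1 (x : R) : is_derive x 1 F1 (F2 x).
  by apply: (is_derive_eq (isdZ (- al) (dr x))); rewrite /F2; ring.
have dF2 (x : R) : is_derive x 1 F2 (F3 x).
  apply: (is_derive_eq (isdZ (- al) (isdB (ds x) (isdX 2 (dr x))))).
  by rewrite /F3 /=; ring.
have hF (f df : R -> R) (x : R) : (forall y : R, is_derive y 1 f (df y)) ->
    is_derive x 1 (fun x => f (F x)) (df (F x) * F1 x).
  by move=> fdf; exact: (@isd_comp _ f F x _ _ (fdf _) (dF x)).
exists (fun x => h1 (F x) * F1 x), (fun x => h2 (F x) * F1 x ^+ 2 + h1 (F x) * F2 x),
  (fun x => h3 (F x) * F1 x ^+ 3 + 3 * h2 (F x) * F1 x * F2 x + h1 (F x) * F3 x); split.
- by move=> x; exact: hF.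
- by move=> x; apply: (is_derive_eq (isdM (hF _ _ x dh1) (dF1 x))); ring.
- move=> x; apply: (is_derive_eq (isdD (isdM (hF _ _ x dh2) (isdX 2 (dF1 x)))
    (isdM (hF _ _ x dh1) (dF2 x)))).
  by rewrite /=; ring.
move=> x; have [ux0 b1 b2 b3] := bu x.
have quot v k : `|v| <= k * u x -> `|v / u x| <= k.
  by move=> vk; rewrite normrM normfV (gtr0_norm ux0) ler_pdivrMr.
have {}b1 : `|r x| <= th := quot _ _ b1.
have {}b2 : `|s x| <= th ^+ 2 := quot _ _ b2.
have {}b3 : `|t x| <= th ^+ 3 := quot _ _ b3.
have t2 : 0 <= th ^+ 2 by rewrite sqr_ge0.
have t3 : 0 <= th ^+ 3 by rewrite exprn_ge0.
have r2 : `|r x ^+ 2| <= th ^+ 2 by rewrite normrX lerXn2r ?nnegrE.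
have r3 : `|r x ^+ 3| <= th ^+ 3 by rewrite normrX lerXn2r ?nnegrE.
have B1 : `|F1 x| <= al * th by rewrite normrM normrN (ger0_norm al0) ler_wpM2l.
have B2 : `|F2 x| <= al * (2 * th ^+ 2).
  rewrite normrM normrN (ger0_norm al0) ler_wpM2l// (le_trans (ler_normB _ _))//; lra.
have B3 : `|F3 x| <= al * (6 * th ^+ 3).
  rewrite normrM normrN (ger0_norm al0) ler_wpM2l//.
  apply: (le_trans (ler_normD _ _)); apply: (le_trans (lerD (ler_normB _ _) (lexx _))).
  have sr : `|3 * s x * r x| <= 3 * th ^+ 2 * th.
    by rewrite normrM ler_pM// normrM ger0_norm// ler_wpM2l.
  have r3' : `|2 * r x ^+ 3| <= 2 * th ^+ 3 by rewrite normrM ger0_norm// ler_wpM2l.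
  have -> : 6 * th ^+ 3 = th ^+ 3 + 3 * th ^+ 2 * th + 2 * th ^+ 3 by ring.
  by rewrite lerD// lerD.
have cc1 : 0 <= c1 := le_trans (normr_ge0 _) (h1c 0).
have cc2 : 0 <= c2 := le_trans (normr_ge0 _) (h2c 0).
have cc3 : 0 <= c3 := le_trans (normr_ge0 _) (h3c 0).
have T1 : `|h3 (F x) * F1 x ^+ 3| <= c3 * (al * th) ^+ 3.
  by rewrite normrM ler_pM// normrX lerXn2r ?nnegrE// mulr_ge0.
have T2 : `|3 * h2 (F x) * F1 x * F2 x| <= 3 * c2 * (al * th) * (al * (2 * th ^+ 2)).
  by rewrite normrM ler_pM// normrM ler_pM// normrM ger0_norm// ler_wpM2l.
have T3 : `|h1 (F x) * F3 x| <= c1 * (al * (6 * th ^+ 3)) by rewrite normrM ler_pM.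
apply: (le_trans (ler_normD _ _)); apply: (le_trans (lerD (ler_normD _ _) (lexx _))).
apply: (le_trans (lerD (lerD T1 T2) T3)).
have -> : c3 * (al * th) ^+ 3 + 3 * c2 * (al * th) * (al * (2 * th ^+ 2)) + c1 * (al * (6 * th ^+ 3))
  = al * th ^+ 3 * (c3 * al ^+ 2 + 6 * c2 * al + 6 * c1) by ring.
rewrite ler_wpM2l ?mulr_ge0// lerD2r lerD//.
  by rewrite ler_piMr// exprn_ile1.
by rewrite ler_piMr// mulr_ge0.
Qed.

Lemma clamp_lipschitz (p q : R) :
  `|Num.max 0 (Num.min 1 p) - Num.max 0 (Num.min 1 q)| <= `|p - q|.
Proof.
have cE (x : R) : Num.max 0 (Num.min 1 x) = if x <= 0 then 0 else if 1 <= x then 1 else x.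
  case: (leP x 0) => x0; first by rewrite max_l// ge_min x0 orbT.
  by case: (leP 1 x) => x1; rewrite max_r// ltW.
wlog qp : p q / q <= p => [hw|].
  have [qp|/ltW pq] := leP q p; first exact: hw.
  by rewrite distrC [leRHS]distrC hw.
rewrite (@ger0_norm _ (p - q)) ?subr_ge0// !cE ler_norml.
by case: (leP p 0) => p0; case: (leP q 0) => q0; case: (leP 1 p) => p1; case: (leP 1 q) => q1;
  apply/andP; split; lra.
Qed.

(** A linear ramp descending over [[a + dl, a + 2 dl]], smoothed at scale [dl / 3]. The smoothed
    value at [x] is a value of the ramp on [[x, x + dl]], so the plateau at 1 reaches only to
    [a]. *)
Lemma smooth_step (a dl : R) : 0 < dl -> exists h h1 h2 h3 : R -> R,
  [/\ [/\ forall x : R, is_derive x 1 h (h1 x), forall x : R, is_derive x 1 h1 (h2 x) &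
          forall x : R, is_derive x 1 h2 (h3 x)],
      forall x, 0 <= h x <= 1,
      forall x, x <= a -> h x = 1, forall x, a + 2 * dl <= x -> h x = 0 &
      [/\ forall x, `|h1 x| <= dl^-1, forall x, `|h2 x| <= 6 * dl ^- 2 &
          forall x, `|h3 x| <= 36 * dl ^- 3]].
Proof.
move=> d0.
pose f x : R := Num.max 0 (Num.min 1 ((a + 2 * dl - x) / dl)).
have f01 x : 0 <= f x <= 1 by rewrite /f le_max lexx /= ge_max ler01 ge_min lexx.
have fL x y : `|f x - f y| <= dl^-1 * `|x - y|.
  have -> : dl^-1 * `|x - y| = `|(a + 2 * dl - x) / dl - (a + 2 * dl - y) / dl|.
    rewrite -mulrBl normrM normfV (gtr0_norm d0) mulrC distrC; congr (`|_| * _); ring.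
  rewrite /f; set p := (a + 2 * dl - x) / dl; set q := (a + 2 * dl - y) / dl.
  exact: clamp_lipschitz.
have e0 : 0 < dl / 3 by rewrite divr_gt0.
have [h [h1 [h2 [h3 [dh avg [b1 b2 b3] _]]]]] := lipschitz_smoothing e0 fL.
exists h, h1, h2, h3; split=> //.
- by move=> x; have [c _ ->] := avg x.
- move=> x xa; have [c /andP[xc cx] ->] := avg x.
  rewrite /f min_l ?max_r//.
  by rewrite ler_pdivlMr// mul1r; lra.
- move=> x xa; have [c /andP[xc cx] ->] := avg x.
  rewrite /f max_l// ge_min; apply/orP; right.
  by rewrite pmulr_lle0 ?invr_gt0//; lra.
- split=> // x.
    by apply: (le_trans (b2 x)); rewrite le_eqVlt; apply/orP; left; apply/eqP; field; rewrite gt_eqF.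
  by apply: (le_trans (b3 x)); rewrite le_eqVlt; apply/orP; left; apply/eqP; field; rewrite gt_eqF.
Qed.

End tame_functions.

(** * Universality of the soft minimum *)

Section swap_entry.
Context {R : realType} d (T : measurableType d) (P : probability T R).

Let rint (f : T -> R) := P.-integrable setT (EFin \o f).

Let rintD f g : rint f -> rint g -> rint (fun t => f t + g t).
Proof.
move=> fi gi; have := integrableD measurableT fi gi; congr integrable.
Qed.

Let rintZ c f : rint f -> rint (fun t => c * f t).
Proof. by move=> fi; have := integrableZl measurableT c fi; congr integrable. Qed.

Let rintC c : rint (fun=> c).
Proof. exact: finite_measure_integrable_cst. Qed.

Lemma rint_le (f g : T -> R) : measurable_fun setT f -> (forall t, `|f t| <= g t) -> rint g -> rint f.
Proof.
move=> mf fg gi; apply: (le_integrable measurableT _ _ gi); first exact/measurable_EFinP.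
by move=> t _ /=; rewrite lee_fin (le_trans (fg t))// ler_norm.
Qed.

Variables (v t6 M6 : R).
Hypothesis t60 : 0 < t6.

(** [t6] is the typical size of the cube of an entry: the application has [v = 1 / m] and
    [t6 ^+ 2 = m ^- 3]. *)
Definition moments6 (X : T -> R) := [/\ measurable_fun setT X, (\int[P]_t (X t)%:E = 0)%E,
  (\int[P]_t (X t ^+ 2)%:E = v%:E)%E & (\int[P]_t (X t ^+ 6)%:E <= (M6 * t6 ^+ 2)%:E)%E].

Let x6 (x : R) : 0 <= x ^+ 6. Proof. by rewrite exprn_even_ge0. Qed.

Lemma mean_quadratic X (c0 c1 c2 K : R) : moments6 X -> 0 <= K ->
  let q t := c0 + c1 * X t + c2 * X t ^+ 2 in let e t := K * (X t ^+ 6 / t6 + t6) in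
  [/\ rint q, rint e, \int[P]_t q t = c0 + c2 * v & \int[P]_t e t <= K * (M6 + 1) * t6].
Proof.
move=> [mX X1 X2 X6] K0 q e.
have i6 : rint (fun t => X t ^+ 6).
  apply/integrableP; split; first by apply/measurable_EFinP; exact: measurable_funX.
  under eq_integral do rewrite /= ger0_norm//.
  by apply: (le_lt_trans X6); rewrite ltry.
have i2 : rint (fun t => X t ^+ 2).
  apply/integrableP; split; first by apply/measurable_EFinP; exact: measurable_funX.
  under eq_integral do rewrite /= ger0_norm ?sqr_ge0//.
  by rewrite X2 ltry.
have i1 : rint X.
  apply: (rint_le mX _ (rintD i2 (rintC 1))) => t.
  rewrite -[X in _ <= X + _]real_normK ?num_real//.
  have := normr_ge0 (X t); move: (`|X t|) => y y0; have := sqr_ge0 (y - 1); nra.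
have iq : rint q by apply: rintD; [apply: rintD; [exact: rintC|exact: rintZ]|exact: rintZ].
have ie0 : rint (fun t => t6^-1 * X t ^+ 6 + t6) by apply: rintD; [exact: rintZ|exact: rintC].
have eE t : e t = K * (t6^-1 * X t ^+ 6 + t6) by rewrite /e [_ / t6]mulrC.
have ie : rint e.
  by have := rintZ K ie0; congr integrable; apply/funext => t; rewrite /= eE.
split=> //.
- rewrite /q RintegralD//; [|by apply: rintD; [exact: rintC|exact: rintZ]|exact: rintZ].
  rewrite RintegralD//; [|exact: rintC|exact: rintZ].
  rewrite !RintegralZl// /Rintegral X1 X2 /= mulr0 addr0 integral_cst//= probability_setT mule1.
  by [].
- have -> : \int[P]_t e t = \int[P]_t (K * (t6^-1 * X t ^+ 6 + t6)).
    by apply: eq_Rintegral => t _; exact: eE.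
  rewrite RintegralZl// -mulrA ler_wpM2l// RintegralD//; [|exact: rintZ|exact: rintC].
  rewrite RintegralZl// [X in _ + X]/Rintegral integral_cst//= probability_setT mule1 /=.
  rewrite mulrDl mul1r lerD2r mulrC ler_pdivrMr// -mulrA -expr2 -lee_fin /Rintegral fineK//.
  exact: integrable_fin_num.
Qed.

(** The two variables share their moments up to order 2, so the quadratic Taylor polynomials have
    equal means and only two cubic remainders are left. *)
Lemma swap_entry_le (X Y : T -> R) (f f1 f2 f3 : R -> R) (K : R) : moments6 X -> moments6 Y ->
  (forall x : R, is_derive x 1 f (f1 x)) -> (forall x : R, is_derive x 1 f1 (f2 x)) ->
  (forall x : R, is_derive x 1 f2 (f3 x)) -> (forall x, `|f3 x| <= K) ->
  (forall x, 0 <= f x <= 1) ->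
  (\int[P]_t (f (X t))%:E <= \int[P]_t (f (Y t))%:E + (2 * (K * (M6 + 1) * t6))%:E)%E.
Proof.
move=> mX mY df df1 df2 f3K f01.
have K0 : 0 <= K := le_trans (normr_ge0 _) (f3K 0).
have cube (x : R) : K * `|x| ^+ 3 <= K * (x ^+ 6 / t6 + t6).
  rewrite ler_wpM2l//.
  have -> : x ^+ 6 = (`|x| ^+ 3) ^+ 2 by rewrite -exprM -normrX ger0_norm.
  have := exprn_ge0 3 (normr_ge0 x); move: (`|x| ^+ 3) => y y0.
  rewrite -(ler_pM2r t60) mulrDl divfK ?gt_eqF//.
  by have := sqr_ge0 (y - t6); nra.
have tay (x : R) : `|f x - (f 0 + f1 0 * x + f2 0 / 2 * x ^+ 2)| <= K * (x ^+ 6 / t6 + t6).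
  apply: le_trans (cube x); have := taylor2_bound df df1 df2 f3K x.
  by congr (`|_| <= _); ring.
have [iqX ieX EqX EeX] := mean_quadratic (f 0) (f1 0) (f2 0 / 2) mX K0.
have [iqY ieY EqY EeY] := mean_quadratic (f 0) (f1 0) (f2 0 / 2) mY K0.
have mf : measurable_fun setT f by apply: continuous_measurable_fun; exact: isd_continuous df.
have ifZ (Z : T -> R) : measurable_fun setT Z -> rint (fun t => f (Z t)).
  move=> mZ; apply: (rint_le _ _ (rintC 1)); first exact: measurableT_comp.
  by move=> t; have /andP[f0 fl1] := f01 (Z t); rewrite ger0_norm.
have ifX := ifZ X (let: And4 a _ _ _ := mX in a).
have ifY := ifZ Y (let: And4 a _ _ _ := mY in a).
have fE (Z : T -> R) : rint (fun t => f (Z t)) ->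
    (\int[P]_t (f (Z t))%:E = (\int[P]_t f (Z t))%:E)%E.
  by move=> iz; rewrite /Rintegral fineK//; exact: integrable_fin_num.
rewrite (fE X ifX) (fE Y ifY) -EFinD lee_fin.
have up : \int[P]_t f (X t) <= f 0 + f2 0 / 2 * v + K * (M6 + 1) * t6.
  rewrite -EqX; apply: le_trans (lerD (lexx _) EeX); rewrite -RintegralD//.
  apply: le_Rintegral => //; first exact: rintD.
  by move=> t _; have := tay (X t); rewrite ler_norml => /andP[_]; lra.
have dn : f 0 + f2 0 / 2 * v <= \int[P]_t f (Y t) + K * (M6 + 1) * t6.
  rewrite -EqY; apply: le_trans (lerD (lexx _) EeY); rewrite -RintegralD//.
  apply: le_Rintegral => //; first exact: rintD.
  by move=> t _; have := tay (Y t); rewrite ler_norml => /andP[+ _]; lra.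
lra.
Qed.

End swap_entry.

Section soft_minimum.
Context {R : realType} {m n : nat}.
Variables (g : R -> R) (lambda b : R) (mu : 'cV[R]_n) (pts : seq 'cV[R]_n).

Definition partition_function (w : coordinates R (entry m n)) : R :=
  \sum_(p <- pts) expR (- b * total_cost g lambda mu (design_of w) (noise_of w) p).

(** The free energy of the total cost at inverse temperature [b]; the factor [1 / m] restores the
    normalization of the robust cost. *)
Definition soft_min (w : coordinates R (entry m n)) : R :=
  - (m%:R * b)^-1 * ln (partition_function w).

Lemma measurable_soft_min : measurable_fun setT g -> measurable_fun setT soft_min.
Proof.
move=> mg; apply: measurable_funM => //; apply: measurableT_comp; first exact: measurable_ln.
apply: measurable_sum => p; apply: measurableT_comp => //; apply: measurable_funM => //.
apply: measurable_funD => //; apply: measurable_sum => i; apply: measurableT_comp => //.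
apply: measurable_funB; last exact: measurable_noise_of.
have -> : (fun w => (design_of w *m p) i 0) =
    (fun w : coordinates R (entry m n) => \sum_j design_of w i j * p j 0).
  by apply/funext => w; rewrite mxE.
by apply: measurable_sum => j; apply: measurable_funM => //; exact: measurable_design_of.
Qed.

Hypotheses (m0 : (0 < m)%N) (b0 : 0 < b).

Lemma partition_function_gt0 w : pts != [::] -> 0 < partition_function w.
Proof.
rewrite /partition_function; case: pts => // p s _; rewrite big_cons ltr_pwDl ?expR_gt0//.
by apply: sumr_ge0 => q _; exact: expR_ge0.
Qed.

Let mb0 : 0 < m%:R * b. Proof. by rewrite mulr_gt0// ltr0n. Qed.

Lemma soft_min_le w p : p \in pts ->
  soft_min w <= m%:R^-1 * total_cost g lambda mu (design_of w) (noise_of w) p.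
Proof.
move=> pp; set c := total_cost _ _ _ _ _ p.
have le : expR (- b * c) <= partition_function w.
  rewrite /partition_function (big_rem p)//= lerDl.
  by apply: sumr_ge0 => q _; exact: expR_ge0.
have : - b * c <= ln (partition_function w).
  by rewrite -[leLHS]expRK ler_ln ?posrE ?expR_gt0// (lt_le_trans _ le) ?expR_gt0.
move=> H; rewrite /soft_min mulNr lerNl.
have -> : - (m%:R^-1 * c) = (m%:R * b)^-1 * (- b * c).
  by field; rewrite gt_eqF// gt_eqF// ltr0n.
by rewrite ler_pM2l// invr_gt0.
Qed.

(** Every term of the partition function is at most [exp (- m b a)], so the price is the entropy
    [ln N] of the net divided by [m b]. *)
Lemma soft_min_ge w (N a : R) : pts != [::] -> (size pts)%:R <= N ->
  (forall p, p \in pts ->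
    a <= m%:R^-1 * total_cost g lambda mu (design_of w) (noise_of w) p) ->
  a - (m%:R * b)^-1 * ln N <= soft_min w.
Proof.
move=> pts0 sN H; have Z0 := partition_function_gt0 w pts0.
have m0' : 0 < m%:R :> R by rewrite ltr0n.
have N0 : 0 < N.
  by apply: lt_le_trans sN; rewrite ltr0n lt0n size_eq0.
have ZN : partition_function w <= N * expR (- (m%:R * b) * a).
  apply: (@le_trans _ _ ((size pts)%:R * expR (- (m%:R * b) * a))).
    have -> : (size pts)%:R * expR (- (m%:R * b) * a) = \sum_(p <- pts) expR (- (m%:R * b) * a).
      by rewrite big_const_seq count_predT iter_addr_0 mulr_natl.
    rewrite /partition_function big_seq [leRHS]big_seq; apply: ler_sum => p pp.
    have := H p pp; rewrite mulrC ler_pdivlMr// => Hp.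
    by rewrite ler_expR !mulNr lerN2 mulrAC mulrC ler_wpM2l ?(ltW b0)// mulrC.
  by rewrite ler_wpM2r ?expR_ge0.
have : ln (partition_function w) <= ln N - (m%:R * b) * a.
  rewrite -mulNr -[X in _ + X]expRK -lnM ?posrE ?expR_gt0//.
  by rewrite ler_ln ?posrE// mulr_gt0 ?expR_gt0.
rewrite /soft_min => lnZ.
have := ler_wpM2l (ltW (_ : 0 < (m%:R * b)^-1)) lnZ; rewrite invr_gt0 => /(_ mb0).
rewrite mulrBr [X in _ - X]mulrA mulVf ?gt_eqF// mul1r; lra.
Qed.

End soft_minimum.

Section universality.
Context {R : realType} {m n : nat}.
Variables (g g1 g2 g3 : R -> R) (lambda L b B : R) (mu : 'cV[R]_n) (pts : seq 'cV[R]_n).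
Hypotheses (dg : forall x : R, is_derive x 1 g (g1 x)) (dg1 : forall x : R, is_derive x 1 g1 (g2 x))
  (dg2 : forall x : R, is_derive x 1 g2 (g3 x)).
Hypotheses (L0 : 0 <= L) (B0 : 0 <= B) (b1 : 1 <= b) (m0 : (0 < m)%N) (pts0 : pts != [::]).
Hypotheses (g1L : forall x, `|g1 x| <= L) (g2L : forall x, `|g2 x| <= 2 * L * b)
  (g3L : forall x, `|g3 x| <= 4 * L * b ^+ 2).
Hypothesis ptsB : forall p, p \in pts -> forall j, `|p j 0| <= B.

Let F := @soft_min R m n g lambda b mu pts.
Let b0 : 0 < b. Proof. exact: lt_le_trans b1. Qed.

(** Entry [(i, j)] enters the cost of [p] only through the [i]-th residual, affinely with
    coefficient [p j 0], at most [B] in size; the rest factors out of the exponential. *)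
Lemma tame_partition_function (w : coordinates R (entry m n)) (ij : 'I_m * 'I_n) :
  tame (4 * (1 + L) * b * B)
    (fun x => partition_function g lambda b mu pts (set_coordinate w (inl ij) x)).
Proof.
case: ij => i j.
apply: tame_sum => // p pp.
pose A := design_of w.
pose rest := \sum_(i' | i' != i) g ((A *m p) i' 0 - noise_of w i' 0) +
  lambda / 2 * \sum_k (p + mu) k 0 ^+ 2.
pose a := \sum_(k | k != j) A i k * p k 0 - noise_of w i 0.
have E x : expR (- b * total_cost g lambda mu (design_of (set_coordinate w (inl (i, j)) x))
      (noise_of (set_coordinate w (inl (i, j)) x)) p) =
    expR (- b * rest) * expR (- b * g (a + x * p j 0)).
  rewrite -expRD -mulrDr; congr (expR (_ * _)).
  pose A' := design_of (set_coordinate w (inl (i, j)) x) : 'M[R]_(m, n).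
  have A'E i' k : A' i' k = if (i' == i) && (k == j) then x else A i' k.
    by rewrite !mxE /set_coordinate (inj_eq (@inl_inj _ _)) xpair_eqE.
  have noiseE i' : noise_of (set_coordinate w (inl (i, j)) x) i' 0 = noise_of w i' 0.
    by rewrite !mxE.
  rewrite /total_cost (bigD1 i)//= /rest -[LHS]addrA [LHS]addrC; congr (_ + _ + _).
    apply: eq_bigr => i' ii'; rewrite noiseE; congr (g (_ - _)).
    by rewrite !mxE; apply: eq_bigr => k _; rewrite -/A' A'E (negbTE ii').
  rewrite noiseE /a; congr g; rewrite [RHS]addrAC; congr (_ - _).
  rewrite mxE (bigD1 j)//= -/A' A'E !eqxx /= addrC; congr (_ + _).
  by apply: eq_bigr => k kj; rewrite -/A' A'E (negbTE kj) andbF.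
have -> : (fun x => expR (- b * total_cost g lambda mu (design_of (set_coordinate w (inl (i, j)) x))
      (noise_of (set_coordinate w (inl (i, j)) x)) p)) =
    fun x => expR (- b * rest) * expR (- b * g (a + x * p j 0)) by apply/funext.
have := @tame_exp R g g1 g2 g3 L b B (expR (- b * rest)) a (p j 0) dg dg1 dg2 L0 b0 (expR_gt0 _) (ptsB pp j) g1L g2L g3L.
exact.
Qed.

Context d (T : measurableType d) (P : probability T R).
Variables (X Y : entry m n -> T -> R) (M6 t6 dl : R).
Hypotheses (mX : forall j, measurable_fun setT (X j)) (mY : forall j, measurable_fun setT (Y j)).
Hypotheses (indX : mutually_independent P X) (indY : mutually_independent P Y).
Hypotheses (momX : design_moments P M6 X) (momY : design_moments P M6 Y).
Hypothesis noiseXY : forall i, X (inr i) = Y (inr i).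
Hypotheses (M60 : 0 <= M6) (t60 : 0 < t6) (t6E : t6 ^+ 2 = m%:R ^- 3) (dl0 : 0 < dl).

(** The test function is a smooth step of the soft minimum, caught between the indicators of
    [F <= a] and [F <= a + 2 dl]. Its third derivative in each design entry is bounded uniformly in
    the other coordinates, and swapping a noise coordinate costs nothing. *)
Lemma universality (a : R) :
  (P [set t | (F (X^~ t) <= a)%R] <= P [set t | (F (Y^~ t) <= a + 2 * dl)%R] +
   ((m * n)%:R * (2 * ((m%:R * b)^-1 * (4 * (1 + L) * b * B) ^+ 3 *
      (36 * dl ^- 3 + 6 * (6 * dl ^- 2) + 6 * dl^-1) * (M6 + 1) * t6)))%:E)%E.
Proof.
have [h [h1 [h2 [h3 [[dh dh1 dh2] h01 hlo hhi [b1h b2h b3h]]]]]] := smooth_step a dl0.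
set Kc := _ * (36 * _ + _ + _).
have mb1 : 1 <= m%:R * b by rewrite -[leLHS]mulr1 ler_pM// ler1n.
have mg : measurable_fun setT g by apply: continuous_measurable_fun; exact: isd_continuous dg.
have mF : measurable_fun setT F := measurable_soft_min lambda b mu pts mg.
have mh : measurable_fun setT h by apply: continuous_measurable_fun; exact: isd_continuous dh.
pose Phi w : \bar R := (h (F w))%:E.
have mPhi : measurable_fun setT Phi by apply/measurable_EFinP; exact: measurableT_comp.
have Phi0 w : (0 <= Phi w)%E by rewrite lee_fin; have /andP[] := h01 (F w).
have th0 : 0 <= 4 * (1 + L) * b * B.
  by rewrite mulr_ge0// mulr_ge0 ?(ltW b0)// mulr_ge0// addr_ge0.
have al01 : 0 <= (m%:R * b)^-1 <= 1.
  by rewrite invr_ge0 (le_trans _ mb1)//= invf_le1// (lt_le_trans _ mb1).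
have Kc0 : 0 <= Kc.
  have di k : 0 <= dl ^- k by rewrite invr_ge0 exprn_ge0// ltW.
  apply: mulr_ge0; first by apply: mulr_ge0; [case/andP: al01|exact: exprn_ge0].
  have di1 : 0 <= dl^-1 by rewrite invr_ge0 ltW.
  have := di 3%N; have := di 2%N; move: (dl ^- 3) (dl ^- 2) di1 => u v ? ? ?; lra.
pose c := 2 * (Kc * (M6 + 1) * t6).
have c0 : 0 <= c.
  by apply: mulr_ge0 => //; apply: mulr_ge0; [apply: mulr_ge0; [|exact: addr_ge0]|exact: ltW].
pose C (k : entry m n) := if k is inl _ then c else 0.
have swap k w : (\int[P]_s Phi (set_coordinate w k (X k s)) <=
    \int[P]_s Phi (set_coordinate w k (Y k s)) + (C k)%:E)%E.
  case: k => [ij|i] /=; last by rewrite noiseXY adde0.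
  have [f1 [f2 [f3 [df df1 df2 f3K]]]] := tame_ln_bound th0 al01
    (tame_partition_function w ij) dh dh1 dh2 b1h b2h b3h.
  have mom (Z : entry m n -> T -> R) : (forall j, measurable_fun setT (Z j)) ->
      design_moments P M6 Z -> moments6 P m%:R^-1 t6 M6 (Z (inl ij)).
    move=> mZ momZ; have [z1 z2 z6] := momZ ij; split=> //.
    by rewrite t6E.
  exact: (swap_entry_le t60 (mom X mX momX) (mom Y mY momY) df df1 df2 f3K).
have CE : \sum_k C k = (m * n)%:R * c.
  rewrite big_sumType /= [X in _ + X]big1// addr0.
  by rewrite sumr_const -[LHS]mulr_natl card_prod !card_ord.
have C0 k : 0 <= C k by case: k.
have := lindeberg mX mY indX indY mPhi Phi0 C0 swap; rewrite CE => H.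
have setm (Z : entry m n -> T -> R) (u : R) : (forall j, measurable_fun setT (Z j)) ->
    measurable [set t | (F (Z^~ t) <= u)%R].
  move=> mZ; have mFZ : measurable_fun setT (fun t => F (Z^~ t)).
    exact: (measurableT_comp mF (joint_measurable mZ)).
  by have := mFZ measurableT _ (measurable_itv `]-oo, u]); rewrite setTI; congr measurable;
    apply/seteqP; split=> t; rewrite /= in_itv.
have mPZ (Z : entry m n -> T -> R) : (forall j, measurable_fun setT (Z j)) ->
    measurable_fun setT (fun t => Phi (Z^~ t)).
  by move=> mZ; exact: (measurableT_comp mPhi (joint_measurable mZ)).
have PE (V : set T) : measurable V -> P V = (\int[P]_t (\1_V t)%:E)%E.
  by move=> mV; rewrite integral_indic// setIT.
rewrite (PE _ (setm X a mX)) (PE _ (setm Y (a + 2 * dl) mY)).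
apply: (@le_trans _ _ (\int[P]_t Phi (X^~ t))%E).
  apply: ge0_le_integral => //.
  - by apply/measurable_EFinP/measurable_indic; exact: setm.
  - exact: mPZ.
  - move=> t _; rewrite lee_fin indicE; case: (boolP (t \in _)) => [|_]; last by have /andP[] := h01 (F (X^~ t)).
    by rewrite inE /= => ta; rewrite hlo.
apply: (le_trans H); apply: leeD2r; apply: ge0_le_integral => //.
- exact: mPZ.
- by apply/measurable_EFinP/measurable_indic; exact: setm.
- move=> t _; rewrite lee_fin indicE; case: (boolP (t \in _)) => [_|]; first by have /andP[] := h01 (F (Y^~ t)).
  by move=> /negP; rewrite inE /= => /negP; rewrite -ltNge => /ltW ta; rewrite hhi.
Qed.

End universality.

(** * Soft minimum versus minimal cost *)

Section comparison.
Context {R : realType} {m n : nat}.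
Variables (psi g : R -> R) (lambda L b B r e1 N : R) (mu : 'cV[R]_n) (S : set 'cV[R]_n)
  (pts : seq 'cV[R]_n).
Hypotheses (m0 : (0 < m)%N) (L0 : 0 <= L) (l0 : 0 < lambda) (b0 : 0 < b) (r01 : 0 < r <= 1).
Hypothesis psiL : forall x y, `|psi x - psi y| <= L * `|x - y|.
Hypothesis gpsi : forall x, `|g x - psi x| <= e1.
Hypothesis SB : forall w, S w -> forall j, `|w j 0| <= B.
Hypothesis muB : forall j, `|mu j 0| <= B.
Hypotheses (ptsS : forall p, p \in pts -> S p) (sizeN : (size pts)%:R <= N).
Hypothesis net : forall w, S w -> exists2 p, p \in pts & forall j, `|w j 0 - p j 0| <= r.

(** [total_cost_diff] divided by [m], for entries at most 1 and for [w] and [mu] in the box: the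
    double sum of entries is at most [m n], and [2 |w j 0 + mu j 0| + r <= 4 B + 1]. *)
Definition net_error : R := (L * n%:R + lambda / 2 * (n%:R / m%:R) * (4 * B + 1)) * r.

Let mR : 0 < m%:R :> R. Proof. by rewrite ltr0n. Qed.

Lemma total_cost_close (A : 'M[R]_(m, n)) (xi : 'cV[R]_m) (w : 'cV[R]_n) :
  `|m%:R^-1 * total_cost g lambda mu A xi w - robust_cost psi lambda mu w A xi| <= e1.
Proof.
rewrite robust_costE -mulrBr normrM gtr0_norm ?invr_gt0// mulrC ler_pdivrMr//.
rewrite /total_cost opprD addrACA subrr addr0 -sumrB (le_trans (ler_norm_sum _ _ _))//.
have -> : e1 * m%:R = \sum_(i < m) e1 by rewrite sumr_const card_ord mulr_natr.
exact: ler_sum.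
Qed.

Lemma soft_min_upper (w : coordinates R (entry m n)) (v : 'cV[R]_n) : (forall i j, `|design_of w i j| <= 1) -> S v ->
  soft_min g lambda b mu pts w <=
  robust_cost psi lambda mu v (design_of w) (noise_of w) + e1 + net_error.
Proof.
move=> A1 Sv; have [p pp vp] := net Sv.
apply: (le_trans (soft_min_le g lambda mu m0 b0 w pp)).
have := total_cost_close (design_of w) (noise_of w) p; rewrite ler_norml => /andP[_ H].
have H2 : robust_cost psi lambda mu p (design_of w) (noise_of w) <=
    robust_cost psi lambda mu v (design_of w) (noise_of w) + net_error.
  have /andP[r0 r1] := r01.
  have := total_cost_diff mu (design_of w) (noise_of w) L0 (ltW l0) psiL vp.
  rewrite distrC => D; have {}D := le_trans (ler_norm _) D.
  rewrite !robust_costE -lerBlDl -mulrBr mulrC ler_pdivrMr//.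
  apply: (le_trans D); rewrite /net_error.
  have -> : (L * n%:R + lambda / 2 * (n%:R / m%:R) * (4 * B + 1)) * r * m%:R =
    (L * (m%:R * n%:R) + lambda / 2 * (n%:R * (4 * B + 1))) * r by field; rewrite gt_eqF.
  apply: ler_wpM2r; first exact: ltW.
  apply: lerD; apply: ler_wpM2l => //; last first.
  - have -> : n%:R * (4 * B + 1) = \sum_(j < n) (4 * B + 1) by rewrite sumr_const card_ord mulr_natl.
    apply: ler_sum => j _; have := ler_normD (v j 0) (mu j 0).
    by have := SB Sv j; have := muB j; lra.
  - by rewrite divr_ge0// ltW.
  have -> : m%:R * n%:R = \sum_(i < m) \sum_(j < n) 1 :> R.
    by rewrite !sumr_const !card_ord mulr_natl.
  by apply: ler_sum => i _; apply: ler_sum => j _.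
lra.
Qed.

(** Net points are themselves competitors in [S], so entropy and smoothing are paid here but, unlike
    in [soft_min_upper], no net error. *)
Lemma soft_min_lower (w : coordinates R (entry m n)) (a : R) : pts != [::] -> soft_min g lambda b mu pts w <= a ->
  (min_cost psi lambda mu (design_of w) (noise_of w) S <= (a + e1 + (m%:R * b)^-1 * ln N)%:E)%E.
Proof.
move=> pts0 Fa; apply/lee_addgt0Pr => e e0; rewrite -EFinD leNgt; apply/negP => H.
have : a + e <= soft_min g lambda b mu pts w.
  have -> : a + e = (a + e + (m%:R * b)^-1 * ln N) - (m%:R * b)^-1 * ln N by ring.
  apply: soft_min_ge => // p pp.
  have := total_cost_close (design_of w) (noise_of w) p; rewrite ler_norml => /andP[D _].
  have : (min_cost psi lambda mu (design_of w) (noise_of w) S <=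
      (robust_cost psi lambda mu p (design_of w) (noise_of w))%:E)%E.
    by apply: ereal_inf_lbound; exists p => //; exact: ptsS.
  by move=> /(lt_le_trans H); rewrite lte_fin; lra.
lra.
Qed.

End comparison.
Arguments net_error {R} m n lambda L B r.

Section argmin.
Context {R : realType} {m n : nat}.
Variables (psi : R -> R) (lambda L : R) (mu : 'cV[R]_n).
Hypotheses (L0 : 0 <= L) (l0 : 0 < lambda) (m0 : (0 < m)%N).
Hypothesis psi0 : forall x, 0 <= psi x.
Hypothesis psiL : forall x y, `|psi x - psi y| <= L * `|x - y|.

Lemma robust_argminP (A : 'M[R]_(m, n)) (xi : 'cV[R]_m) :
  ((robust_cost psi lambda mu (robust_argmin psi lambda mu A xi) A xi)%:E =
   min_cost psi lambda mu A xi setT)%E.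
Proof.
have mi0 : 0 < m%:R^-1 :> R by rewrite invr_gt0 ltr0n.
have [w0 _ w0min] := @total_cost_minimizer R m n psi lambda mu A xi L pred0 L0 l0 psi0 psiL.
have : forall v, robust_cost psi lambda mu (robust_argmin psi lambda mu A xi) A xi <=
    robust_cost psi lambda mu v A xi.
  rewrite /robust_argmin; case: xgetP => [w _ //|/(_ w0) []] v.
  by rewrite !robust_costE ler_pM2l// w0min.
move=> H; apply/eqP; rewrite eq_le; apply/andP; split.
  by apply: le_ereal_inf_tmp => _ [v _ <-]; rewrite lee_fin.
by apply: ereal_inf_lbound; exists (robust_argmin psi lambda mu A xi).
Qed.

Lemma boxed_argmin (w : coordinates R (entry m n)) (B : R) :
  (forall j, ~ unboxed psi lambda mu B j w) ->
  forall j, `|robust_argmin psi lambda mu (design_of w) (noise_of w) j 0| <= B.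
Proof.
move=> H j; rewrite leNgt; apply/negP => Bj; apply: (H j).
rewrite /unboxed /= -robust_argminP; apply: ereal_inf_lbound.
by exists (robust_argmin psi lambda mu (design_of w) (noise_of w)).
Qed.

End argmin.

(** * Comparison of two designs *)

Section transfer.
Context {R : realType} {m n : nat} d (T : measurableType d) (P : probability T R).
Variables (psi : R -> R) (lambda L b B r M6 t6 dl : R) (K : nat) (mu : 'cV[R]_n).
Hypotheses (m0 : (0 < m)%N) (L0 : 0 < L) (l0 : 0 < lambda) (b1 : 1 <= b) (B0 : 0 < B)
  (r01 : 0 < r <= 1) (BrK : B / r <= K%:R).
Hypotheses (psi0 : forall x, 0 <= psi x) (psiL : forall x y, `|psi x - psi y| <= L * `|x - y|)
  (psi_mid : forall x h, 0 < h -> 0 <= psi (x + h + h) - 2 * psi (x + h) + psi x).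
Hypothesis muB : forall j, `|mu j 0| <= B.
Hypotheses (M60 : 0 <= M6) (t60 : 0 < t6) (t6E : t6 ^+ 2 = m%:R ^- 3) (dl0 : 0 < dl).

Definition net_size : R := ((2 * K + 1) ^ n)%:R.

Definition swap_error : R := (m * n)%:R * (2 * ((m%:R * b)^-1 * (4 * (1 + L) * b * B) ^+ 3 *
  (36 * dl ^- 3 + 6 * (6 * dl ^- 2) + 6 * dl^-1) * (M6 + 1) * t6)).

Definition large_entry_error : R := (m * n)%:R * (M6 / m%:R ^+ 3).

Definition unboxed_error (mumax : R) : R :=
  m%:R * (M6 / m%:R ^+ 3) + 2 * expR (2 - lambda * (B / 4 - mumax) / (2 * L)).

Hypothesis approx : 3 * L / b + net_error m n lambda L B r + (m%:R * b)^-1 * ln net_size <= dl.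

Definition cost_inf (S : set 'cV[R]_n) (X : entry m n -> T -> R) (t : T) : \bar R :=
  min_cost psi lambda mu (design_of (X^~ t)) (noise_of (X^~ t)) S.

Lemma measurable_cost_inf S X : (forall j, measurable_fun setT (X j)) ->
  measurable_fun setT (cost_inf S X).
Proof.
move=> mX; apply: (measurable_min_cost mu (ltW L0) (ltW l0) psiL).
- move=> i j; have -> : (fun t => design_of (X^~ t) i j) = X (inl (i, j)).
    by apply/funext => t; rewrite mxE.
  exact: mX.
- move=> i; have -> : (fun t => noise_of (X^~ t) i 0) = X (inr i).
    by apply/funext => t; rewrite mxE.
  exact: mX.
Qed.

Lemma measurable_cost_inf_lt S X (a : R) : (forall j, measurable_fun setT (X j)) ->
  measurable [set t | (cost_inf S X t < a%:E)%E].
Proof.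
move=> mX; have := measurable_cost_inf S mX.
move=> /(measurable_lte measurableT) /(_ (measurable_cst a%:E)).
by rewrite setTI.
Qed.

Lemma measurable_cost_inf_le S X (a : R) : (forall j, measurable_fun setT (X j)) ->
  measurable [set t | (cost_inf S X t <= a%:E)%E].
Proof.
move=> mX; have := measurable_cost_inf S mX.
move=> /(measurable_lee measurableT) /(_ (measurable_cst a%:E)).
by rewrite setTI.
Qed.

Variables (X Y : entry m n -> T -> R).
Hypotheses (mX : forall j, measurable_fun setT (X j)) (mY : forall j, measurable_fun setT (Y j)).
Hypotheses (indX : mutually_independent P X) (indY : mutually_independent P Y).
Hypotheses (momX : design_moments P M6 X) (momY : design_moments P M6 Y).
Hypothesis noiseXY : forall i, X (inr i) = Y (inr i).

(** Off large entries of [X], a minimal cost below [a] gives a soft minimum at most [a + dl];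
    [universality] moves to [Y] at level [a + 3 dl]; returning to the minimal cost spends the last
    [dl]. *)
Lemma transfer (S : set 'cV[R]_n) (a : R) : (forall w, S w -> forall j, `|w j 0| <= B) ->
  (P [set t | (cost_inf S X t < a%:E)%E] <=
   P [set t | (cost_inf S Y t <= (a + 4 * dl)%:E)%E] + (large_entry_error + swap_error)%:E)%E.
Proof.
move=> SB; have b0 : 0 < b by exact: lt_le_trans b1.
have [pts [ptsS sizep net]] := finite_net (proj1 (andP r01)) BrK SB.
have err0 : 0 <= large_entry_error + swap_error.
  have di k : 0 <= dl ^- k by rewrite invr_ge0 exprn_ge0// ltW.
  have di1 : 0 <= dl^-1 by rewrite invr_ge0 ltW.
  rewrite addr_ge0//; apply: mulr_ge0 => //; first by rewrite divr_ge0// exprn_ge0.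
  apply: mulr_ge0 => //; apply: mulr_ge0; last exact: ltW.
  apply: mulr_ge0; last exact: addr_ge0.
  apply: mulr_ge0; first apply: mulr_ge0.
  - by rewrite invr_ge0 mulr_ge0// ltW.
  - by apply: exprn_ge0; apply: mulr_ge0; [apply: mulr_ge0; [apply: mulr_ge0|]|];
      rewrite ?addr_ge0// ltW.
  - by have := di 3%N; have := di 2%N; move: (dl ^- 3) (dl ^- 2) di1 => u v ? ? ?; lra.
(* An empty net means an empty [S], whose minimal cost is [+oo]; the soft minimum is meaningful for
   nonempty nets only. *)
have [/eqP p0|p0] := boolP (pts == [::]).
  have -> : [set t | (cost_inf S X t < a%:E)%E] = set0.
    apply/seteqP; split=> t //=; rewrite /cost_inf.
    have -> : S = set0.
      by rewrite -subset0 => w Sw; have [p] := net w Sw; rewrite p0.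
    by rewrite /min_cost image_set0 ereal_inf0 ltNge leey.
  by rewrite measure0 adde_ge0.
have eta0 : 0 < b^-1 by rewrite invr_gt0.
have [g [g1 [g2 [g3 [[dg dg1 dg2] gc [g1L g2L g3L] _]]]]] := lipschitz_smoothing eta0 psiL.
have gpsi x : `|g x - psi x| <= 3 * L / b.
  have [c /andP[xc cx] ->] := gc x; apply: (le_trans (psiL _ _)).
  rewrite ger0_norm ?subr_ge0// [leRHS](_ : _ = L * (3 * b^-1)); last by ring.
  by rewrite ler_pM2l// lerBlDl.
have g2L' x : `|g2 x| <= 2 * L * b by have := g2L x; rewrite invrK.
have g3L' x : `|g3 x| <= 4 * L * b ^+ 2 by have := g3L x; rewrite exprVn invrK.
have sizeN : (size pts)%:R <= net_size by rewrite ler_nat.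
have ptsB p (pp : p \in pts) j : `|p j 0| <= B by apply: SB; exact: ptsS.
pose F := @soft_min R m n g lambda b mu pts.
have e10 : 0 <= 3 * L / b by rewrite divr_ge0 ?mulr_ge0 ?(ltW L0) ?(ltW b0).
have ne0 : 0 <= net_error m n lambda L B r.
  have r0 : 0 <= r by case/andP: r01 => /ltW.
  apply: mulr_ge0 => //; apply: addr_ge0; first by rewrite mulr_ge0// ltW.
  apply: mulr_ge0; first by rewrite mulr_ge0// ?divr_ge0// ltW.
  by rewrite addr_ge0// mulr_ge0// ltW.
have ln0 : 0 <= (m%:R * b)^-1 * ln net_size.
  apply: mulr_ge0; first by rewrite invr_ge0 mulr_ge0// ltW.
  by rewrite ln_ge0// /net_size ler1n expn_gt0 addn1.
have mg : measurable_fun setT g by apply: continuous_measurable_fun; exact: isd_continuous dg.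
have mF (Z : entry m n -> T -> R) u : (forall j, measurable_fun setT (Z j)) ->
    measurable [set t | (F (Z^~ t) <= u)%R].
  move=> mZ; have mFZ : measurable_fun setT (fun t => F (Z^~ t)).
    exact: (measurableT_comp (measurable_soft_min lambda b mu pts mg) (joint_measurable mZ)).
  by have := mFZ measurableT _ (measurable_itv `]-oo, u]); rewrite setTI; congr measurable;
    apply/seteqP; split=> t; rewrite /= in_itv.
pose Lg := \bigcup_ij [set t | (1 < `|X (inl ij) t|)%R].
have mLg : measurable Lg.
  apply: fin_bigcup_measurable => [|ij _]; first exact: finite_finset.
  have mN : measurable_fun setT (fun t => `|X (inl ij) t|) by exact: measurableT_comp.
  by have := mN measurableT _ (measurable_itv `]1%R, +oo[); rewrite setTI; congr measurable;
    apply/seteqP; split=> t; rewrite /= in_itv /= andbT.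
apply: (@le_trans _ _ (P (Lg `|` [set t | (F (X^~ t) <= a + dl)%R]))).
  apply: le_measure; rewrite ?inE//; first exact: measurable_cost_inf_lt.
    by apply: measurableU => //; exact: mF.
  move=> t /ereal_inf_lt[_ [v Sv <-]]; rewrite lte_fin => va.
  have [?|nL] := pselect (Lg t); [by left|right].
  have A1 i j : `|design_of (X^~ t) i j| <= 1.
    by rewrite leNgt; apply/negP; rewrite mxE => ?; apply: nL; exists (i, j).
  apply: (le_trans (soft_min_upper m0 (ltW L0) l0 b0 r01 psiL gpsi SB muB net A1 Sv)).
  rewrite -addrA lerD ?(ltW va)// (le_trans _ approx)// lerDl.
  by [].
apply: (le_trans (measureU2 _ _ _)) => //; first exact: mF.
rewrite (EFinD large_entry_error) [leRHS]addeCA; apply: leeD.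
  have := probability_large_entry mX momX; congr (P _ <= _)%E.
  by apply/seteqP; split=> t [ij]; [exists ij|move=> _; exists ij].
have U := @universality _ _ _ _ _ _ _ lambda _ _ _ mu _ dg dg1 dg2 (ltW L0) (ltW B0) b1 m0 p0 g1L g2L' g3L' ptsB
  _ _ P _ _ _ _ _ mX mY indX indY momX momY noiseXY M60 t60 t6E dl0 (a + dl).
apply: (le_trans U).
apply: leeD2r; apply: le_measure; rewrite ?inE//; first exact: mF.
  exact: measurable_cost_inf_le.
move=> t /= Ft; have := soft_min_lower m0 b0 gpsi ptsS sizeN p0 Ft.
move=> /le_trans; apply; rewrite lee_fin.
move: ne0 approx; move: (net_error _ _ _ _ _ _) (_ * ln _) (_ / b) => x y e; lra.
Qed.

Lemma boxed_cost_inf (Z : entry m n -> T -> R) t : (forall j, ~ unboxed psi lambda mu B j (Z^~ t)) ->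
  forall S : set 'cV[R]_n, S (robust_argmin psi lambda mu (design_of (Z^~ t)) (noise_of (Z^~ t))) ->
  (cost_inf (S `&` [set w | forall j, (`|w j 0| <= B)%R]) Z t <= cost_inf setT Z t)%E.
Proof.
move=> box S St; rewrite /cost_inf -(robust_argminP mu (ltW L0) l0 m0 psi0 psiL).
apply: ereal_inf_lbound; eexists; last reflexivity.
by split=> //; exact: (boxed_argmin (ltW L0) l0 m0 psi0 psiL box).
Qed.

Lemma probability_unboxed_any (Z : entry m n -> T -> R) (mumax : R) :
  (forall j, measurable_fun setT (Z j)) -> mutually_independent P Z -> design_moments P M6 Z ->
  (forall j, `|mu j 0| <= mumax) ->
  measurable (\bigcup_j [set t | unboxed psi lambda mu B j (Z^~ t)]) /\
  (P (\bigcup_j [set t | unboxed psi lambda mu B j (Z^~ t)]) <= (n%:R * unboxed_error mumax)%:E)%E.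
Proof.
move=> mZ indZ momZ muM.
have mU j : measurable [set t | unboxed psi lambda mu B j (Z^~ t)].
  by have := joint_measurable mZ measurableT (measurable_unboxed mu L0 l0 psiL B j); rewrite setTI.
split; first by apply: fin_bigcup_measurable => [|j _]; [exact: finite_finset|exact: mU].
apply: (le_trans (union_bound P mU)).
have -> : (n%:R * unboxed_error mumax)%:E = (\sum_(j < n) (unboxed_error mumax)%:E)%E.
  by rewrite sumEFin sumr_const card_ord mulr_natl.
apply: lee_sum => j _.
apply: (le_trans (probability_unboxed mu L0 l0 m0 psi0 psiL psi_mid mZ indZ momZ j B0)).
rewrite lee_fin /unboxed_error lerD2l ler_wpM2l// ler_expR lerD2l lerN2 ler_pM2r ?invr_gt0 ?mulr_gt0//.
by rewrite ler_pM2l// lerD2l lerN2.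
Qed.

End transfer.
Arguments net_size {R} n K.
Arguments swap_error {R} m n L b B M6 t6 dl.
Arguments large_entry_error {R} m n M6.
Arguments unboxed_error {R} m lambda L B M6 mumax.
Arguments cost_inf {R m n d T} psi lambda mu S X t.

Section comparison_of_designs.
Context {R : realType} {m n : nat} d (T : measurableType d) (P : probability T R).
Variables (psi : R -> R) (lambda L b B r M6 t6 dl mumax : R) (K : nat) (mu : 'cV[R]_n).
Hypotheses (m0 : (0 < m)%N) (L0 : 0 < L) (l0 : 0 < lambda) (b1 : 1 <= b) (B0 : 0 < B)
  (r01 : 0 < r <= 1) (BrK : B / r <= K%:R).
Hypotheses (psi0 : forall x, 0 <= psi x) (psiL : forall x y, `|psi x - psi y| <= L * `|x - y|)
  (psi_mid : forall x h, 0 < h -> 0 <= psi (x + h + h) - 2 * psi (x + h) + psi x).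
Hypotheses (muM : forall j, `|mu j 0| <= mumax) (maxB : mumax <= B).
Hypotheses (M60 : 0 <= M6) (t60 : 0 < t6) (t6E : t6 ^+ 2 = m%:R ^- 3) (dl0 : 0 < dl).
Hypothesis approx :
  3 * L / b + net_error m n lambda L B r + (m%:R * b)^-1 * ln (net_size n K) <= dl.
Variables (X Y : entry m n -> T -> R).
Hypotheses (mX : forall j, measurable_fun setT (X j)) (mY : forall j, measurable_fun setT (Y j)).
Hypotheses (indX : mutually_independent P X) (indY : mutually_independent P Y).
Hypotheses (momX : design_moments P M6 X) (momY : design_moments P M6 Y).
Hypothesis noiseXY : forall i, X (inr i) = Y (inr i).

(** The full minimal cost is carried from [Y] to [X], to show that it is below [a], and the minimum
    over the boxed part of [S] from [X] to [Y], to show that it rarely is. Each passage costs one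
    [te], and [eps] is spent once in each. *)
Lemma argmin_probability (S : set 'cV[R]_n) (z rho eps : R) : rho = 16 * dl ->
  (P [set t | ((z + rho)%:E <= cost_inf psi lambda mu setT Y t)%E] <= eps%:E)%E ->
  (P [set t | (cost_inf psi lambda mu S Y t <= (z + 2 * rho)%:E)%E] <= eps%:E)%E ->
  (mu_ext P [set t | S (robust_argmin psi lambda mu (design_of (X^~ t)) (noise_of (X^~ t)))] <=
   (2 * eps + 2 * (n%:R * unboxed_error m lambda L B M6 mumax +
      (large_entry_error m n M6 + swap_error m n L b B M6 t6 dl)))%:E)%E.
Proof.
move=> rhoE PT PS.
have muB j : `|mu j 0| <= B := le_trans (muM j) maxB.
set ue := unboxed_error _ _ _ _ _ _; set te := large_entry_error _ _ _ + _.
pose box := [set w : 'cV[R]_n | forall j, `|w j 0| <= B].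
pose c (V : set 'cV[R]_n) Z := @cost_inf R m n d T psi lambda mu V Z.
pose N Z := \bigcup_j [set t : T | unboxed psi lambda mu B j ((Z : entry m n -> T -> R)^~ t)].
have [mNX PNX] := probability_unboxed_any m0 L0 l0 B0 psi0 psiL psi_mid mX indX momX muM.
have [mNY PNY] := probability_unboxed_any m0 L0 l0 B0 psi0 psiL psi_mid mY indY momY muM.
have trXY := @transfer _ _ _ _ _ P _ _ _ _ _ _ _ _ _ _ _ m0 L0 l0 b1 B0 r01 BrK psiL muB
  M60 t60 t6E dl0 approx X Y mX mY indX indY momX momY noiseXY.
have trYX := @transfer _ _ _ _ _ P _ _ _ _ _ _ _ _ _ _ _ m0 L0 l0 b1 B0 r01 BrK psiL muB
  M60 t60 t6E dl0 approx Y X mY mX indY indX momY momX (fun i => esym (noiseXY i)).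
have mlt V Z (a : R) : (forall j, measurable_fun setT (Z j)) -> measurable [set t | (c V Z t < a%:E)%E].
  exact: (@measurable_cost_inf_lt R m n d T psi lambda L mu L0 l0 psiL V Z a).
have mle V Z (a : R) : (forall j, measurable_fun setT (Z j)) -> measurable [set t | (c V Z t <= a%:E)%E].
  exact: (@measurable_cost_inf_le R m n d T psi lambda L mu L0 l0 psiL V Z a).
pose p V := fine (P V).
have pE V : measurable V -> P V = (p V)%:E by move=> mV; rewrite /p fineK// fin_num_measure.
have pU V W : measurable V -> measurable W -> p (V `|` W) <= p V + p W.
  move=> mV mW; rewrite -lee_fin EFinD -!pE//; last exact: measurableU.
  exact: measureU2.
have ple V W : measurable V -> measurable W -> V `<=` W -> p V <= p W.
  by move=> mV mW VW; rewrite -lee_fin -!pE//; apply: le_measure; rewrite ?inE.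
have pC V : measurable V -> p (~` V) = 1 - p V.
  move=> mV; apply: EFin_inj; rewrite -pE; last exact: measurableC.
  by rewrite probability_setC// pE.
(* Halfway between [z + rho] and [z + 2 rho], as [rho = 16 dl]; a transfer costs [4 dl], so there is
   room on both sides. *)
pose a := z + rho + 8 * dl.
pose A1 := [set t | (c setT Y t < (z + rho)%:E)%E].
pose A2 := [set t | (c setT X t < a%:E)%E].
pose A3 := [set t | (c (S `&` box) X t < a%:E)%E].
have H1 : 1 - eps <= p A1.
  have mA1 : measurable A1 by exact: mlt.
  have : p (~` A1) <= eps.
    rewrite -lee_fin -pE; last exact: measurableC.
    apply: le_trans PT; rewrite le_eqVlt; apply/orP; left; apply/eqP; congr (P _).
    by apply/seteqP; split=> t /=; rewrite /A1 /c /= leNgt => /negP.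
  by rewrite pC//; lra.
have H2 : p A1 <= n%:R * ue + (p A2 + te).
  apply: (@le_trans _ _ (p (N Y `|` [set t | (c box Y t < (z + rho)%:E)%E]))).
    apply: ple; [exact: mlt|by apply: measurableU => //; exact: mlt|].
    move=> t tA; have [?|nN] := pselect (N Y t); [by left|right].
    apply: le_lt_trans tA; have := @boxed_cost_inf _ _ _ _ _ _ _ _ _ _ m0 L0 l0 psi0 psiL Y t _ setT I.
    by move=> Q; rewrite -[box]setTI; apply: Q => j jt; apply: nN; exists j.
  apply: (le_trans (pU _ _ _ _)) => //; first exact: mlt.
  apply: lerD; first by rewrite -lee_fin -pE.
  have := trYX box (z + rho) (fun w h => h); rewrite (pE _ (mlt box Y _ mY)) (pE _ (mle box X _ mX)).
  rewrite -EFinD lee_fin => /le_trans; apply; rewrite lerD2r; apply: ple; [exact: mle|exact: mlt|].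
  move=> t /= cb; apply: (@le_lt_trans _ _ (c box X t)); first by apply: ereal_inf_le_tmp; exact: image_subset.
  by apply: (le_lt_trans cb); rewrite lte_fin /a ltrD2l ltr_pM2r// ltr_nat.
have H3 : p A3 <= eps + te.
  have := trXY (S `&` box) a (fun w h => h.2); rewrite (pE _ (mlt _ X _ mX)) (pE _ (mle _ Y _ mY)).
  rewrite -EFinD lee_fin => /le_trans; apply; rewrite lerD2r -lee_fin -pE; last exact: mle.
  apply: le_trans PS; apply: le_measure; rewrite ?inE; [exact: mle|exact: mle|].
  move=> t /= cb; apply: (@le_trans _ _ (c (S `&` box) Y t)); first by apply: ereal_inf_le_tmp; apply: image_subset => // w [].
  by apply: (le_trans cb); rewrite lee_fin /a rhoE; move: (dl0) => dl0'; nra.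
have H4 : p (N X) <= n%:R * ue by rewrite -lee_fin -pE.
(* A measurable cover of an event that may fail to be measurable. If the minimizer lies in [S] and
   in the box and its cost is below [a], then [A3] occurs. *)
pose E := N X `|` (~` A2 `|` A3).
have mA2 : measurable A2 by exact: mlt.
have mA3 : measurable A3 by exact: mlt.
have mC2 : measurable (~` A2) by exact: measurableC.
have mE : measurable E by apply: measurableU => //; exact: measurableU.
apply: (@le_trans _ _ (P E)).
  rewrite -(measurable_mu_extE P mE); apply: le_mu_ext => t St.
  have [?|nN] := pselect (N X t); [by left|right].
  have [tA|] := pselect (A2 t); [right|by left].
  apply: le_lt_trans tA.
  have Q := @boxed_cost_inf _ _ _ _ _ _ _ _ B _ m0 L0 l0 psi0 psiL X t _ S St.
  by apply: Q => j jt; apply: nN; exists j.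
rewrite pE// lee_fin (le_trans (pU _ _ _ _))//; first exact: measurableU.
have := pU _ _ mC2 mA3; rewrite pC//; lra.
Qed.

End comparison_of_designs.

(** * Independence and moments of the designs *)

Section joint_independence.
Context d (T : measurableType d) (R : realType) (P : probability T R).

Lemma sigma_family_bigcap (I : finType) (U : I -> T -> R) (B : I -> set R) :
  (forall i, measurable (B i)) -> sigma_family U (\bigcap_i (U i @^-1` B i)).
Proof.
move=> mB; rewrite /sigma_family; set G := [set E | _].
have := @fin_bigcap_measurable _ (g_sigma_algebraType G) I setT (fun i => U i @^-1` B i).
apply; first exact: finite_finset.
by move=> i _; apply: sub_sigma_algebra; exists i, (B i).
Qed.

Definition joined (I J : Type) (U : I -> T -> R) (V : J -> T -> R) (k : I + J) : T -> R :=
  match k with inl i => U i | inr j => V j end.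

Lemma mutually_independent_joined (I J : finType) (U : I -> T -> R) (V : J -> T -> R) :
  mutually_independent P U -> mutually_independent P V -> independent_families P U V ->
  mutually_independent P (joined U V).
Proof.
move=> iU iV iUV B mB; rewrite big_sumType /= -iU// -iV// -iUV; last 2 first.
  by apply: sigma_family_bigcap.
  by apply: sigma_family_bigcap.
congr (P _); apply/seteqP; split=> t /=.
  by move=> H; split=> k _; [exact: (H (inl k))|exact: (H (inr k))].
by move=> [HU HV] [k|k] _; [exact: HU|exact: HV].
Qed.

Lemma mutually_independent_comp (I : finType) (U : I -> T -> R) (f : I -> R -> R) :
  (forall i, measurable_fun setT (f i)) -> mutually_independent P U ->
  mutually_independent P (fun i => f i \o U i).
Proof.
move=> mf iU B mB.
have := iU (fun i => f i @^-1` B i); rewrite /= => H.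
rewrite -[RHS]H// => i; have := mf i measurableT _ (mB i); by rewrite setTI.
Qed.

End joint_independence.

Section entry_moments.
Context d (T : measurableType d) (R : realType) (P : probability T R).

Lemma integrable_of_integral_sqr (X : T -> R) (v : R) : measurable_fun setT X ->
  (\int[P]_t (X t ^+ 2)%:E = v%:E)%E ->
  P.-integrable setT (EFin \o X) /\ P.-integrable setT (EFin \o (fun t => X t ^+ 2)).
Proof.
move=> mX X2; exact: (@integrable_of_sqr R unit _ T P (fun=> X) v (fun=> mX) predT (fun _ _ => X2) tt).
Qed.

Variable m : nat.
Hypothesis m0 : (0 < m)%N.
Let s : R := (Num.sqrt m%:R)^-1.
Let s0 : 0 < s. Proof. by rewrite invr_gt0 sqrtr_gt0 ltr0n. Qed.
Let s2 : s ^+ 2 = m%:R^-1. Proof. by rewrite exprVn sqr_sqrtr. Qed.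
Let s6 : s ^+ 6 = m%:R ^- 3. Proof. by rewrite (exprM _ 2 3) s2 exprVn. Qed.

Definition centered_entry (M6 : R) (X : T -> R) : Prop :=
  [/\ (\int[P]_t (X t)%:E = 0)%E, (\int[P]_t (X t ^+ 2)%:E = (m%:R^-1)%:E)%E &
      (\int[P]_t (X t ^+ 6)%:E <= (M6 / m%:R ^+ 3)%:E)%E].

(** From [x^6 <= 1 + |x|^(6 + delta)] the sixth moment is at most [1 + M]; the Gaussian one is 15
    before scaling, and [16 + |M|] covers both designs. *)
Lemma normalized_entry_moments (X X0 : T -> R) (M delta : R) : measurable_fun setT X0 ->
  X = (fun t => s * X0 t) -> 0 < delta ->
  ('E_P[X0] = 0)%E -> ('V_P[X0] = 1)%E ->
  ('E_P[fun t => (`|X0 t| `^ (6 + delta))%R] <= M%:E)%E -> centered_entry (16 + `|M|) X.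
Proof.
move=> mX0 XE d0 E0 V1 EM.
have X2 : (\int[P]_t (X0 t ^+ 2)%:E = 1)%E.
  move: V1; rewrite /variance unlock E0 unlock /= => <-; apply: eq_integral => t _.
  by rewrite fctE /= /GRing.sub_fun /= subr0 expr2.
have E0' : (\int[P]_t (X0 t)%:E = 0)%E by rewrite -E0 unlock.
have [i1 i2] := integrable_of_integral_sqr mX0 X2.
rewrite /centered_entry XE; split.
- under eq_integral do rewrite EFinM.
  by rewrite integralZl// E0' mule0.
- under eq_integral do rewrite exprMn EFinM.
  by rewrite integralZl// X2 mule1 s2.
- under eq_integral do rewrite exprMn EFinM.
  have s60 : 0 <= s ^+ 6 by exact: exprn_ge0 (ltW s0).
  have x60 (x : R) : 0 <= x ^+ 6 by have := sqr_ge0 (x ^+ 3); rewrite -exprM.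
  have mX6 : measurable_fun setT (fun t => (X0 t ^+ 6)%:E).
    by apply/measurable_EFinP; exact: measurable_funX.
  rewrite ge0_integralZl_EFin//; last by move=> t _; rewrite lee_fin.
  rewrite -[(m%:R ^+ 3)^-1]s6 [(16 + _) * _]mulrC [(_ * (16 + _))%:E]EFinM; apply: lee_wpmul2l; first by rewrite lee_fin.
  have mp : measurable_fun setT (fun t => (`|X0 t| `^ (6 + delta))).
    by apply: (measurableT_comp (measurable_powR (6 + delta))); exact: measurableT_comp.
  apply: (@le_trans _ _ (\int[P]_t (1 + `|X0 t| `^ (6 + delta))%:E)%E).
    apply: ge0_le_integral => //.
    + by move=> t _; rewrite lee_fin.
    + by apply/measurable_EFinP; exact: measurable_funD.
    + move=> t _; rewrite lee_fin -[X0 t ^+ 6]ger0_norm// normrX.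
      have [x1|x1] := leP `|X0 t| 1.
        by rewrite -[leLHS]addr0 lerD ?powR_ge0// exprn_ile1.
      rewrite -[leLHS]add0r lerD// -powR_mulrn// ler_powR ?(ltW x1)//.
      by rewrite lerDl ltW.
  under eq_integral do rewrite EFinD.
  rewrite ge0_integralD//; last by apply/measurable_EFinP.
  rewrite integral_cst//= probability_setT mule1.
  rewrite unlock in EM; apply: (le_trans (leeD2l _ EM)).
  by rewrite lee_fin; have := ler_norm M; lra.
Qed.

Lemma gaussian_entry_moments (X : {RV P >-> R}) (M : R) :
  (forall B : set R, measurable B -> distribution P X B = normal_prob 0 s B) ->
  centered_entry (16 + `|M|) X.
Proof.
move=> XN.
have tr (f : R -> R) : measurable_fun setT f -> (forall x, 0 <= f x) ->
    (\int[P]_t (f (X t))%:E = \int[normal_prob 0 s]_x (f x)%:E)%E.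
  move=> mf f0; have mf' : measurable_fun setT (EFin \o f) by exact/measurable_EFinP.
  pose X' : T -> measurableTypeR R := X.
  have mX' : measurable_fun setT X'.
    have mX : measurable_fun setT X by [].
    exact: mX.
  have := ge0_integral_pushforward mX' P (D := setT) measurableT mf'.
  rewrite preimage_setT => /(_ (fun x _ => f0 x)) <-.
  by rewrite (eq_measure_integral (normal_prob 0 s))// => B mB _; exact: XN.
have [n2 n1 n6] := normal_moments s0.
have X2 : (\int[P]_t (X t ^+ 2)%:E = (m%:R^-1)%:E)%E.
  by rewrite (tr (fun x => x ^+ 2)) ?n2 ?s2// => x; exact: sqr_ge0.
have X1 : (\int[P]_t ((X t + 1) ^+ 2)%:E = (m%:R^-1 + 1)%:E)%E.
  rewrite (tr (fun x => (x + 1) ^+ 2)) ?n1 ?s2// => [|x]; last exact: sqr_ge0.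
  by apply: measurable_funX; exact: measurable_funD.
have X6 : (\int[P]_t (X t ^+ 6)%:E = (15 * m%:R ^- 3)%:E)%E.
  rewrite (tr (fun x => x ^+ 6)) ?n6 ?s6// => x.
  by have := sqr_ge0 (x ^+ 3); rewrite -exprM.
have mX : measurable_fun setT X by [].
have [i1 i2] := integrable_of_integral_sqr mX X2.
split=> //; last first.
  rewrite X6 lee_fin ler_wpM2r// ?invr_ge0 ?exprn_ge0//.
  by have := normr_ge0 M; lra.
(* Expanding the square leaves the mean as the only unknown. *)
have : (\int[P]_t ((X t + 1) ^+ 2)%:E =
   \int[P]_t (X t ^+ 2)%:E + (2%:E * \int[P]_t (X t)%:E + 1%:E))%E.
  have iA : P.-integrable setT (fun t => 2%:E * (X t)%:E)%E by exact: (integrableZl measurableT 2 i1).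
  have iB : P.-integrable setT (cst 1%:E) by exact: finite_measure_integrable_cst.
  have I1 : (1%:E = \int[P]_t (cst 1%:E t))%E by rewrite integral_cst//= probability_setT mul1e.
  rewrite -(integralZl measurableT i1) [X in (_ + (_ + X))%E]I1 -(integralD measurableT iA iB).
  rewrite -(integralD measurableT i2 (integrableD measurableT iA iB)).
  by apply: eq_integral => t _; rewrite /= -EFinM -!EFinD; congr EFin; ring.
have := integrable_fin_num measurableT i1; rewrite /=.
rewrite X1 X2; case: (\int[P]_x _)%E => // e _; rewrite -EFinM -!EFinD => -[] H.
congr EFin; lra.
Qed.

End entry_moments.

Lemma condM2_lipschitz (R : realType) (psi : R -> R) (L : R) : 0 < L -> condM2 psi L ->
  [/\ forall x, 0 <= psi x, forall x y, `|psi x - psi y| <= L * `|x - y| &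
      forall x h, 0 < h -> 0 <= psi (x + h + h) - 2 * psi (x + h) + psi x].
Proof.
move=> L0 [psi0 cvx [dpsi wd]]; rewrite ge_max => /andP[_ /ess_supP esL]; split=> //.
  exact: (lipschitz_of_weak_derivative (ltW L0) cvx wd esL).
move=> x h h0; have := convex_function_ineq cvx (_ : x < x + h) (_ : x + h < x + h + h).
rewrite !ltrDl => /(_ h0 h0).
have -> : x + h + h - x = 2 * h by ring.
have -> : x + h + h - (x + h) = h by ring.
have -> : x + h - x = h by ring.
rewrite -(pmulr_lge0 _ h0) => H; nra.
Qed.

(** * Rates *)

Section rates.
Context {R : realType}.
Variables (m n : nat) (lambda tau L M6 : R).
Hypotheses (m0 : (0 < m)%N) (n0 : (0 < n)%N) (L0 : 0 < L) (l0 : 0 < lambda) (M60 : 0 <= M6).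
Hypotheses (tau01 : 0 < tau < 1) (tau_mn : tau <= m%:R / n%:R).

(** The exponent 1/40 makes [y^20 = sqrt n]: with [b = y^2] and [B = y^5], the swap error is of
    order [y^19 / sqrt m], one power of [y] below the critical one. *)
Definition scale : R := n%:R `^ (40%:R^-1).
Local Notation y := scale.
Let u := y^-1.

Let mR : 0 < m%:R :> R. Proof. by rewrite ltr0n. Qed.
Let nR : 0 < n%:R :> R. Proof. by rewrite ltr0n. Qed.
Let t0 : 0 < tau. Proof. by case/andP: tau01. Qed.

Lemma scale_ge1 : 1 <= y.
Proof.
apply: (@le_trans _ _ (1 `^ (40%:R^-1 : R))); first by rewrite powR1.
by rewrite ge0_ler_powR ?nnegrE ?invr_ge0// ler1n.
Qed.

Lemma scale_gt0 : 0 < y. Proof. exact: lt_le_trans scale_ge1. Qed.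

Lemma scaleX : y ^+ 40 = n%:R.
Proof. by rewrite -powR_mulrn ?powR_ge0// -powRrM mulVf ?powRr1// pnatr_eq0. Qed.

Let u0 : 0 < u. Proof. by rewrite invr_gt0 scale_gt0. Qed.
Let u1 : u <= 1. Proof. by rewrite invf_le1 ?scale_gt0// scale_ge1. Qed.
Let yu : y * u = 1. Proof. by rewrite mulfV// gt_eqF// scale_gt0. Qed.

Let uX k : (0 < k)%N -> u ^+ k <= u.
Proof.
case: k => // k _; rewrite exprS -[leRHS]mulr1 ler_wpM2l ?(ltW u0)//.
by rewrite exprn_ile1// ltW.
Qed.

Let tn : tau * n%:R <= m%:R. Proof. by rewrite -ler_pdivlMr. Qed.

Let nm : n%:R / m%:R <= tau^-1.
Proof. by rewrite ler_pdivrMr// ler_pdivlMl. Qed.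

Let minv_le : m%:R^-1 <= tau^-1 * u.
Proof.
have : m%:R^-1 <= tau^-1 * n%:R^-1 by rewrite -invfM lef_pV2 ?posrE// mulr_gt0.
move=> /le_trans; apply; rewrite ler_wpM2l ?invr_ge0 ?(ltW t0)//.
by rewrite -scaleX -exprVn uX.
Qed.

(** Since [tau^2 <= tau], the bound [tau n <= m] gives [tau y^20 <= sqrt m]. *)
Let sqrtm_le : (Num.sqrt m%:R)^-1 * y ^+ 19 <= tau^-1 * u.
Proof.
have ne : tau * y ^+ 20 <= Num.sqrt m%:R.
  have ty : 0 <= tau * y ^+ 20 by rewrite mulr_ge0 ?exprn_ge0// ltW// scale_gt0.
  rewrite -[leLHS](ger0_norm ty) -sqrtr_sqr ler_sqrt// exprMn -exprM scaleX.
  apply: le_trans tn.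
  by rewrite ler_pM2r// expr2 ger_pMl// ltW//; case/andP: tau01.
have y0 := scale_gt0.
rewrite -(@ler_pM2r _ (tau * y ^+ 20)) ?mulr_gt0 ?exprn_gt0//.
have -> : tau^-1 * u * (tau * y ^+ 20) = y ^+ 19.
  by rewrite /u; field; rewrite !gt_eqF.
rewrite mulrAC -[leRHS]mul1r ler_pM2r ?exprn_gt0//.
by rewrite mulrC ler_pdivrMr ?mul1r// sqrtr_gt0.
Qed.

Lemma ln_scale_le : ln y <= y - 1.
Proof.
rewrite [in leLHS](_ : y = 1 + (y - 1)); last by rewrite addrC subrK.
by apply: le_ln1Dx; have := scale_gt0; lra.
Qed.

Definition approx_const : R := 3 * L + (L + 3 * lambda / tau) + 125 / tau.

Lemma approx_rate : 3 * L / y ^+ 2 + net_error m n lambda L (y ^+ 5) (n%:R ^- 2) +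
  (m%:R * y ^+ 2)^-1 * ln (net_size n (n ^ 3)) <= approx_const / y.
Proof.
have ti0 : 0 < tau^-1 by rewrite invr_gt0.
rewrite /approx_const (mulrDl _ (125 / tau)) (mulrDl (3 * L)); apply: lerD; first apply: lerD.
- by rewrite -exprVn ler_wpM2l ?uX// mulr_ge0// ltW.
- have uu : u ^+ 2 <= u by exact: uX.
  have nu : n%:R * n%:R ^- 2 <= u.
    rewrite expr2 invfM mulrA mulfV ?gt_eqF// mul1r -scaleX -exprVn; exact: uX.
  have Bu : (4 * y ^+ 5 + 1) * n%:R ^- 2 <= 5 * u.
    have y51 : 1 <= y ^+ 5 by rewrite exprn_ege1// scale_ge1.
    have y5n : y ^+ 5 * n%:R ^- 2 <= u.
      apply: (@le_trans _ _ (y ^+ 5 * n%:R^-1)).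
        rewrite ler_wpM2l ?(le_trans ler01)// expr2 invfM ger_pMl ?invr_gt0//.
        by rewrite invf_le1// ler1n.
      rewrite -scaleX -exprVn (exprD _ 5 35) mulrA -exprMn yu expr1n mul1r; exact: uX.
    have n2 : 0 <= n%:R ^- 2 :> R by rewrite invr_ge0 exprn_ge0.
    move: (y ^+ 5) (n%:R ^- 2) n2 y51 y5n => Y v v0 Y1 Yv.
    have := mulr_ge0 (_ : 0 <= Y - 1) v0; rewrite subr_ge0 => /(_ Y1); lra.
  rewrite /net_error (mulrDl (L * _)) (mulrDl L); apply: lerD.
    by rewrite -!mulrA ler_pM2l.
  have -> : lambda / 2 * (n%:R / m%:R) * (4 * y ^+ 5 + 1) / n%:R ^+ 2 =
    lambda / 2 * ((n%:R / m%:R) * ((4 * y ^+ 5 + 1) * n%:R ^- 2)) by rewrite !mulrA.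
  apply: (@le_trans _ _ (lambda / 2 * (tau^-1 * (5 * u)))).
    rewrite ler_pM2l ?divr_gt0//; apply: ler_pM => //; apply: divr_ge0; last exact: exprn_ge0.
    by rewrite addr_ge0// mulr_ge0// exprn_ge0// ltW// scale_gt0.
  rewrite -/u; have : 0 <= lambda * (tau^-1 * u) by rewrite !mulr_ge0// ltW.
  lra.
(* The net has at most [(2 n^3 + 1)^n] points. From [3 ln n = 120 ln y <= 120 (y - 1)] and
   [ln 3 <= 2], the logarithm per coordinate is at most [125 y]. *)
- have lnE : ln (net_size n (n ^ 3)) <= n%:R * (125 * y).
    rewrite /net_size natrX lnXn ?ltr0n ?addn1// -[ln _ *+ n]mulr_natl ler_pM2l//.
    have n3 : ((2 * n ^ 3).+1)%:R <= 3 * n%:R ^+ 3 :> R.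
      have : 1 <= n%:R ^+ 3 :> R by rewrite exprn_ege1// ler1n.
      by rewrite -natr1 natrM natrX; lra.
    apply: (@le_trans _ _ (ln (3 * n%:R ^+ 3))).
      by rewrite ler_ln ?posrE// mulr_gt0// exprn_gt0.
    rewrite lnM ?posrE ?exprn_gt0// lnXn// -[ln _ *+ 3]mulr_natl.
    have -> : ln n%:R = 40 * ln y by rewrite /scale ln_powR mulVKf.
    have l3 : ln (3 : R) <= 2 by rewrite (_ : 3 = 1 + 2); [apply: le_ln1Dx; lra|ring].
    by have := ln_scale_le; have := scale_ge1; lra.
  have y0 := scale_gt0.
  apply: (@le_trans _ _ ((m%:R * y ^+ 2)^-1 * (n%:R * (125 * y)))).
    by rewrite ler_wpM2l// invr_ge0 mulr_ge0// exprn_ge0// ltW.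
  have -> : (m%:R * y ^+ 2)^-1 * (n%:R * (125 * y)) = 125 * (n%:R / m%:R / y).
    by field; rewrite !gt_eqF.
  rewrite -(mulrA 125 tau^-1); apply: ler_wpM2l => //.
  by apply: ler_wpM2r => //; exact: ltW.
Qed.

Lemma large_entry_rate : large_entry_error m n M6 <= M6 / tau ^+ 2 / y.
Proof.
rewrite /large_entry_error.
have -> : (m * n)%:R * (M6 / m%:R ^+ 3) = M6 * (n%:R / m%:R * m%:R^-1).
  by rewrite natrM; field; rewrite gt_eqF.
have -> : M6 / tau ^+ 2 / y = M6 * (tau^-1 * (tau^-1 * u)).
  by rewrite /u; field; rewrite !gt_eqF// scale_gt0.
by apply: ler_wpM2l => //; apply: ler_pM => //; rewrite invr_ge0.
Qed.

Definition unboxed_const : R := 2 * (expR 2 * (9`!%:R / (lambda / (16 * L)) ^+ 9)).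

(** As [mumax] is at most half of [B / 4], the exponent is at least [lambda y^5 / (16 L)] up to the
    constant 2. The ninth-order bound on the exponential gives [y^-45], of which the factor
    [n = y^40] leaves [y^-5]. *)
Lemma unboxed_rate mumax : mumax <= y ^+ 5 / 8 ->
  n%:R * unboxed_error m lambda L (y ^+ 5) M6 mumax <= (M6 / tau ^+ 2 + unboxed_const) / y.
Proof.
move=> muy; rewrite /unboxed_error mulrDr (mulrDl (M6 / _)); apply: lerD.
  apply: le_trans large_entry_rate; rewrite /large_entry_error natrM.
  by rewrite mulrA [n%:R * m%:R]mulrC.
set e := expR (2 - _); have -> : n%:R * (2 * e) = 2 * (e * n%:R) by ring.
rewrite /unboxed_const -(mulrA 2) ler_pM2l// /e.
set k := lambda / (16 * L); have k0 : 0 < k by rewrite divr_gt0// mulr_gt0.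
have y5 : 0 < y ^+ 5 by rewrite exprn_gt0// scale_gt0.
apply: (@le_trans _ _ (expR 2 * expR (- (k * y ^+ 5)) * n%:R)).
  rewrite ler_pM2r// -expRD ler_expR lerD2l lerN2 /k.
  have -> : lambda / (16 * L) * y ^+ 5 = lambda * (y ^+ 5 / 8) / (2 * L).
    by field; rewrite gt_eqF.
  apply: ler_wpM2r; first by rewrite invr_ge0 mulr_ge0// ltW.
  apply: ler_wpM2l; first exact: ltW.
  by move: (y ^+ 5) muy => Y muy; lra.
rewrite -[leLHS]mulrA -[leRHS]mulrA ler_pM2l ?expR_gt0//.
apply: (le_trans (ler_wpM2r (ltW nR) (expRN_le 9 (mulr_gt0 k0 y5)))).
rewrite exprMn invfM mulrA -[leLHS]mulrA ler_wpM2l ?divr_ge0 ?ler0n ?exprn_ge0 ?(ltW k0)//.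
have y0 := scale_gt0.
have -> : (y ^+ 5 ^+ 9)^-1 * n%:R = u ^+ 5.
  rewrite -exprM -exprVn -scaleX (exprD _ 5 40) -mulrA -exprMn mulVf ?gt_eqF//.
  by rewrite expr1n mulr1.
exact: uX.
Qed.

(** 128 is twice [4^3], 78 is 36 + 36 + 6, and [16^3] comes from [dl = rho / 16]. One power of [tau]
    comes from [n / m], the other from comparing [sqrt m] with [y^20]. *)
Definition swap_const : R := 128 * (1 + L) ^+ 3 * (78 * 16 ^+ 3) * (M6 + 1) / tau ^+ 2.

Lemma swap_rate rho : 0 < rho ->
  swap_error m n L (y ^+ 2) (y ^+ 5) M6 (m%:R^-1 * (Num.sqrt m%:R)^-1) (rho / 16) <=
  swap_const * (1 + rho ^- 3) / y.
Proof.
move=> rho0; rewrite /swap_error.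
set D := 36 * _ + _ + _.
have DD : D <= 78 * 16 ^+ 3 * (1 + rho ^- 3).
  have v0 : 0 < rho^-1 by rewrite invr_gt0.
  have -> : D = 36 * (16 ^+ 3 * rho ^- 3) + 36 * (16 / rho) ^+ 2 + 6 * (16 / rho).
    by rewrite /D; field; rewrite gt_eqF.
  rewrite -exprVn; have c1 : 1 <= 16 ^+ 3 :> R by rewrite exprn_ege1// ler1n.
  set d := 16 / rho; have d0 : 0 < d by rewrite mulr_gt0.
  have -> : 16 ^+ 3 * rho^-1 ^+ 3 = d ^+ 3 by rewrite exprMn.
  have d3 : d ^+ 3 + 1 <= 16 ^+ 3 * (1 + rho^-1 ^+ 3).
    by rewrite mulrDr mulr1 addrC lerD// exprMn.
  have d2 : d ^+ 2 <= 1 + d ^+ 3.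
    have [d1|d1] := leP d 1.
      by apply: (@le_trans _ _ 1); [rewrite exprn_ile1// ltW|rewrite lerDl exprn_ge0// ltW].
    by rewrite -[leLHS]add0r lerD// ler_eXn2l.
  have d1 : d <= 1 + d ^+ 3.
    have [d1|d1] := leP d 1.
      by apply: (@le_trans _ _ 1) => //; rewrite lerDl exprn_ge0// ltW.
    by rewrite -[leLHS]add0r lerD// -[leLHS]expr1 ler_eXn2l.
  rewrite -mulrA; move: (16 ^+ 3 * _) d3 => c d3; lra.
have sm0 : 0 < Num.sqrt m%:R :> R by rewrite sqrtr_gt0.
have -> : (m * n)%:R * (2 * ((m%:R * y ^+ 2)^-1 * (4 * (1 + L) * y ^+ 2 * y ^+ 5) ^+ 3 * D *
    (M6 + 1) * (m%:R^-1 * (Num.sqrt m%:R)^-1))) =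
    128 * (1 + L) ^+ 3 * (M6 + 1) * (D * ((n%:R / m%:R) * ((Num.sqrt m%:R)^-1 * y ^+ 19))).
  by rewrite natrM; field; rewrite !gt_eqF// scale_gt0.
have -> : swap_const * (1 + rho ^- 3) / y = 128 * (1 + L) ^+ 3 * (M6 + 1) *
   (78 * 16 ^+ 3 * (1 + rho ^- 3) * (tau^-1 * (tau^-1 * u))).
  by rewrite /swap_const /u; field; rewrite !gt_eqF// scale_gt0.
have D0 : 0 <= D.
  have i0 : 0 < (rho / 16)^-1 by rewrite invr_gt0 divr_gt0.
  by rewrite /D -!exprVn; have := exprn_gt0 3 i0; have := exprn_gt0 2 i0; move: (_ ^+ 3) (_ ^+ 2) i0 => *; lra.
have y0 := scale_gt0.
apply: ler_wpM2l.
  by apply: mulr_ge0; [apply: mulr_ge0 => //; apply: exprn_ge0; rewrite addr_ge0// ltW|exact: addr_ge0].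
apply: ler_pM => //.
  by apply: mulr_ge0; [exact: divr_ge0|apply: mulr_ge0; rewrite ?invr_ge0 ?exprn_ge0// ltW].
apply: ler_pM => //.
by apply: mulr_ge0; rewrite ?invr_ge0 ?exprn_ge0// ltW.
Qed.

End rates.

(** * Joint families built from the stated conditions, and the conclusion *)

Lemma mx_norm_ge_entry (R : realType) (n : nat) (v : 'cV[R]_n) j : `|v j 0| <= `|v|.
Proof. by rewrite [leRHS]/Num.Def.normr /= mx_normrE; apply/bigmax_geP; right => /=; exists (j, 0). Qed.

Lemma mu_ext_le1 (R : realType) d (T : measurableType d) (P : probability T R) (E : set T) :
  (mu_ext P E <= 1)%E.
Proof.
rewrite -(@probability_setT _ _ _ P) -(measurable_mu_extE P measurableT).
exact: le_mu_ext.
Qed.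

Section joint_entries.
Context d (T : measurableType d) (R : realType) (P : probability T R) (m n : nat).
Hypothesis m0 : (0 < m)%N.
Variables (A : 'I_m -> 'I_n -> {RV P >-> R}) (xi : 'I_m -> {RV P >-> R}).

Definition entries : entry m n -> T -> R :=
  joined (fun ij : 'I_m * 'I_n => A ij.1 ij.2 : T -> R) (fun i => xi i : T -> R).

Lemma measurable_entries k : measurable_fun setT (entries k).
Proof. by case: k. Qed.

Lemma design_of_entries t : design_of (entries^~ t) = random_mx A t.
Proof. by apply/matrixP => i j; rewrite !mxE. Qed.

Lemma noise_of_entries t : noise_of (entries^~ t) = random_cV xi t.
Proof. by apply/matrixP => i j; rewrite !mxE. Qed.

Lemma condM3_entries (delta M : R) : condM3 A xi delta M ->
  mutually_independent P entries /\ design_moments P (16 + `|M|) entries.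
Proof.
move=> [iAx [iA ix] EV /andP[d0 d1] maxM].
have sm0 : Num.sqrt m%:R != 0 :> R by rewrite gt_eqF// sqrtr_gt0 ltr0n.
have mA0 ij : measurable_fun setT (normalized_mx A ij) by exact: measurable_funM.
have AE ij : (A ij.1 ij.2 : T -> R) = (fun t => (Num.sqrt m%:R)^-1 * normalized_mx A ij t).
  by apply/funext => t; rewrite /normalized_mx mulKf.
split.
  have := mutually_independent_joined iA ix iAx.
  move=> /(mutually_independent_comp (f := fun k : entry m n =>
    if k is inl _ then *%R (Num.sqrt m%:R)^-1 else id)) H.
  have : mutually_independent P (fun k : entry m n =>
      (if k is inl _ then *%R (Num.sqrt m%:R)^-1 else id) \o joined (normalized_mx A) (fun i => xi i : T -> R) k).
    by apply: H => -[ij|i] //; exact: measurable_funM.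
  by congr mutually_independent; apply/funext => -[ij|i] //=; rewrite AE.
move=> ij; have [E0 V1] := EV ij.
apply: (normalized_entry_moments m0 (mA0 ij) (AE ij) d0 E0 V1).
rewrite -maxM; exact: (le_bigmax _ (fun ij => 'E_P[_]%E) ij).
Qed.

Lemma gaussian_design_entries (M : R) : gaussian_design A xi ->
  mutually_independent P (fun i => xi i : T -> R) ->
  mutually_independent P entries /\ design_moments P (16 + `|M|) entries.
Proof.
move=> [iG GN iGx] ix; split; first exact: mutually_independent_joined.
by move=> [i j]; exact: (gaussian_entry_moments m0 M (GN i j)).
Qed.

End joint_entries.

(* P is replaced by its outer measure in the conclusion because the set S is
   arbitrary; the two agree whenever the event is measurable. *)
Theorem theorem3p10 (R : realType) (lambda tau M delta L0 : R) (hL0 : 0 < L0) :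
  exists2 K : R, 0 < K &
  forall (m n : nat) (d : measure_display) (T : measurableType d)
    (P : probability T R)
    (A G : 'I_m -> 'I_n -> {RV P >-> R}) (xi : 'I_m -> {RV P >-> R})
    (psi0 : R -> R) (mu0 : 'cV[R]_n)
    (S : set 'cV[R]_n) (z rho0 eps : R),
    condM1 m n tau lambda ->
    condM2 psi0 L0 ->
    condM3 A xi delta M ->
    gaussian_design G xi ->
    0 < rho0 ->
    0 <= eps < 1 / 4 ->
    (maxe
      (P [set t | min_cost psi0 lambda mu0 (random_mx G t) (random_cV xi t) setT
                  >= (z + rho0)%:E])
      (P [set t | min_cost psi0 lambda mu0 (random_mx G t) (random_cV xi t) S
                  <= (z + 2 * rho0)%:E])
     <= eps%:E)%E ->
    (mu_ext P
      [set t | S (robust_argmin psi0 lambda mu0 (random_mx A t) (random_cV xi t))]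
     <= (4 * eps
         + K * (1 + `|mu0| `^ (6 + delta) + rho0 ^- 3)
             * n%:R `^ (- (Num.min 1 delta / 500)))%:E)%E.
Proof.
(* [K] is chosen before (M1) is available; for inadmissible [tau] or [lambda] the claim is vacuous
   and any [K] serves. *)
have [[tau01 l0]|triv] := pselect (0 < tau < 1 /\ 0 < lambda); last first.
  by exists 1 => // m n d T P A G xi psi0 mu0 S z rho0 eps [? _ ?]; case: triv.
pose M6 := 16 + `|M|.
have M60 : 0 <= M6 by rewrite addr_ge0.
have t0 : 0 < tau by case/andP: tau01.
pose Cm := M6 / tau ^+ 2.
pose Cu := unboxed_const lambda L0.
pose Cs := swap_const tau L0 M6.
pose Ca := approx_const lambda tau L0.
have Cm0 : 0 <= Cm by rewrite divr_ge0// exprn_ge0// ltW.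
have Cu0 : 0 <= Cu.
  rewrite /Cu /unboxed_const !mulr_ge0 ?expR_ge0 ?invr_ge0 ?exprn_ge0//.
  by rewrite divr_ge0 ?mulr_ge0 ?ltW.
have Cs0 : 0 <= Cs.
  rewrite /Cs /swap_const divr_ge0 ?exprn_ge0 ?(ltW t0)//.
  by rewrite !mulr_ge0 ?exprn_ge0 ?addr_ge0 ?(ltW hL0).
have Ca0 : 0 < Ca.
  have := mulr_gt0 l0 (_ : 0 < tau^-1); rewrite invr_gt0 => /(_ t0).
  have : 0 < tau^-1 by rewrite invr_gt0.
  by rewrite /Ca /approx_const; lra.
(* [K1] carries the errors of the main case; [K2] and [K3] make the bound exceed 1 when [mu] is too
   large for the box or [rho] too small for the approximation. *)
pose K1 := 2 * (Cm + Cu + (Cm + Cs)).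
pose K2 : R := 8 `^ (6 + delta).
pose K3 := (16 * Ca) ^+ 3.
have K10 : 0 <= K1 by rewrite /K1; lra.
have K20 : 0 <= K2 by exact: powR_ge0.
have K30 : 0 <= K3 by rewrite exprn_ge0// mulr_ge0// ltW.
exists (K1 + K2 + K3 + 1); first by rewrite ltr_wpDl// addr_ge0// addr_ge0.
move=> m n d T P A G xi psi mu S z rho eps [_ /andP[tmn _] _] M2 M3 GD rho0 /andP[e0 _].
rewrite ge_max => /andP[PT PS].
have [mR nR] : 0 < m%:R :> R /\ 0 < n%:R :> R.
  have := lt_le_trans t0 tmn; case: (m) => [|m']; first by rewrite mul0r ltxx.
  by case: (n) => [|n']; [rewrite invr0 mulr0 ltxx|rewrite !ltr0n].
have m0 : (0 < m)%N by rewrite -(ltr0n R).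
have n0 : (0 < n)%N by rewrite -(ltr0n R).
have [_ [_ ix] _ /andP[d0 d1] _] := M3.
have [psi0 psiL psi_mid] := condM2_lipschitz hL0 M2.
pose y : R := scale n; pose u := y^-1.
have y1 : 1 <= y := scale_ge1 n0; have y0 : 0 < y by exact: lt_le_trans y1.
have u0 : 0 < u by rewrite invr_gt0.
have yu : y * u = 1 by rewrite mulfV// gt_eqF.
set q := n%:R `^ _; set w := `|mu| `^ _.
(* The rate [n^(-1/40)] of the estimates is at most the claimed one, whose exponent is at most 1/500
   in absolute value. *)
have uq : u <= q.
  rewrite /u /y /scale /q -powRN ler_powR ?ler1n// lerN2 (min_idPr (ltW d1)).
  lra.
have w0 : 0 <= w by exact: powR_ge0.
have v0 : 0 < rho ^- 3 by rewrite invr_gt0 exprn_gt0.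
have yp (p : R) : 1 <= p -> forall x, y <= x -> y <= x `^ p.
  move=> p1 x yx; apply: (le_trans yx).
  have x1 := le_trans y1 yx.
  by rewrite -[leLHS]powRr1 ?ler_powR// (le_trans ler01).
have triv1 : 1 <= (K1 + K2 + K3 + 1) * (1 + w + rho ^- 3) * q ->
    (mu_ext P [set t | S (robust_argmin psi lambda mu (random_mx A t) (random_cV xi t))]
     <= (4 * eps + (K1 + K2 + K3 + 1) * (1 + w + rho ^- 3) * q)%:E)%E.
  by move=> H; apply: (le_trans (mu_ext_le1 P _)); rewrite lee_fin; lra.
(* For such a large [mu], [K2 * w = (8 |mu|)^(6 + delta) >= y], and [y] times the rate is at least
   1. *)
have [muy|muy] := ltP (y ^+ 5 / 8) `|mu|.
  apply: triv1; rewrite -yu; apply: ler_pM => //; [exact: ltW|exact: ltW|].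
  apply: (@le_trans _ _ (K2 * w)).
    rewrite /K2 /w -powRM//; apply: yp; first by lra.
    apply: (@le_trans _ _ (y ^+ 5)); first by rewrite -[leLHS]expr1 ler_weXn2l.
    by move: muy; rewrite ltr_pdivrMr// mulrC => /ltW.
  by apply: ler_pM => //; lra.
(* For such a small [rho], [K3 * rho ^- 3] is the cube of a number that is at least [y]. *)
have [approx|approx] := leP (Ca / y) (rho / 16); last first.
  apply: triv1; rewrite -yu; apply: ler_pM => //; [exact: ltW|exact: ltW|].
  apply: (@le_trans _ _ (K3 * rho ^- 3)); last by apply: ler_pM => //; [exact: ltW|lra|lra].
  rewrite /K3 -exprVn -exprMn.
  have yx : y <= 16 * Ca / rho.
    rewrite ler_pdivlMr//; move: approx; rewrite ltr_pdivlMr// mulrAC ltr_pdivrMr//.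
    by move=> /ltW; rewrite [rho * y]mulrC [Ca * _]mulrC.
  apply: (le_trans yx); rewrite -[leLHS]expr1 ler_weXn2l//.
  exact: le_trans yx.
pose X := entries A xi; pose Y := entries G xi.
have [indX momX] := condM3_entries m0 M3.
have [indY momY] := gaussian_design_entries m0 M GD ix.
have t60 : 0 < m%:R^-1 * (Num.sqrt m%:R)^-1 :> R.
  by rewrite mulr_gt0 ?invr_gt0 ?sqrtr_gt0.
have t6E : (m%:R^-1 * (Num.sqrt m%:R)^-1) ^+ 2 = m%:R ^- 3 :> R.
  by rewrite exprMn !exprVn sqr_sqrtr ?ler0n// -invfM -exprSr.
have B0 : 0 < y ^+ 5 by exact: exprn_gt0.
have b1 : 1 <= y ^+ 2 by exact: exprn_ege1.
have r01 : 0 < (n%:R ^- 2 : R) <= 1.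
  by rewrite invr_gt0 exprn_gt0//= invf_le1 ?exprn_gt0// exprn_ege1// ler1n.
have BrK : y ^+ 5 / n%:R ^- 2 <= (n ^ 3)%:R.
  rewrite invrK natrX [leRHS]exprS ler_wpM2r ?exprn_ge0//.
  by rewrite -(@scaleX R n) ler_weXn2l.
have muM j : `|mu j 0| <= `|mu| by exact: mx_norm_ge_entry.
have maxB : `|mu| <= y ^+ 5 by apply: (le_trans muy); move: (y ^+ 5) B0 => B B0; lra.
have dl0 : 0 < rho / 16 by rewrite divr_gt0.
have appr := le_trans (approx_rate m0 n0 hL0 l0 tau01 tmn) approx.
have PT' : (P [set t | ((z + rho)%:E <= cost_inf psi lambda mu setT Y t)%E] <= eps%:E)%E.
  by move: PT; congr (P _ <= _)%E; apply/seteqP; split=> t /=; rewrite /cost_inf design_of_entries noise_of_entries.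
have PS' : (P [set t | (cost_inf psi lambda mu S Y t <= (z + 2 * rho)%:E)%E] <= eps%:E)%E.
  by move: PS; congr (P _ <= _)%E; apply/seteqP; split=> t /=; rewrite /cost_inf design_of_entries noise_of_entries.
have rhoE : rho = 16 * (rho / 16) by rewrite mulrC divfK.
have := argmin_probability m0 hL0 l0 b1 B0 r01 BrK psi0 psiL psi_mid muM maxB M60 t60 t6E dl0 appr
  (measurable_entries A xi) (measurable_entries G xi) indX indY momX momY (fun=> erefl) rhoE PT' PS'.
have -> : [set t | S (robust_argmin psi lambda mu (design_of (X^~ t)) (noise_of (X^~ t)))] =
    [set t | S (robust_argmin psi lambda mu (random_mx A t) (random_cV xi t))].
  by apply/seteqP; split=> t /=; rewrite design_of_entries noise_of_entries.
move=> /le_trans; apply; rewrite lee_fin.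
have H1 := unboxed_rate m0 n0 hL0 l0 M60 tau01 tmn muy.
have H2 := large_entry_rate m0 n0 M60 tau01 tmn.
have H3 := swap_rate m0 n0 hL0 M60 tau01 tmn rho0.
have W1 : 1 <= 1 + w + rho ^- 3 by lra.
have qW : u <= (1 + w + rho ^- 3) * q by rewrite -[leLHS]mul1r ler_pM// ltW.
have D0 : 0 <= rho ^- 3 by exact: ltW.
set err := n%:R * _ + _.
have errle : err <= (Cm + Cu + (Cm + Cs)) * ((1 + w + rho ^- 3) * q).
  apply: (@le_trans _ _ ((Cm + Cu) * u + (Cm * u + Cs * (1 + rho ^- 3) * u))).
    by apply: lerD => //; exact: lerD.
  rewrite (mulrDl (Cm + Cu)) (mulrDl Cm Cs); apply: lerD; first by rewrite ler_wpM2l// addr_ge0.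
  apply: lerD; first by rewrite ler_wpM2l.
  rewrite -mulrA ler_wpM2l//; apply: ler_pM => //; [lra|exact: ltW|lra].
have Wq0 : 0 <= (1 + w + rho ^- 3) * q by exact: le_trans (ltW u0) qW.
rewrite -mulrA; move: (_ * q) Wq0 errle => Wq Wq0 errle.
have : 0 <= (K2 + K3 + 1) * Wq by apply: mulr_ge0 => //; lra.
move: e0; rewrite /K1; nra.
Qed.
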